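(* Let $(X,d,\mu)$ be a locally complete and separable metric measure space, where $\mu$ is a Borel measure on $X$ with $0<\mu(B)<\infty$ for every ball $B=B(x,r)$, $x\in X$, $0<r<\infty$. Let $p\in[1,\infty)$. Then $C(X)\cap N^{1,p}(X)$ is dense in $N^{1,p}(X)$, and every function $f\in N^{1,p}(X)$ is quasicontinuous.
   Context: A metric space is locally complete if every point has a neighborhood that is complete in the restricted metric (equivalently, $X$ is an open subset of its completion). $C(X)$ is the set of continuous functions on $X$. For a rectifiable curve $\gamma$, $\int_\gamma g\,ds$ is the usual path integral, defined via the constant-speed parametrization of $\gamma$ on $[0,1]$. A Borel function $g:X\to[0,\infty]$ is an upper gradient of $f:X\to[-\infty,\infty]$ if for all rectifiable curves $\gamma:[0,1]\to X$ one has $|f(\gamma(1))-f(\gamma(0))|\le\int_\gamma g\,ds$, where the left-hand side is interpreted as $\infty$ if it has the form $|\infty-\infty|$ or $|-\infty-(-\infty)|$. Let $\mathcal D(f)$ be the set of upper gradients of $f$. $N^{1,p}(X)$ is the collection of all (pointwise defined) functions $f\in L^p(X)$ that have an upper gradient $g\in L^p(X)$, with seminorm $$\|f\|_{N^{1,p}(X)}=\Big(\|f\|_{L^p(X)}^p+\inf_{g\in\mathcal D(f)}\|g\|_{L^p(X)}^p\Big)^{1/p}.$$ Density is with respect to this seminorm. For $E\subset X$, $\mathrm{Cap}_p(E)=\inf\{\|u\|_{N^{1,p}(X)}^p : u\in N^{1,p}(X),\ u|_E\ge 1\}$. A function $f:X\to\mathbb R\cup\{\infty,-\infty\}$ is quasicontinuous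 if for every $\epsilon>0$ there is an open set $O\subset X$ with $\mathrm{Cap}_p(O)<\epsilon$ such that $f|_{X\setminus O}$ is continuous. *)

(* Defs.v *)
(* MathComp-Analysis *)
From HB Require Import structures.
From mathcomp Require Import all_boot all_order all_algebra.
From mathcomp Require Import all_classical all_reals all_analysis.
From mathcomp Require Import measurable_realfun.

Set Implicit Arguments.
Unset Strict Implicit.
Unset Printing Implicit Defensive.

Import Order.TTheory GRing.Theory Num.Theory.
Import numFieldNormedType.Exports.

Local Open Scope classical_set_scope.
Local Open Scope ring_scope.

(* Measurable types are pointed in the library, hence so is the space. *)
#[short(type="pmetricType")]
HB.structure Definition PointedMetric (R : numDomainType) :=
  {M of Pointed M & Metric R M}.

Notation borel X := (g_sigma_algebraType (@open X)).

Section metric_notions.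
Context {R : realType} {X : pmetricType R}.
Implicit Types (A : set X) (gamma : R -> X).

Definition complete_set A :=
  forall u : nat -> X, (forall n, A (u n)) -> cauchy (u @ \oo) ->
    exists2 x, A x & u @ \oo --> x.

Definition locally_complete :=
  forall x : X, exists2 U, nbhs x U & complete_set U.

Definition separable := exists2 D : set X, countable D & dense D.

Local Open Scope ereal_scope.

Definition curve_length (a b : R) gamma : \bar R :=
  ereal_sup [set (let F := gamma \o nth b (a :: s) in
    \sum_(0 <= n < size s) mdist (F n) (F n.+1))%R%:E | s in itv_partition a b].

(* A curve [0, 1] -> X is the restriction to [0, 1] of a function R -> X. *)
Definition rectifiable gamma :=
  {within `[0%R, 1%R], continuous gamma} /\ curve_length 0 1 gamma < +oo.

(* The constant-speed parametrization sends t to gamma s, where s is any time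
   at which gamma has run through the fraction t of its length; gamma takes
   the same value at all such times. *)
Definition constant_speed gamma (t : R) : X :=
  gamma (xget 0%R [set s | (0 <= s <= 1)%R /\
    curve_length 0 s gamma = t%:E * curve_length 0 1 gamma]).

Definition path_integral gamma (g : X -> \bar R) : \bar R :=
  curve_length 0 1 gamma *
  \int[lebesgue_measure]_(t in `[0%R, 1%R]) g (constant_speed gamma t).

(* Since +oo - +oo and -oo - -oo are both -oo in the library, the left-hand
   side is +oo in these two cases. *)
Definition upper_gradient (f g : X -> \bar R) :=
  [/\ measurable_fun setT (g : borel X -> \bar R),
      forall x, 0 <= g x &
      forall gamma, rectifiable gamma ->
        `|f (gamma 1%R) - f (gamma 0%R)| <= path_integral gamma g].

End metric_notions.

Arguments locally_complete {R} X.
Arguments separable {R} X.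

Section newtonian.
Context {R : realType} {X : pmetricType R}.
Variables (mu : {measure set (borel X) -> \bar R}) (p : R).
Implicit Types (f g u : X -> \bar R) (E : set X).

Local Open Scope ereal_scope.

(* Functions in L^p are measurable for the completion of mu; the Caratheodory
   sigma-algebra of the outer measure mu^* is this completion as soon as mu is
   sigma-finite. *)
Definition Lp_norm f : \bar R :=
  Lnorm (@completed_measure_extension _ _ _ mu) p%:E
    (f : caratheodory_type (mu^*)%mu -> \bar R).

Definition in_Lp f :=
  measurable_fun setT (f : caratheodory_type (mu^*)%mu -> \bar R) /\
  Lp_norm f < +oo.

Definition in_N1p f := in_Lp f /\ exists2 g, upper_gradient f g & in_Lp g.

Definition N1p_norm f : \bar R :=
  (Lp_norm f `^ p + ereal_inf [set Lp_norm g `^ p | g in upper_gradient f])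
    `^ p^-1.

Definition capacity E : \bar R :=
  ereal_inf [set N1p_norm u `^ p |
    u in [set u | in_N1p u /\ forall x, E x -> 1 <= u x]].

Definition quasicontinuous f :=
  forall e : R, (0 < e)%R -> exists O : set X,
    [/\ open O, capacity O < e%:E & {within ~` O, continuous f}].

Definition continuous_dense_in_N1p :=
  forall f, in_N1p f -> forall e : R, (0 < e)%R ->
    exists h : X -> R, [/\ continuous h, in_N1p (EFin \o h) &
      N1p_norm (fun x => f x - (h x)%:E) < e%:E].

End newtonian.

(* Main.v *)
(* A function with an upper gradient [g] satisfies [|w (c b) - w (c a)| <= l \int_[a, b] g (c t)]
   along every [l]-Lipschitz curve [c], and this form of the condition is stable under sums,
   suprema, contractions, and restriction of [g] to an open set off which [w] vanishes.

   Let [f] be bounded. On a ball with complete closure, [g] is dominated by the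
   lower semicontinuous function [sup_n A_n], where [A_n = kap + \sum_(k < n)
   kap 2^k min(1, n dist(., Q_k))] is continuous and the [Q_k] are totally bounded
   sets exhausting the ball (Vitali-Caratheodory). The infimum [h_n (x)] of
   [F (x_m) + \sum_i A_n (x_i) d(x_i, x_(i+1))] over chains from [x = x_0] with steps at
   most [1/n] is continuous, has [A_n] as upper gradient, and is at most [F]. If [F >= f] is
   lower semicontinuous, then [h_n >= f - del] on a totally bounded closed set [K] on which [f] is
   continuous, once [n] is large: otherwise bad chains converge along an ultrafilter to a
   rectifiable curve violating the upper gradient inequality, because leaving the [Q_k] by a
   fixed amount costs more than the oscillation of [f]. Correcting the error repeatedly gives a
   continuous [h] equal to [f] on [K] (chosen by Lusin's theorem), so that, for a cutoff [phi],
   [phi (f - h)] vanishes off a set of small measure and hence has small norm. A locally finite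
   Lipschitz partition of unity glues these functions, and truncation removes the bound on [f].

   For quasicontinuity, [sup_n h_n] built from a lower semicontinuous [F >= |w|] is a lower
   semicontinuous majorant of [w = phi (f - h)] with small norm. The superlevel sets of these
   majorants are open, have small capacity, and off them [f / (1 + |f|)] is a uniform limit of
   continuous functions. *)
Require Import Defs.
From mathcomp Require Import all_boot all_order all_algebra.
From mathcomp Require Import all_classical all_reals all_analysis.
From mathcomp Require Import measurable_realfun.
From mathcomp Require Import ring lra.
Set Implicit Arguments.
Unset Strict Implicit.
Unset Printing Implicit Defensive.
Import Order.TTheory GRing.Theory Num.Theory.
Import numFieldNormedType.Exports.
Local Open Scope classical_set_scope.
Local Open Scope ring_scope.

(** * Length of curves *)

Section curve_length.
Context {R : realType} {X : pmetricType R}.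
Implicit Types (gamma : R -> X) (a b c : R) (s : seq R).

(** The obstacle is the absence of compactness: closed balls need not be compact, and no Poincare or
    doubling condition is at hand. The density [sup_n A_n] is the substitute. Its floor [kap] bounds
    the lengths of the competing chains, and its growth off the [Q_k] confines them to
    neighbourhoods of totally bounded sets, where local completeness provides limit points. Chains
    replace curves because an infimum over curves is in general not continuous, whereas small jumps
    are available in every direction. The limits of chains are Lipschitz curves with no control on
    their speed, so upper gradients are tested on all Lipschitz curves.

    Functions of the Newtonian space are defined pointwise, so every decomposition has to hold at
    each point. Infinite families are handled through suprema: [sum_j a_j <= sup_j 2^(j+1) a_j], and
    the [p]-th power of a supremum is at most the sum of the [p]-th powers. This replaces
    Minkowski's inequality and limits of upper gradients, at the price of factors [2^(j+1)] which
    the choices of small constants absorb. *)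

Fixpoint chord_sum gamma a s : R :=
  if s is x :: s' then mdist (gamma a) (gamma x) + chord_sum gamma x s' else 0.

Lemma chord_sumE gamma a b s :
  (let F := gamma \o nth b (a :: s) in
    \sum_(0 <= n < size s) mdist (F n) (F n.+1)) = chord_sum gamma a s.
Proof.
elim: s a => [|x s ih] a /=; first by rewrite big_nil.
by rewrite big_nat_recl//= -(ih x).
Qed.

Lemma curve_lengthE a b gamma :
  curve_length a b gamma =
  ereal_sup [set (chord_sum gamma a s)%:E | s in itv_partition a b].
Proof.
rewrite /curve_length; congr ereal_sup; apply/seteqP; split => x [s ps <-];
by exists s => //; rewrite -(chord_sumE gamma a b s).
Qed.

Lemma chord_sum_ge0 gamma a s : 0 <= chord_sum gamma a s.
Proof. by elim: s a => //= x s ih a; rewrite addr_ge0// mdist_ge0. Qed.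

Lemma chord_sum_cat gamma a s t :
  chord_sum gamma a (s ++ t) = chord_sum gamma a s + chord_sum gamma (last a s) t.
Proof. by elim: s a => [|x s ih] a /=; rewrite ?add0r// ih addrA. Qed.

Lemma chord_sum_le_length gamma a b s : itv_partition a b s ->
  ((chord_sum gamma a s)%:E <= curve_length a b gamma)%E.
Proof. by move=> ps; rewrite curve_lengthE; apply: ereal_sup_ubound; exists s. Qed.

Lemma dist_le_curve_length gamma a b : a <= b ->
  ((mdist (gamma a) (gamma b))%:E <= curve_length a b gamma)%E.
Proof.
rewrite le_eqVlt => /predU1P[->|ab].
  rewrite mdistxx -[0]/(chord_sum gamma b [::]).
  by apply: chord_sum_le_length; split=> /=.
rewrite -[mdist _ _]addr0 -[_ + 0]/(chord_sum gamma a [:: b]).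
exact/chord_sum_le_length/itv_partition1.
Qed.

Lemma curve_length_ge0 gamma a b : a <= b -> (0 <= curve_length a b gamma)%E.
Proof.
by move=> ab; apply: le_trans (dist_le_curve_length gamma ab); rewrite lee_fin mdist_ge0.
Qed.

Lemma curve_lengthxx gamma a : curve_length a a gamma = 0%E.
Proof.
apply/eqP; rewrite eq_le curve_length_ge0// andbT curve_lengthE.
by apply: ge_ereal_sup => _ [s /itv_partitionxx-> <-].
Qed.

Lemma curve_length_superadd gamma a b c : a <= b -> b <= c ->
  (curve_length a b gamma + curve_length b c gamma <= curve_length a c gamma)%E.
Proof.
move=> ab bc; have [->|acoo] := eqVneq (curve_length a c gamma) +oo%E; first by rewrite leey.
have acfin : curve_length a c gamma \is a fin_num.
  by rewrite ge0_fin_numE ?curve_length_ge0 ?(le_trans ab)// ltey.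
have key s t : itv_partition a b s -> itv_partition b c t ->
    ((chord_sum gamma a s)%:E + (chord_sum gamma b t)%:E <= curve_length a c gamma)%E.
  move=> ps pt; have := chord_sum_le_length gamma (itv_partition_cat ps pt).
  by rewrite chord_sum_cat EFinD; case: (ps) => _ /eqP ->.
have step s : itv_partition a b s ->
    ((chord_sum gamma a s)%:E + curve_length b c gamma <= curve_length a c gamma)%E.
  move=> ps; rewrite addeC -leeBrDr// [leLHS]curve_lengthE.
  by apply: ge_ereal_sup => _ [t pt <-]; rewrite leeBrDr// addeC; exact: key.
have bcfin : curve_length b c gamma \is a fin_num.
  rewrite ge0_fin_numE ?curve_length_ge0//.
  have [s ps] : exists s, itv_partition a b s.
    move: ab; rewrite le_eqVlt => /predU1P[<-|ab]; first by exists [::]; split => /=.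
    by exists [:: b]; exact: itv_partition1.
  apply: le_lt_trans (_ : curve_length a c gamma < +oo)%E; last by rewrite ltey.
  by apply: le_trans (step _ ps); rewrite leeDr// lee_fin chord_sum_ge0.
rewrite -leeBrDr// curve_lengthE.
by apply: ge_ereal_sup => _ [s ps <-]; rewrite leeBrDr//; exact: step.
Qed.

(** Inserting [b] can only increase the chord sum, by the triangle inequality; this is the half of
    additivity missing from [curve_length_superadd]. *)
Lemma chord_sum_split gamma a b c s : a <= b -> b <= c -> itv_partition a c s ->
  exists s1 s2, [/\ itv_partition a b s1, itv_partition b c s2 &
    chord_sum gamma a s <= chord_sum gamma a s1 + chord_sum gamma b s2].
Proof.
move=> + bc; elim: s a => [|x s ih] a ab ps.
  have ac := itv_partition_nil ps; move: ab bc; rewrite -ac => ab bc.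
  have ->: b = a by apply/eqP; rewrite eq_le ab bc.
  by exists [::], [::]; rewrite /= addr0.
have psx := itv_partition_cons ps.
have ax : a < x by case: ps => /= /andP[].
have [xb|bx] := leP x b.
  have [s1 [s2 [p1 p2 h]]] := ih x xb psx.
  exists (x :: s1), s2; split => //=; last by rewrite -addrA lerD2l.
  by case: p1 => p1 q1; split => //=; rewrite ax.
move: ab; rewrite le_eqVlt => /predU1P[<-|ab].
  by exists [::], (x :: s); rewrite /= add0r.
exists [:: b], (x :: s); split => /=.
- exact: itv_partition1.
- by case: psx => p1 q1; split => //=; rewrite bx.
- by rewrite addr0 addrA lerD2r metric_triangle.
Qed.

Lemma curve_length_add gamma a b c : a <= b -> b <= c ->
  curve_length a c gamma = (curve_length a b gamma + curve_length b c gamma)%E.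
Proof.
move=> ab bc; apply/eqP; rewrite eq_le curve_length_superadd// andbT [leLHS]curve_lengthE.
apply: ge_ereal_sup => _ [s ps <-].
have [s1 [s2 [p1 p2 h]]] := chord_sum_split gamma ab bc ps.
apply: le_trans (_ : ((chord_sum gamma a s1)%:E + (chord_sum gamma b s2)%:E <= _)%E).
  by rewrite -EFinD lee_fin.
by apply: leeD; exact: chord_sum_le_length.
Qed.

Lemma curve_length_lipschitz gamma (l : R) a b : a <= b ->
  (forall x y, a <= x -> x <= y -> y <= b -> mdist (gamma x) (gamma y) <= l * (y - x)) ->
  (curve_length a b gamma <= (l * (b - a))%:E)%E.
Proof.
move=> ab gl; rewrite curve_lengthE; apply: ge_ereal_sup => _ [s ps <-].
rewrite lee_fin; elim: s a ab gl ps => [|x s ih] a ab gl ps /=.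
  by rewrite (itv_partition_nil ps) subrr mulr0.
have psx := itv_partition_cons ps.
have ax : a < x by case: ps => /= /andP[].
have xb : x <= b := itv_partition_le psx.
have -> : l * (b - a) = l * (x - a) + l * (b - x) by ring.
rewrite lerD ?gl ?(ltW ax)//; apply: ih => // y z xy yz zb.
by apply: gl => //; rewrite (le_trans (ltW ax)).
Qed.

End curve_length.

Lemma within_continuous_ballP {R : realType} {T Y : pseudoMetricType R}
    (A : set T) (f : T -> Y) :
  {within A, continuous f} <-> (forall x, A x -> forall e : R, 0 < e ->
    exists2 d : R, 0 < d & forall y, A y -> ball x d y -> ball (f x) e (f y)).
Proof.
rewrite subspace_continuousP; split=> [fA x Ax e e0|fA x Ax].
  have /fA/cvg_ballP/(_ _ e0) := Ax.
  rewrite near_withinE => /nbhs_ballP[d /= d0 dA].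
  by exists d => // y Ay xy; exact: dA.
apply/cvg_ballP => e e0; rewrite near_withinE.
have [d d0 dA] := fA x Ax e e0.
by apply/nbhs_ballP; exists d => //= y xy Ay; exact: dA.
Qed.

(** * Arc length and the constant-speed parametrization *)

Section rectifiable_curves.
Context {R : realType} {X : pmetricType R}.
Variable gamma : R -> X.

(** Take a partition whose chord sum is within [e / 2] of the length, and let [u] be its last point
    before [t]. For [r] between [u] and [t], the length up to [r] is at least the chord sum up to
    [u] plus the distance from [gamma u] to [gamma r]. Hence the length from [r] to [t] is less than
    [e / 2] plus the distance from [gamma r] to [gamma t]. *)
Lemma curve_length_left a t (e : R) : a < t -> 0 < e ->
  (forall e : R, 0 < e -> exists2 d : R, 0 < d &
    forall r, a <= r <= t -> t - r < d -> mdist (gamma r) (gamma t) < e) ->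
  (curve_length a t gamma < +oo)%E ->
  exists2 d : R, 0 < d &
    forall r, a <= r <= t -> t - r < d -> (curve_length r t gamma < e%:E)%E.
Proof.
move=> a_t e0 gc loo; have e20 : 0 < e / 2 by rewrite divr_gt0.
have [d d0 gd] := gc (e / 2) e20.
have lfin : curve_length a t gamma \is a fin_num.
  by rewrite ge0_fin_numE// curve_length_ge0// ltW.
have : (curve_length a t gamma - (e / 2)%:E < curve_length a t gamma)%E.
  by rewrite -(fineK lfin) -EFinB lte_fin ltrBlDr ltrDl.
rewrite [X in (_ < X)%E -> _]curve_lengthE => /ereal_sup_gt[_ [s ps <-]].
have [s' es'] : exists s', s = rcons s' t.
  case/lastP: s ps => [/itv_partition_nil ta|s x [_]]; first by rewrite ta ltxx in a_t.
  by rewrite last_rcons => /eqP ->; exists s.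
move: ps; rewrite {}es' /itv_partition rcons_path => -[/andP[ps ut] _].
set u := last a s' in ut.
have pu : itv_partition a u s' by split.
rewrite -cats1 chord_sum_cat /= addr0 -/u => lt_s.
have au := itv_partition_le pu.
exists (Num.min d (t - u)); first by rewrite lt_min d0 subr_gt0.
move=> r /andP[ar rt]; rewrite lt_min => /andP[trd]; rewrite ltrD2l ltrN2 => ur.
have rt_fin : curve_length r t gamma \is a fin_num.
  rewrite ge0_fin_numE ?curve_length_ge0//; apply: le_lt_trans loo.
  by rewrite (curve_length_add gamma ar rt) leeDr// curve_length_ge0.
have h1 : ((chord_sum gamma a s' + mdist (gamma u) (gamma r))%:E <= curve_length a r gamma)%E.
  rewrite (curve_length_add gamma au (ltW ur)) EFinD leeD ?chord_sum_le_length//.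
  exact/dist_le_curve_length/ltW.
have h2 := gd r; rewrite ar rt in h2; have {}h2 := h2 isT trd.
have h3 := metric_triangle (gamma u) (gamma r) (gamma t).
have ar_fin : curve_length a r gamma \is a fin_num.
  rewrite ge0_fin_numE ?curve_length_ge0//; apply: le_lt_trans loo.
  by rewrite (curve_length_add gamma ar rt) leeDl// curve_length_ge0.
move: lt_s h1; rewrite (curve_length_add gamma ar rt) -(fineK rt_fin) -(fineK ar_fin).
by rewrite -!EFinD !lte_fin lee_fin; lra.
Qed.

Lemma curve_length_right t b (e : R) : t < b -> 0 < e ->
  (forall e : R, 0 < e -> exists2 d : R, 0 < d &
    forall r, t <= r <= b -> r - t < d -> mdist (gamma t) (gamma r) < e) ->
  (curve_length t b gamma < +oo)%E ->
  exists2 d : R, 0 < d &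
    forall r, t <= r <= b -> r - t < d -> (curve_length t r gamma < e%:E)%E.
Proof.
move=> tb e0 gc loo; have e20 : 0 < e / 2 by rewrite divr_gt0.
have [d d0 gd] := gc (e / 2) e20.
have lfin : curve_length t b gamma \is a fin_num.
  by rewrite ge0_fin_numE// curve_length_ge0// ltW.
have : (curve_length t b gamma - (e / 2)%:E < curve_length t b gamma)%E.
  by rewrite -(fineK lfin) -EFinB lte_fin ltrBlDr ltrDl.
rewrite [X in (_ < X)%E -> _]curve_lengthE => /ereal_sup_gt[_ [s ps <-]].
case: s ps => [/itv_partition_nil tb'|u s ps]; first by rewrite tb' ltxx in tb.
have pu := itv_partition_cons ps; have ub := itv_partition_le pu.
have tu : t < u by case: ps => /= /andP[].
move=> /= lt_s.
exists (Num.min d (u - t)); first by rewrite lt_min d0 subr_gt0.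
move=> r /andP[tr rb]; rewrite lt_min => /andP[trd]; rewrite ltrD2r => ru.
have tr_fin : curve_length t r gamma \is a fin_num.
  rewrite ge0_fin_numE ?curve_length_ge0//; apply: le_lt_trans loo.
  by rewrite (curve_length_add gamma tr rb) leeDl// curve_length_ge0.
have rb_fin : curve_length r b gamma \is a fin_num.
  rewrite ge0_fin_numE ?curve_length_ge0//; apply: le_lt_trans loo.
  by rewrite (curve_length_add gamma tr rb) leeDr// curve_length_ge0.
have h1 : ((mdist (gamma r) (gamma u) + chord_sum gamma u s)%:E <= curve_length r b gamma)%E.
  rewrite (curve_length_add gamma (ltW ru) ub) EFinD leeD ?chord_sum_le_length//.
  exact/dist_le_curve_length/ltW.
have h2 := gd r; rewrite tr rb in h2; have {}h2 := h2 isT trd.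
have h3 := metric_triangle (gamma t) (gamma r) (gamma u).
move: lt_s h1; rewrite (curve_length_add gamma tr rb) -(fineK rb_fin) -(fineK tr_fin).
by rewrite -!EFinD !lte_fin lee_fin; lra.
Qed.

Hypothesis rect : rectifiable gamma.

Let len : R := fine (curve_length 0 1 gamma).
Let L (t : R) : R := fine (curve_length 0 t gamma).

Lemma rectifiable_length_fin a b : 0 <= a -> a <= b -> b <= 1 ->
  curve_length a b gamma \is a fin_num.
Proof.
move=> a0 ab b1; rewrite ge0_fin_numE ?curve_length_ge0//.
apply: le_lt_trans rect.2.
rewrite (curve_length_add gamma (le_trans a0 ab) b1) (curve_length_add gamma a0 ab).
apply: le_trans (leeDl _ _); last exact: curve_length_ge0.
by rewrite leeDr// curve_length_ge0.
Qed.

Lemma rectifiable_lengthE : curve_length 0 1 gamma = len%:E.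
Proof. by rewrite fineK// rectifiable_length_fin. Qed.

Lemma rectifiable_length_ge0 : 0 <= len.
Proof. by rewrite fine_ge0// curve_length_ge0. Qed.

Let LE t : 0 <= t -> t <= 1 -> curve_length 0 t gamma = (L t)%:E.
Proof. by move=> t0 t1; rewrite fineK// rectifiable_length_fin. Qed.

Let LD s t : 0 <= s -> s <= t -> t <= 1 -> curve_length s t gamma = (L t - L s)%:E.
Proof.
move=> s0 st t1; have := curve_length_add gamma s0 st.
rewrite !LE// ?(le_trans _ t1)// ?(le_trans s0)//.
have := rectifiable_length_fin s0 st t1; case: curve_length => // r _ [->].
by congr (_%:E); ring.
Qed.

Lemma arc_length_dist s t : 0 <= s -> s <= t -> t <= 1 ->
  mdist (gamma s) (gamma t) <= L t - L s.
Proof. by move=> s0 st t1; rewrite -lee_fin -LD//; exact: dist_le_curve_length. Qed.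

Lemma arc_length_continuous : {within `[0, 1], continuous L}.
Proof.
have gc := (within_continuous_ballP _ _).1 rect.1.
apply/within_continuous_ballP => t /=; rewrite in_itv/= => /andP[t0 t1] e e0.
have [d1 d10 h1] : exists2 d : R, 0 < d &
    forall r, 0 <= r <= t -> t - r < d -> L t - L r < e.
  move: t0; rewrite le_eqVlt => /predU1P[<-|t0].
    exists 1 => // r; rewrite -eq_le => /eqP <- _; by rewrite subrr.
  have [|| d d0 h] := curve_length_left t0 e0.
  - move=> e' e'0; have [|d d0 h] := gc t _ e' e'0; first by rewrite /= in_itv/= (ltW t0) t1.
    exists d => // r /andP[r0 rt] rd; rewrite metric_sym.
    have : ball (gamma t) e' (gamma r); last by rewrite ballEmdist.
    apply: h; first by rewrite /= in_itv/= r0 (le_trans rt).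
    by rewrite /ball/= ger0_norm// subr_ge0.
  - by rewrite ltey_eq rectifiable_length_fin// ltW.
  - exists d => // r /andP[r0 rt] rd.
    by rewrite -lte_fin -LD// h// r0 rt.
have [d2 d20 h2] : exists2 d : R, 0 < d &
    forall r, t <= r <= 1 -> r - t < d -> L r - L t < e.
  move: t1; rewrite le_eqVlt => /predU1P[->|t1].
    by exists 1 => // r; rewrite -eq_le => /eqP <- _; rewrite subrr.
  have [|| d d0 h] := curve_length_right t1 e0.
  - move=> e' e'0; have [|d d0 h] := gc t _ e' e'0; first by rewrite /= in_itv/= (ltW t1) t0.
    exists d => // r /andP[r0 rt] rd.
    have : ball (gamma t) e' (gamma r); last by rewrite ballEmdist.
    apply: h; first by rewrite /= in_itv/= rt andbT (le_trans t0).
    by rewrite /ball/= distrC ger0_norm// subr_ge0.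
  - by rewrite ltey_eq rectifiable_length_fin// ltW.
  - exists d => // r /andP[r0 rt] rd.
    by rewrite -lte_fin -LD// h// r0 rt.
exists (Num.min d1 d2); first by rewrite lt_min d10.
move=> r; rewrite /= in_itv/= => /andP[r0 r1].
rewrite /ball /= lt_min => /andP[rd1 rd2].
have [rt|tr] := leP r t.
  have := arc_length_dist r0 rt t1; have := mdist_ge0 (gamma r) (gamma t).
  move=> /le_trans/[apply] Lrt; rewrite ger0_norm//; apply: h1; first by rewrite r0.
  by rewrite ger0_norm ?subr_ge0// in rd1.
have := arc_length_dist t0 (ltW tr) r1; have := mdist_ge0 (gamma t) (gamma r).
move=> /le_trans/[apply] Lrt; rewrite distrC ger0_norm//; apply: h2; first by rewrite r1 ltW.
by rewrite distrC ger0_norm ?subr_ge0// in rd2; exact: ltW.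
Qed.

(** By the intermediate value theorem for the arc length, the set from which [constant_speed] picks
    a time is nonempty, so the default time 0 of [xget] never intervenes. *)
Lemma constant_speedP u : 0 <= u <= 1 ->
  exists2 s, 0 <= s <= 1 & L s = u * len /\ constant_speed gamma u = gamma s.
Proof.
move=> /andP[u0 u1]; have := @IVT R L 0 1 (u * len) ler01 arc_length_continuous.
have L0 : L 0 = 0 by rewrite /L curve_lengthxx.
have L1 : L 1 = len by [].
have l0 := rectifiable_length_ge0.
rewrite L0 L1 min_l// max_r// mulr_ge0//= ler_piMl// => /(_ isT)[s].
rewrite in_itv/= => /andP[s0 s1] Ls.
rewrite /constant_speed; case: xgetP => [x _ [x01]|/(_ s)]; last first.
  by case; rewrite /= (LE s0 s1) rectifiable_lengthE -EFinM Ls s0 s1.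
have /andP[x0 x1] := x01.
by rewrite rectifiable_lengthE -EFinM (LE x0 x1) => -[Lx]; exists x.
Qed.

Lemma constant_speed_lipschitz u v : 0 <= u <= 1 -> 0 <= v <= 1 ->
  mdist (constant_speed gamma u) (constant_speed gamma v) <= len * `|u - v|.
Proof.
have l0 := rectifiable_length_ge0.
move=> /constant_speedP[s /andP[s0 s1] [Ls ->]] /constant_speedP[t /andP[t0 t1] [Lt ->]].
rewrite -[X in X * _]ger0_norm// -normrM mulrC mulrBl -Ls -Lt.
have [st|ts] := leP s t.
  by rewrite distrC (le_trans (arc_length_dist s0 st t1))// ler_norm.
by rewrite metric_sym (le_trans (arc_length_dist t0 (ltW ts) s1))// ler_norm.
Qed.

(* The arc-length parameter runs over a constant stretch of the curve only. *)
Lemma constant_speed_arc_length t : 0 <= t <= 1 -> 0 < len ->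
  constant_speed gamma (L t / len) = gamma t.
Proof.
move=> /andP[t0 t1] len0.
have Lt0 : 0 <= L t by rewrite fine_ge0// curve_length_ge0.
have Lt1 : L t <= len.
  rewrite -subr_ge0 (le_trans _ (arc_length_dist t0 t1 (lexx _)))//.
  exact: mdist_ge0.
have [|s /andP[s0 s1] [Ls ->]] := @constant_speedP (L t / len).
  by rewrite divr_ge0//= ?ler_pdivrMr ?mul1r// ltW.
move: Ls; rewrite divfK ?gt_eqF// => Ls; apply: mdist_positivity.
apply/eqP; rewrite eq_le mdist_ge0 andbT; have [st|ts] := leP s t.
  by rewrite (le_trans (arc_length_dist s0 st t1))// Ls subrr.
by rewrite metric_sym (le_trans (arc_length_dist t0 (ltW ts) s1))// Ls subrr.
Qed.

Lemma constant_speed0 : constant_speed gamma 0 = gamma 0.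
Proof.
have [|s /andP[s0 s1] [Ls ->]] := @constant_speedP 0; first by rewrite lexx ler01.
apply/esym/mdist_positivity/eqP; rewrite eq_le mdist_ge0 andbT.
by rewrite (le_trans (arc_length_dist (lexx _) s0 s1))// Ls mul0r /L curve_lengthxx subrr.
Qed.

Lemma constant_speed1 : constant_speed gamma 1 = gamma 1.
Proof.
have [|s /andP[s0 s1] [Ls ->]] := @constant_speedP 1; first by rewrite lexx ler01.
apply/mdist_positivity/eqP; rewrite eq_le mdist_ge0 andbT.
by rewrite (le_trans (arc_length_dist s0 s1 (lexx _)))// Ls mul1r subrr.
Qed.

End rectifiable_curves.

(** * Capped distance to a set *)

Section capped_distance.
Context {R : realType} {X : pmetricType R}.
Implicit Types (A : set X) (x y : X).

(* The cap makes the distance to the empty set the constant 1. *)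
Definition cdist A x : R := inf ([set 1] `|` [set mdist x a | a in A]).

Let has_lb A x : has_lbound ([set 1] `|` [set mdist x a | a in A]).
Proof. by exists 0 => _ [->|[a _ <-]]//; exact: mdist_ge0. Qed.

Let nonempty A x : [set 1] `|` [set mdist x a | a in A] !=set0.
Proof. by exists 1; left. Qed.

Lemma cdist_ge0 A x : 0 <= cdist A x.
Proof.
by apply: lb_le_inf; [exact: nonempty|move=> _ [->|[a _ <-]]//; exact: mdist_ge0].
Qed.

Lemma cdist_le1 A x : cdist A x <= 1.
Proof. by apply: ge_inf; [exact: has_lb|left]. Qed.

Lemma cdist_le A x a : A a -> cdist A x <= mdist x a.
Proof. by move=> Aa; apply: ge_inf; [exact: has_lb|right; exists a]. Qed.

Lemma cdist_lipschitz A x y : cdist A x <= cdist A y + mdist x y.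
Proof.
rewrite -lerBlDr; apply: lb_le_inf; first exact: nonempty.
move=> _ [->|[a Aa <-]]; rewrite lerBlDr.
  by rewrite (le_trans (cdist_le1 A x))// lerDl mdist_ge0.
by rewrite (le_trans (cdist_le x Aa))// addrC metric_triangle.
Qed.

Lemma cdist_lipschitz_norm A x y : `|cdist A x - cdist A y| <= mdist x y.
Proof.
rewrite ler_norml lerBlDl cdist_lipschitz andbT lerNl opprB lerBlDl metric_sym.
exact: cdist_lipschitz.
Qed.

Lemma cdist_lt A x (r : R) : cdist A x < r -> r <= 1 -> exists2 a, A a & mdist x a < r.
Proof.
move=> /inf_lt-/(_ (nonempty A x))[_ [->|[a Aa <-]]] ar r1; last by exists a.
by move: (lt_le_trans ar r1); rewrite ltxx.
Qed.

Lemma cdist_eq0 A x : A x -> cdist A x = 0.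
Proof.
by move=> Ax; apply/eqP; rewrite eq_le cdist_ge0 andbT (le_trans (cdist_le x Ax))// mdistxx.
Qed.

Lemma cdist_gt0 A x : closed A -> ~ A x -> 0 < cdist A x.
Proof.
move=> cA Ax; have /nbhs_ballP[e /= e0 eA] : nbhs x (~` A).
  by apply: open_nbhs_nbhs; split => //; exact: closed_openC.
apply: lt_le_trans (_ : Num.min 1 e <= _); first by rewrite lt_min ltr01.
apply: lb_le_inf; first exact: nonempty.
move=> _ [->|[a Aa <-]]; first by rewrite ge_min lexx.
rewrite ge_min; apply/orP; right; rewrite leNgt; apply/negP => xa.
by apply: (eA a) => //; rewrite ballEmdist.
Qed.

Lemma lipschitz_continuous (f : X -> R) (k : R) :
  (forall x y, `|f x - f y| <= k * mdist x y) -> continuous f.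
Proof.
move=> fk x; apply/cvg_ballP => e e0.
apply/nbhs_ballP; exists (e / (`|k| + 1)) => /=; first by rewrite divr_gt0// ltr_wpDl.
move=> y; rewrite ballEmdist /ball/= ltr_pdivlMr ?ltr_wpDl// => xy.
apply: le_lt_trans (fk x y) _; apply: le_lt_trans xy; rewrite mulrC ler_wpM2l ?mdist_ge0//.
by rewrite (le_trans (ler_norm k))// lerDl.
Qed.

Lemma closed_superlevel (f : X -> R) a : continuous f -> closed [set x | a <= f x].
Proof.
move=> cf; rewrite -[X in closed X]setCK; apply: open_closedC.
rewrite [X in open X](_ : _ = f @^-1` [set y | y < a]); last first.
  by apply/seteqP; split => x /=; rewrite ltNge => /negP.
by apply: open_comp => [x _|]; [exact: cf|exact: open_lt].
Qed.

Lemma cdist_continuous A : continuous (cdist A).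
Proof. by apply: (@lipschitz_continuous _ 1) => x y; rewrite mul1r cdist_lipschitz_norm. Qed.

End capped_distance.

(** * Borel sets and regularity of finite Borel measures *)

Section borel.
Context {R : realType} {X : pmetricType R}.

Lemma open_borel (U : set X) : open U -> measurable (U : set (borel X)).
Proof. by move=> oU; exact: sub_sigma_algebra. Qed.

Lemma closed_borel (U : set X) : closed U -> measurable (U : set (borel X)).
Proof.
by move=> cU; rewrite -(setCK U); apply: measurableC; apply: open_borel; exact: closed_openC.
Qed.

Lemma continuous_borel (f : X -> R) : continuous f ->
  measurable_fun setT (f : borel X -> R).
Proof.
move=> cf; apply: (measurability _ (RGenOpens.measurableE R)).
move=> _ [_ [a [b ->]] <-]; rewrite setTI; apply: open_borel.
by apply: open_comp => // x _; exact: cf.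
Qed.

Lemma continuous_curve_borel (c : R -> X) : continuous c ->
  measurable_fun setT (c : R -> borel X).
Proof.
move=> cc; apply: (@measurability _ _ _ (borel X) setT c (@open X)) => //.
move=> _ [U oU <-]; rewrite setTI; apply: open_measurable.
by apply: open_comp => // x _; exact: cc.
Qed.

(** The sets with this property form a sigma-algebra, and an open set belongs to it because the
    closed sets at distance at least [1 / (n + 1)] from its complement exhaust it. For a countable
    union only finitely many of the inner closed sets are kept, so that their union is closed;
    finiteness of [m] makes the loss small. *)
Lemma finite_borel_regular (m : {measure set (borel X) -> \bar R}) :
  (m setT < +oo)%E -> forall E : set (borel X), measurable E ->
  forall e : R, 0 < e -> exists Q U : set X,
    [/\ closed Q, open U, Q `<=` E, E `<=` U & (m (U `\` Q) < e%:E)%E].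
Proof.
move=> mfin.
have mfin' A : measurable A -> m A \is a fin_num.
  move=> mA; rewrite ge0_fin_numE//; apply: le_lt_trans mfin.
  by apply: le_measure; rewrite ?inE.
pose S := [set E : set (borel X) | forall e : R, 0 < e -> exists Q U : set X,
    [/\ closed Q, open U, Q `<=` E, E `<=` U & (m (U `\` Q) < e%:E)%E]].
suff : <<s (@open X) >> `<=` S by move=> h E mE; exact: (h E mE).
have decr (F : (set (borel X))^nat) : (forall n, measurable (F n)) ->
    nonincreasing_seq F -> \bigcap_n F n = set0 -> forall e : R, 0 < e ->
    exists n, (m (F n) < e%:E)%E.
  move=> mF dF F0 e e0.
  have := @nonincreasing_cvg_mu _ _ _ m F; rewrite F0 measure0.
  move=> /(_ _ mF measurable0 dF) h.
  have /fine_cvgP[_ /cvgrPdist_lt/(_ e e0)[N _ /(_ N (leqnn N))]] : m \o F @ \oo --> 0%:E.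
    by apply: h; apply: le_lt_trans mfin; apply: le_measure; rewrite ?inE.
  rewrite /= sub0r normrN ger0_norm ?fine_ge0// => h'; exists N.
  by rewrite -(fineK (mfin' _ (mF N))) lte_fin.
apply: smallest_sub; last first.
  move=> U oU e e0.
  pose F n : set (borel X) := U `\` [set x | n.+1%:R^-1 <= cdist (~` U) x].
  have cF n : closed [set x : X | n.+1%:R^-1 <= cdist (~` U) x].
    exact/closed_superlevel/cdist_continuous.
  have [||| n mn] := decr F _ _ _ e e0.
  - by move=> n; apply: measurableD; [exact: open_borel|exact: closed_borel].
  - move=> n k nk; apply/subsetPset => x [Ux /= h]; split => // h'; apply: h.
    by apply: le_trans h'; rewrite lef_pV2 ?posrE// ler_nat ltnS.
  - rewrite -subset0 => x Fx; have Ux := (Fx 0%N I).1.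
    have := @cdist_gt0 _ _ (~` U) x (open_closedC oU) (fun f => f Ux).
    move=> /ltr_add_invr[k]; rewrite add0r => hk.
    by apply: (Fx k I).2; exact: ltW.
  exists [set x | n.+1%:R^-1 <= cdist (~` U) x], U; split => //= x /=.
  move=> h; apply: contrapT => Ux; move: h; rewrite cdist_eq0//.
  by rewrite leNgt invr_gt0 ltr0n.
split.
- move=> e e0; exists set0, set0.
  split; [exact: closed0|exact: open0|by []|by []|by rewrite setD0 measure0].
- move=> A SA e e0; have [Q [U [cQ oU QA AU h]]] := SA e e0.
  exists (~` U), (~` Q); split.
  + exact: open_closedC.
  + exact: closed_openC.
  + by rewrite setTD; exact: subsetC.
  + by rewrite setTD; exact: subsetC.
  + by rewrite setDE setCK setIC -setDE.
- move=> A SA e e0.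
  have pe i : 0 < e / 2 / (2 ^ i.+1)%:R by rewrite !divr_gt0// ltr0n expn_gt0.
  have /choice[Q /(_ _)/cid-/all_sig[U H]] := fun i => SA i _ (pe i).
  have mU i : measurable (U i : set (borel X)) by apply: open_borel; case: (H i).
  have mQ i : measurable (Q i : set (borel X)) by apply: closed_borel; case: (H i).
  pose F n : set (borel X) := \bigcup_i Q i `\` \bigcup_(i < n) Q i.
  have e20 : 0 < e / 2 by rewrite divr_gt0.
  have mUQ : measurable (\bigcup_i Q i : set (borel X)) by exact: bigcup_measurable.
  have mUQn n : measurable (\bigcup_(i < n) Q i : set (borel X)) by exact: bigcup_measurable.
  have [||| n mn] := decr F _ _ _ _ e20.
  - by move=> n; apply: measurableD.
  - move=> n k nk; apply/subsetPset => x [Ux h]; split => // -[i /= ik Qx]; apply: h.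
    by exists i => //=; exact: leq_trans nk.
  - rewrite -subset0 => x Fx; have [i _ Qi] := (Fx 0%N I).1.
    by apply: (Fx i.+1 I).2; exists i => /=.
  exists (\bigcup_(i < n) Q i), (\bigcup_i U i); split.
  + by rewrite bigcup_mkord; apply: closed_bigsetU => i _; case: (H i).
  + by apply: bigcup_open => i _; case: (H i).
  + by move=> x [i _ Qx]; exists i => //; case: (H i) => _ _ + _ _; exact.
  + by move=> x [i _ Qx]; exists i => //; case: (H i) => _ _ _ + _; exact.
  have sub : (\bigcup_i U i) `\` \bigcup_(i < n) Q i `<=`
      (\bigcup_i (U i `\` Q i)) `|` F n.
    move=> x [[i _ Ux] nQ]; have [Qx|nQx] := pselect (Q i x); last by left; exists i.
    by right; split => //; exists i.
  have mD : measurable (\bigcup_i (U i `\` Q i) : set (borel X)).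
    by apply: bigcup_measurable => i _; exact: measurableD.
  apply: le_lt_trans (_ : (m (\bigcup_i (U i `\` Q i)) + m (F n) < _)%E).
    apply: le_trans (measureU2 _ _ _) => //; last exact: measurableD.
    apply: le_measure; rewrite ?inE//.
    + by apply: measurableD => //; exact: bigcup_measurable.
    + by apply: measurableU => //; exact: measurableD.
  rewrite [e]splitr EFinD; apply: lee_ltD => //; [exact: mfin'|].
  apply: le_trans (@measure_sigma_subadditive _ _ _ m _ (fun i => U i `\` Q i) _ _ _) _ => //.
    by move=> i; exact: measurableD.
  apply: le_trans (_ : (\sum_(0 <= i <oo) (e / 2 / (2 ^ i.+1)%:R)%:E <= _)%E).
    apply: lee_nneseries => // i _; apply/ltW; by case: (H i).
  by apply: epsilon_trick0; exact: ltW.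
Qed.

End borel.

(** * Comparison of increments and integrals over segments *)

Section increments.
Context {R : realType}.

(** When [a, b] is cut into [N] equal steps, the quadratic errors add up to at most
    [|C| (b - a)^2 / N]. The lemma stands in for differentiation and for changes of variables: two
    functions are compared from local estimates alone. *)
Lemma increments_le (P Q : R -> R) (a b C d : R) : a <= b -> 0 < d ->
  (forall s t, a <= s -> s <= t -> t <= b -> t - s < d ->
    P t - P s <= Q t - Q s + C * (t - s) ^+ 2) ->
  P b - P a <= Q b - Q a.
Proof.
move=> ab d0 PQ; apply/ler_addgt0Pr => e e0.
(* The first summand makes the accumulated error at most [e], the second makes the steps shorter
   than [d]. *)
pose N := (Num.bound (`|C| * (b - a) ^+ 2 / e) + Num.bound ((b - a) / d)).+1.
have N0 : (0 : R) < N%:R by rewrite ltr0n.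
have ba0 : 0 <= b - a by rewrite subr_ge0.
have N1 : `|C| * (b - a) ^+ 2 / e <= N%:R.
  rewrite (le_trans (ltW (archi_boundP _)))// ?ler_nat.
    by rewrite divr_ge0 ?mulr_ge0 ?exprn_ge0// ltW.
  by rewrite /N -addnS leq_addr.
have N2 : (b - a) / d < N%:R.
  rewrite (lt_le_trans (archi_boundP _))// ?ler_nat; first by rewrite divr_ge0// ltW.
  by rewrite /N -addSn leq_addl.
pose h := (b - a) / N%:R.
have h0 : 0 <= h by rewrite divr_ge0// ltW.
have hd : h < d by rewrite /h ltr_pdivrMr// mulrC -ltr_pdivrMr.
have key k : (k <= N)%N -> P (a + k%:R * h) - P a <=
    Q (a + k%:R * h) - Q a + k%:R * (`|C| * h ^+ 2).
  elim: k => [|k ih] kN; first by rewrite !mul0r !addr0 !subrr.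
  have {}ih := ih (ltnW kN).
  have Nh : N%:R * h = b - a by rewrite /h mulrC divfK// gt_eqF.
  have := PQ (a + k%:R * h) (a + k.+1%:R * h).
  have e1 : a + k.+1%:R * h - (a + k%:R * h) = h by rewrite -natr1; ring.
  rewrite e1 => /(_ _ _ _ hd) st.
  have {}st := st _ _ _.
  have : P (a + k.+1%:R * h) - P (a + k%:R * h) <=
     Q (a + k.+1%:R * h) - Q (a + k%:R * h) + C * h ^+ 2.
    apply: st.
    - by rewrite lerDl mulr_ge0.
    - by rewrite lerD2l ler_wpM2r// ler_nat.
    - have : k.+1%:R * h <= N%:R * h by rewrite ler_wpM2r// ler_nat.
      by rewrite Nh; lra.
  have : C * h ^+ 2 <= `|C| * h ^+ 2 by rewrite ler_wpM2r ?sqr_ge0// ler_norm.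
  by rewrite -natr1 mulrDl mul1r; lra.
have := key N (leqnn _).
have -> : a + N%:R * h = b by rewrite /h mulrC divfK ?gt_eqF//; ring.
move=> /le_trans; apply; rewrite lerD2l.
have -> : N%:R * (`|C| * h ^+ 2) = `|C| * (b - a) ^+ 2 / N%:R.
  by rewrite /h; field; rewrite gt_eqF.
by rewrite ler_pdivrMr// [e * _]mulrC -ler_pdivrMr.
Qed.

End increments.

Section segment_integral.
Context {R : realType}.
Local Notation mu := (@lebesgue_measure R).
Local Open Scope ereal_scope.

Lemma segment_measurable (a b : R) : measurable (`[a, b]%classic : set R).
Proof. exact: measurable_itv. Qed.

Lemma segment_integral_split (f : R -> \bar R) (a s b : R) :
  measurable_fun setT f -> (forall x, 0 <= f x) -> (a <= s)%R -> (s <= b)%R ->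
  \int[mu]_(t in `[a, b]) f t =
  \int[mu]_(t in `[a, s]) f t + \int[mu]_(t in `[s, b]) f t.
Proof.
move=> mf f0 as_ sb.
have -> : (`[a, b]%classic : set R) = `[a, s]%classic `|` `]s, b]%classic.
  by rewrite -itv_bndbnd_setU.
rewrite ge0_integral_setU//=; [|exact: measurable_funTS|].
  by congr (_ + _); apply: integral_itv_obnd_cbnd; exact: measurable_funTS.
by apply/disj_setPS => x /=; rewrite !in_itv/= => -[/andP[_ xs] /andP[]]; rewrite ltNge xs.
Qed.

Lemma segment_integral_le (f : R -> \bar R) (a b M : R) : (a <= b)%R ->
  measurable_fun setT f -> (forall x, 0 <= f x) ->
  (forall x, (a <= x <= b)%R -> f x <= M%:E) ->
  \int[mu]_(t in `[a, b]) f t <= (M * (b - a))%:E.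
Proof.
move=> ab mf f0 fM; have M0 : (0 <= M)%R.
  by rewrite -lee_fin (le_trans (f0 a))// fM// lexx.
apply: le_trans (_ : \int[mu]_(t in `[a, b]) cst M%:E t <= _).
  apply: ge0_le_integral => //; first exact: measurable_funTS.
rewrite integral_cst//= lebesgue_measure_itv/= lte_fin; case: ltP => [_|ba].
  by rewrite EFinM EFinB.
have -> : b = a by apply/eqP; rewrite eq_le ab ba.
by rewrite subrr mulr0 mule0.
Qed.

Lemma segment_integral_ge (f : R -> \bar R) (a b m : R) : (a <= b)%R -> (0 <= m)%R ->
  measurable_fun setT f -> (forall x, 0 <= f x) ->
  (forall x, (a <= x <= b)%R -> m%:E <= f x) ->
  (m * (b - a))%:E <= \int[mu]_(t in `[a, b]) f t.
Proof.
move=> ab m0 mf f0 fM.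
apply: le_trans (_ : \int[mu]_(t in `[a, b]) cst m%:E t <= _); last first.
  apply: ge0_le_integral => //; first exact: measurable_funTS.
rewrite integral_cst//= lebesgue_measure_itv/= lte_fin; case: ltP => [_|ba].
  by rewrite EFinM EFinB.
have -> : b = a by apply/eqP; rewrite eq_le ab ba.
by rewrite subrr mulr0 mule0.
Qed.

End segment_integral.

Section clamp.
Context {R : realType}.
Definition clamp (a b t : R) : R := Num.max a (Num.min b t).

Lemma clamp_itv a b t : a <= b -> a <= clamp a b t <= b.
Proof. by move=> ab; rewrite /clamp le_max lexx ge_max ab ge_min lexx. Qed.

Lemma clamp_id a b t : a <= t <= b -> clamp a b t = t.
Proof. by move=> /andP[a_t tb]; rewrite /clamp min_r// max_r. Qed.

Lemma dist_max_le (a x y : R) : `|Num.max a x - Num.max a y| <= `|x - y|.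
Proof. by case: (leP a x) (leP a y) => ? [] ?; rewrite ler_norml; case: (ger0P (x - y)) => ?; lra. Qed.

Lemma dist_min_le (a x y : R) : `|Num.min a x - Num.min a y| <= `|x - y|.
Proof. by case: (leP a x) (leP a y) => ? [] ?; rewrite ler_norml; case: (ger0P (x - y)) => ?; lra. Qed.

Lemma clamp_lipschitz a b s t : `|clamp a b s - clamp a b t| <= `|s - t|.
Proof. exact: le_trans (dist_max_le _ _ _) (dist_min_le _ _ _). Qed.
End clamp.

Section primitive.
Context {R : realType}.
Local Notation mu := (@lebesgue_measure R).
Variables (phi : R -> R) (B : R).
Hypothesis mphi : measurable_fun setT phi.
Hypothesis phiB : forall t, 0 <= phi t <= B.

Definition primitive a t : R := fine (\int[mu]_(x in `[a, t]) (phi x)%:E)%E.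

Let mE : measurable_fun setT (EFin \o phi).
Proof. exact/measurable_EFinP. Qed.

Lemma primitive_fin a t : a <= t -> (\int[mu]_(x in `[a, t]) (phi x)%:E)%E \is a fin_num.
Proof.
move=> a_t; rewrite ge0_fin_numE; last first.
  by apply: integral_ge0 => x _; rewrite lee_fin; case/andP: (phiB x).
apply: le_lt_trans (_ : (B * (t - a))%:E < _)%E; last by rewrite ltry.
apply: (segment_integral_le a_t mE) => x *; rewrite lee_fin; by case/andP: (phiB x).
Qed.

Lemma primitiveE a t : a <= t -> (primitive a t)%:E = (\int[mu]_(x in `[a, t]) (phi x)%:E)%E.
Proof. by move=> a_t; rewrite fineK// primitive_fin. Qed.

Lemma primitivexx a : primitive a a = 0.
Proof. by rewrite /primitive set_itv1 integral_set1. Qed.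

Lemma primitiveB a s t : a <= s -> s <= t ->
  (primitive a t - primitive a s)%:E = (\int[mu]_(x in `[s, t]) (phi x)%:E)%E.
Proof.
move=> as_ st; have ph0 x : (0 <= (phi x)%:E)%E by rewrite lee_fin; case/andP: (phiB x).
rewrite EFinB !primitiveE// ?(le_trans as_)// (segment_integral_split mE ph0 as_ st).
by rewrite [X in (X - _)%E]addeC addeK// primitive_fin.
Qed.

Lemma primitive_le a s t M : a <= s -> s <= t -> (forall x, s <= x <= t -> phi x <= M) ->
  primitive a t - primitive a s <= M * (t - s).
Proof.
move=> as_ st pM; rewrite -lee_fin primitiveB//; apply: (segment_integral_le st mE).
  by move=> x; rewrite lee_fin; case/andP: (phiB x).
by move=> x /pM; rewrite lee_fin.
Qed.

Lemma primitive_ge a s t m : a <= s -> s <= t -> 0 <= m ->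
  (forall x, s <= x <= t -> m <= phi x) -> m * (t - s) <= primitive a t - primitive a s.
Proof.
move=> as_ st m0 pM; rewrite -lee_fin primitiveB//; apply: (segment_integral_ge st m0 mE).
  by move=> x; rewrite lee_fin; case/andP: (phiB x).
by move=> x /pM; rewrite lee_fin.
Qed.

End primitive.

(** * Upper gradients tested on Lipschitz curves *)

Section lipschitz_curves.
Context {R : realType} {X : pmetricType R}.
Local Notation mu := (@lebesgue_measure R).

Definition lipschitz_curve (l : R) (c : R -> X) :=
  forall s t, mdist (c s) (c t) <= l * `|s - t|.

Lemma lipschitz_curve_continuous l c : lipschitz_curve l c -> continuous c.
Proof.
move=> cl t; apply/cvg_ballP => e e0.
apply/nbhs_ballP; exists (e / (`|l| + 1)) => /=; first by rewrite divr_gt0// ltr_wpDl.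
move=> y; rewrite ballEmdist /ball/= ltr_pdivlMr ?ltr_wpDl// => xy.
apply: le_lt_trans (cl t y) _; apply: le_lt_trans xy; rewrite mulrC ler_wpM2l//.
by rewrite (le_trans (ler_norm l))// lerDl.
Qed.

Lemma curve_comp_measurable l c (G : X -> \bar R) : lipschitz_curve l c ->
  measurable_fun setT (G : borel X -> \bar R) -> measurable_fun setT (G \o c).
Proof.
move=> cl mG; apply: (@measurableT_comp _ _ _ _ (borel X)) => //.
exact: continuous_curve_borel (lipschitz_curve_continuous cl).
Qed.

(* Quantifying over all subintervals of Lipschitz curves of any constant makes
   the condition stable under restriction and avoids reparametrization. *)
Definition lip_upper_gradient (w : X -> R) (G : X -> \bar R) :=
  forall l c a b, 0 <= l -> lipschitz_curve l c -> a <= b ->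
  (`|w (c b) - w (c a)|%:E <= l%:E * \int[mu]_(t in `[a, b]) G (c t))%E.

Definition borel_nonneg (G : X -> \bar R) :=
  measurable_fun setT (G : borel X -> \bar R) /\ forall x, (0 <= G x)%E.

(** Clamping the time to [0, 1] extends the constant-speed parametrization to a curve on the whole
    line that is Lipschitz with the length of [gamma] as constant. *)
Lemma upper_gradient_of_lip (w : X -> R) G : borel_nonneg G ->
  lip_upper_gradient w G -> upper_gradient (EFin \o w) G.
Proof.
move=> [mG G0] wG; split => // gamma rect.
have l0 := rectifiable_length_ge0 gamma.
pose c t := constant_speed gamma (clamp 0 1 t).
have cl : lipschitz_curve (fine (curve_length 0 1 gamma)) c.
  move=> s t; apply: le_trans (constant_speed_lipschitz rect _ _) _; try exact/clamp_itv/ler01.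
  by rewrite ler_wpM2l// clamp_lipschitz.
have := wG _ c 0 1 l0 cl ler01.
have c01 (t : R) : 0 <= t <= 1 -> c t = constant_speed gamma t.
  by move=> t01; rewrite /c clamp_id.
rewrite (c01 0) ?lexx ?ler01// (c01 1) ?lexx ?ler01//.
rewrite (constant_speed0 rect) (constant_speed1 rect).
rewrite /path_integral {2}(rectifiable_lengthE rect) => /le_trans; apply.
rewrite le_eqVlt; apply/orP; left; apply/eqP; congr (_ * _)%E.
by apply: eq_integral => t; rewrite inE/= in_itv/= => t01; rewrite c01.
Qed.

End lipschitz_curves.

Section upper_gradient_lipschitz.
Context {R : realType} {X : pmetricType R}.
Local Notation mu := (@lebesgue_measure R).

Lemma lipschitz_curve_rectifiable l (c : R -> X) a b : 0 <= l -> lipschitz_curve l c ->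
  a <= b -> rectifiable (fun t => c (a + (b - a) * t)).
Proof.
move=> l0 cl ab.
have cl' : lipschitz_curve (l * (b - a)) (fun t => c (a + (b - a) * t)).
  move=> s t; apply: le_trans (cl _ _) _; rewrite -mulrA ler_wpM2l//.
  have -> : a + (b - a) * s - (a + (b - a) * t) = (b - a) * (s - t) by ring.
  by rewrite normrM (ger0_norm (_ : 0 <= b - a))// subr_ge0.
split.
  by apply: continuous_subspaceT; exact: lipschitz_curve_continuous cl'.
apply: le_lt_trans (curve_length_lipschitz (l := l * (b - a)) ler01 _) _; last exact: ltry.
by move=> x y x0 xy y1; apply: le_trans (cl' _ _) _; rewrite distrC ger0_norm ?subr_ge0.
Qed.

Section arc_length_reparametrization.
Variables (l : R) (c : R -> X) (a b : R).
Hypotheses (l0 : 0 <= l) (cl : lipschitz_curve l c) (ab : a <= b).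
Let gamma t := c (a + (b - a) * t).
Let rect : rectifiable gamma := lipschitz_curve_rectifiable l0 cl ab.
Let len := fine (curve_length 0 1 gamma).
Hypothesis len0 : 0 < len.
Let sigma t := constant_speed gamma (clamp 0 1 t).

Lemma sigma_lipschitz : lipschitz_curve len sigma.
Proof.
move=> s t; apply: le_trans (constant_speed_lipschitz rect _ _) _; try exact/clamp_itv/ler01.
by rewrite ler_wpM2l// ?clamp_lipschitz// ltW.
Qed.

(** Both integrals are followed as functions of a time in [0, 1]. From [s] to a later [t] they grow
    by about [A (gamma s)] times the arc length run through, respectively times [l (b - a) (t - s)],
    which is at least that length. As [A] and the curves are Lipschitz the errors are quadratic, and
    [increments_le] applies. *)
Lemma arc_length_integral_le (A : X -> R) (k B : R) : 0 <= k ->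
  (forall x y, `|A x - A y| <= k * mdist x y) -> (forall x, 0 <= A x <= B) ->
  (len%:E * \int[mu]_(u in `[0%R, 1%R]) (A (sigma u))%:E <=
   l%:E * \int[mu]_(t in `[a, b]) (A (c t))%:E)%E.
Proof.
move=> k0 Ak AB.
have cA : continuous A := lipschitz_continuous Ak.
have m1 : measurable_fun setT (A \o sigma).
  apply: (@measurableT_comp _ _ _ _ (borel X)) => //; first exact: continuous_borel.
  exact: continuous_curve_borel (lipschitz_curve_continuous sigma_lipschitz).
have m2 : measurable_fun setT (A \o c).
  apply: (@measurableT_comp _ _ _ _ (borel X)) => //; first exact: continuous_borel.
  exact: continuous_curve_borel (lipschitz_curve_continuous cl).
have b1 t : 0 <= (A \o sigma) t <= B by exact: AB.
have b2 t : 0 <= (A \o c) t <= B by exact: AB.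
rewrite -[X in (_ * X <= _)%E](primitiveE m1 b1 ler01) -(primitiveE m2 b2 ab) -!EFinM lee_fin.
pose L t := fine (curve_length 0 t gamma).
have L0 : L 0 = 0 by rewrite /L curve_lengthxx.
have Lmon s t : 0 <= s -> s <= t -> t <= 1 -> 0 <= L t - L s <= l * ((b - a) * (t - s)).
  move=> s0 st t1; have s1 := le_trans st t1; have t0 := le_trans s0 st.
  apply/andP; split.
    by rewrite (le_trans _ (arc_length_dist rect s0 st t1))// mdist_ge0.
  rewrite lerBlDr -lee_fin EFinD /L !fineK ?rectifiable_length_fin//.
  rewrite (curve_length_add gamma s0 st) [leLHS]addeC mulrA; apply: leeD => //.
  apply: curve_length_lipschitz => // x y sx xy yt.
  apply: le_trans (cl _ _) _; rewrite -mulrA ler_wpM2l//.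
  have -> : a + (b - a) * x - (a + (b - a) * y) = (b - a) * (x - y) by ring.
  rewrite normrM (ger0_norm (_ : 0 <= b - a)) ?subr_ge0// ler_wpM2l ?subr_ge0//.
  by rewrite distrC ger0_norm// subr_ge0.
pose P t := len * primitive (A \o sigma) 0 (L t / len).
pose Q t := l * primitive (A \o c) a (a + (b - a) * t).
have ba0 : 0 <= b - a by rewrite subr_ge0.
suff : P 1 - P 0 <= Q 1 - Q 0.
  have -> : P 0 = 0 by rewrite /P L0 mul0r primitivexx mulr0.
  have -> : Q 0 = 0 by rewrite /Q [(b - a) * 0]mulr0 addr0 primitivexx mulr0.
  have -> : P 1 = len * primitive (A \o sigma) 0 1 by rewrite /P divff// gt_eqF.
  have -> : Q 1 = l * primitive (A \o c) a b by rewrite /Q mulr1 addrC subrK.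
  by rewrite !subr0.
apply: (@increments_le _ _ _ 0 1 (2 * (k * (l * (b - a)) ^+ 2)) 1) => // s t s0 st t1 _.
have t0 := le_trans s0 st; have s1 := le_trans st t1.
have /andP[D0 D1] := Lmon s t s0 st t1.
have /andP[Ls0 _] := Lmon 0 s (lexx _) s0 s1; rewrite L0 subr0 in Ls0.
set D := l * ((b - a) * (t - s)) in D1.
have Ds0 : 0 <= D by rewrite (le_trans D0).
have ss : sigma (L s / len) = gamma s.
  rewrite /sigma clamp_id; first by rewrite constant_speed_arc_length// s0.
  rewrite divr_ge0 ?(ltW len0)//= ler_pdivrMr// mul1r.
  by have /andP[+ _] := Lmon s 1 s0 s1 (lexx _); rewrite subr_ge0.
have h1 : P t - P s <= (A (gamma s) + k * D) * D.
  rewrite /P -mulrBr.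
  have /(_ (A (gamma s) + k * (L t - L s))) := @primitive_le _ _ _ m1 b1 0 (L s / len) (L t / len).
  have LL : L s / len <= L t / len by rewrite ler_pM2r ?invr_gt0// -subr_ge0.
  move=> /(_ (divr_ge0 Ls0 (ltW len0)) LL) h.
  apply: le_trans (_ : len * ((A (gamma s) + k * (L t - L s)) * (L t / len - L s / len)) <= _).
    rewrite ler_pM2l//; apply: h => x /andP[x1 x2] /=; rewrite -lerBlDl -ss.
    apply: le_trans (ler_norm _) _; apply: le_trans (Ak _ _) _; rewrite ler_wpM2l//.
    apply: le_trans (sigma_lipschitz _ _) _; rewrite ger0_norm ?subr_ge0//.
    by rewrite mulrC -ler_pdivlMr// mulrBl lerD2r.
  have -> : len * ((A (gamma s) + k * (L t - L s)) * (L t / len - L s / len)) =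
      (A (gamma s) + k * (L t - L s)) * (L t - L s) by field; rewrite gt_eqF.
  have /andP[A0 _] := AB (gamma s).
  apply: ler_pM => //; first by rewrite addr_ge0// mulr_ge0.
  by rewrite lerD2l ler_wpM2l.
have h2 : (A (gamma s) - k * D) * D <= Q t - Q s.
  rewrite /Q -mulrBr.
  have as_ : a <= a + (b - a) * s by rewrite lerDl mulr_ge0.
  have st_ : a + (b - a) * s <= a + (b - a) * t by rewrite lerD2l ler_wpM2l.
  have h0 := @primitive_ge _ _ _ m2 b2 a _ _ (Num.max 0 (A (gamma s) - k * D)) as_ st_.
  apply: le_trans (_ : Num.max 0 (A (gamma s) - k * D) * D <= _).
    by rewrite ler_wpM2r// le_max lexx orbT.
  have -> : Num.max 0 (A (gamma s) - k * D) * D =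
     l * (Num.max 0 (A (gamma s) - k * D) * (a + (b - a) * t - (a + (b - a) * s))).
    by rewrite /D; ring.
  rewrite ler_wpM2l//; apply: h0; first by rewrite le_max lexx.
  move=> x /andP[x1 x2] /=; rewrite ge_max; have /andP[-> _] /= := AB (c x).
  rewrite lerBlDr -lerBlDl.
  apply: le_trans (ler_norm _) _; apply: le_trans (Ak _ _) _; rewrite ler_wpM2l//.
  apply: le_trans (cl _ _) _; rewrite ler_wpM2l//.
  by rewrite distrC ger0_norm ?subr_ge0//; lra.
have -> : 2 * (k * (l * (b - a)) ^+ 2) * (t - s) ^+ 2 = 2 * (k * D ^+ 2) by rewrite /D; ring.
by apply: le_trans h1 _; rewrite -lerBlDr; apply: le_trans h2; lra.
Qed.

End arc_length_reparametrization.

Lemma ge0_integral_mrestr d (T : measurableType d) (m : {measure set T -> \bar R})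
    (D : set T) (mD : measurable D) (f : T -> \bar R) :
  measurable_fun setT f -> (forall x, 0 <= f x)%E ->
  (\int[mrestr m mD]_x f x = \int[m]_(x in D) f x)%E.
Proof.
move=> mf f0; rewrite -(setUv D) ge0_integral_setU//=.
- rewrite [X in (_ + X)%E](_ : _ = 0%E) ?adde0; last first.
    apply: null_set_integral => //; first exact: measurableC.
      exact: measurable_funTS.
    by rewrite /= /mrestr setICl measure0.
  by apply: eq_measure_integral => A mA AD; rewrite /= /mrestr setIidl.
- exact: measurableC.
- exact: measurable_funTS.
- by apply/disj_setPS => x [].
Qed.

(** The measure is the pushforward under [c] of [r] times Lebesgue measure on [a, b]. It turns the
    comparison of two curve integrals of an arbitrary Borel function into the comparison of two
    measures. *)
Lemma curve_measure l (c : R -> X) r a b : 0 <= r -> lipschitz_curve l c -> a <= b ->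
  exists m : {measure set (borel X) -> \bar R},
    (m setT < +oo)%E /\ forall G : X -> \bar R, borel_nonneg G ->
    (\int[m]_x G x = r%:E * \int[mu]_(t in `[a, b]) G (c t))%E.
Proof.
move=> r0 cl ab.
have mc := continuous_curve_borel (lipschitz_curve_continuous cl).
have mab := @segment_measurable R a b.
pose m0 :=
  (pushforward (mscale (NngNum r0) (mrestr mu mab)) (c : measurableTypeR R -> borel X)
    : {measure set (borel X) -> \bar R}).
pose m := m0 mc.
have mE : forall G : X -> \bar R, borel_nonneg G ->
    (\int[m]_x G x = r%:E * \int[mu]_(t in `[a, b]) G (c t))%E.
  move=> G [mG G0]; rewrite ge0_integral_pushforward// preimage_setT.
  have mGc : measurable_fun setT (G \o c) by exact: curve_comp_measurable cl mG.
  rewrite ge0_integral_mscale//; last by move=> t _; exact: G0.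
  by rewrite ge0_integral_mrestr//= => t; exact: G0.
exists m; split => //.
rewrite -(mul1e (m setT)) -integral_cst// mE//.
apply: (@le_lt_trans _ _ (r%:E * (1 * (b - a))%:E)%E); last by rewrite -EFinM ltry.
rewrite lee_wpmul2l ?lee_fin//; apply: segment_integral_le => //.
Qed.

(** The integrals along the constant-speed reparametrization and along [c] are integrals of [g]
    against finite Borel measures [m1] and [m2], so it is enough that [m1 <= m2] on Borel sets.
    Lipschitz cutoffs and [arc_length_integral_le] give this on open sets, and outer regularity of
    [m2] extends it to the others. *)
Lemma lip_of_upper_gradient (f : X -> R) g :
  upper_gradient (EFin \o f) g -> lip_upper_gradient f g.
Proof.
move=> [mg g0 fg] l c a b l0 cl ab.
pose gamma t := c (a + (b - a) * t).
have rect : rectifiable gamma := lipschitz_curve_rectifiable l0 cl ab.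
have := fg gamma rect.
rewrite /gamma mulr1 mulr0 addr0 [a + _]addrC subrK => /le_trans; apply.
rewrite /path_integral rectifiable_lengthE//.
have := rectifiable_length_ge0 gamma; rewrite le_eqVlt => /predU1P[<-|len0].
  by rewrite mul0e mule_ge0// integral_ge0.
pose sigma t := constant_speed gamma (clamp 0 1 t).
have sl := sigma_lipschitz l0 cl ab len0.
have [m1 [m1fin m1E]] := curve_measure (ltW len0) sl ler01.
have [m2 [m2fin m2E]] := curve_measure l0 cl ab.
have bg : borel_nonneg g by [].
rewrite -m2E//.
have -> : (\int[mu]_(t in `[0%R, 1%R]) g (constant_speed gamma t) =
    \int[mu]_(t in `[0%R, 1%R]) g (sigma t))%E.
  by apply: eq_integral => t; rewrite inE/= in_itv/= => t01; rewrite /sigma clamp_id.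
rewrite -m1E//.
apply: ge0_le_measure_integral => // E mE.
have openle (U : set X) : open U -> (m1 U <= m2 U)%E.
  move=> oU; pose F n := [set x : X | n.+1%:R^-1 <= cdist (~` U) x].
  have cF n : closed (F n) by exact/closed_superlevel/cdist_continuous.
  have UF : \bigcup_n F n = U.
    apply/seteqP; split => x.
      move=> [n _]; rewrite /F /= => h; apply: contrapT => Ux; move: h; rewrite cdist_eq0//.
      by rewrite leNgt invr_gt0 ltr0n.
    move=> Ux; have := @cdist_gt0 _ _ (~` U) x (open_closedC oU) (fun f => f Ux).
    by move=> /ltr_add_invr[k]; rewrite add0r => hk; exists k => //=; exact: ltW.
  have := @nondecreasing_cvg_mu _ _ _ m1 F.
  rewrite UF => /(_ (fun n => closed_borel (cF n)) (open_borel oU)) h.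
  have /cvg_lim <- // : m1 \o F @ \oo --> m1 U.
    apply: h => n k nk; apply/subsetPset => x /= ; apply: le_trans.
    by rewrite lef_pV2 ?posrE// ler_nat ltnS.
  apply: lime_le.
    apply/cvg_ex; exists (m1 U); apply: h => n k nk; apply/subsetPset => x /= ; apply: le_trans.
    by rewrite lef_pV2 ?posrE// ler_nat ltnS.
  apply: nearW => n /=.
  (* This Lipschitz cutoff is 1 on [F n] and 0 off [U]. *)
  pose A x : R := Num.min 1 (n.+1%:R * cdist (~` U) x).
  have Alip x y : `|A x - A y| <= n.+1%:R * mdist x y.
    apply: le_trans (dist_min_le _ _ _) _; rewrite -mulrBr normrM ger0_norm//.
    by rewrite ler_wpM2l// cdist_lipschitz_norm.
  have A01 x : 0 <= A x <= 1 by rewrite /A le_min ler01 mulr_ge0 ?cdist_ge0// ge_min lexx.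
  have bA : borel_nonneg (EFin \o A).
    split; last by move=> x; rewrite lee_fin; case/andP: (A01 x).
    apply/measurable_EFinP; apply: continuous_borel.
    exact: (@lipschitz_continuous _ _ A n.+1%:R).
  apply: (@le_trans _ _ (\int[m1]_x (A x)%:E)%E).
    rewrite -[leLHS]mul1e -integral_cst; last exact: closed_borel.
    apply: (@le_trans _ _ (\int[m1]_(x in (F n : set (borel X))) (A x)%:E)%E).
      apply: ge0_le_integral => //; first exact: closed_borel.
        by apply: measurable_funTS; exact: bA.1.
      move=> x /= Fx; rewrite lee_fin /A le_min lexx/=.
      by rewrite mulrC -ler_pdivrMr// mul1r.
    apply: ge0_subset_integral => //; first exact: closed_borel.
      exact: bA.1.
    by move=> x _; exact: (bA.2 x).
  apply: (@le_trans _ _ (\int[m2]_x (A x)%:E)%E).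
    rewrite (m1E (EFin \o A))// (m2E (EFin \o A))//.
    exact: (arc_length_integral_le l0 cl ab len0 _ Alip A01).
  rewrite -[leRHS]mul1e -integral_cst; last exact: open_borel.
  rewrite -(setTI U) integral_mkcondr.
  apply: ge0_le_integral => //.
  - by move=> x _; exact: (bA.2 x).
  - exact: bA.1.
  - apply/measurable_restrict => //; exact: open_borel.
  - move=> x _; rewrite patchE; case: ifPn => [_|]; first by rewrite lee_fin; case/andP: (A01 x).
    rewrite notin_setE => Ux; rewrite /A cdist_eq0// mulr0 lee_fin.
    by rewrite ge_min lexx orbT.
apply/lee_addgt0Pr => e e0.
have [Q [U [cQ oU QE EU UQ]]] := finite_borel_regular m2fin mE e0.
apply: (@le_trans _ _ (m1 U)).
  by apply: le_measure; rewrite ?inE//; exact: open_borel.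
apply: le_trans (openle _ oU) _.
apply: le_trans (_ : (m2 Q + m2 (U `\` Q) <= _)%E); last first.
  apply: leeD; last exact: ltW.
  by apply: le_measure; rewrite ?inE//; exact: closed_borel.
apply: le_trans (measureU2 _ _ _) => //.
- apply: le_measure; rewrite ?inE//.
  + exact: open_borel.
  + by apply: measurableU; [exact: closed_borel|apply: measurableD; [exact: open_borel|exact: closed_borel]].
  + by move=> x Ux; have [?|?] := pselect (Q x); [left|right].
- exact: closed_borel.
- by apply: measurableD; [exact: open_borel|exact: closed_borel].
Qed.

End upper_gradient_lipschitz.

(** * Absolute continuity of the integral, suprema of sequences *)

Section integral_smallness.
Local Open Scope ereal_scope.
Context d (T : measurableType d) {R : realType} (m : {measure set T -> \bar R}).

Lemma integral_absolutely_continuous (f : T -> \bar R) (D : set T) : measurable D ->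
  measurable_fun setT f -> (forall x, 0 <= f x) -> \int[m]_(x in D) f x < +oo ->
  forall e : R, (0 < e)%R -> exists2 r : R, (0 < r)%R &
    forall E, measurable E -> E `<=` D -> m E < r%:E -> \int[m]_(x in E) f x < e%:E.
Proof.
move=> mD mf f0 foo e e0; have e20 : (0 < e / 2)%R by rewrite divr_gt0.
pose g n x := mine (f x) n%:R%:E.
have mg n : measurable_fun setT (g n) by exact: measurable_mine.
have gf n x : g n x <= f x by rewrite /g ge_min lexx.
have g0 n x : 0 <= g n x by rewrite /g le_min f0 lee_fin ler0n.
have gnd x : {homo g^~ x : n k / (n <= k)%N >-> n <= k}.
  move=> n k nk; rewrite /g le_min ge_min lexx/= ge_min; apply/orP; right.
  by rewrite lee_fin ler_nat.
have gbig x (r : R) : (0 <= r)%R -> r%:E <= f x -> exists n, r%:E <= g n x.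
  move=> r0 rf; exists (Num.bound r); rewrite /g le_min rf/= lee_fin.
  exact/ltW/archi_boundP.
have glim x : limn (g^~ x) = f x.
  have /cvg_lim -> // := ereal_nondecreasing_cvgn (gnd x).
  apply/eqP; rewrite eq_le; apply/andP; split.
    by apply: ge_ereal_sup => _ [n _ <-].
  case fx : (f x) (f0 x) => [r| |] // r0.
    have rf : r%:E <= f x by rewrite fx.
    have [n gn] := gbig x r r0 rf.
    by apply: le_trans gn _; apply: ereal_sup_ubound; exists n.
  rewrite leye_eq; apply/eqP/eqyP => r r1.
  have [|n gn] := gbig x r (ltW r1); first by rewrite fx leey.
  by apply: le_trans gn _; apply: ereal_sup_ubound; exists n.
have ffin : \int[m]_(x in D) f x \is a fin_num.
  by rewrite ge0_fin_numE//; apply: integral_ge0.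
have := @cvg_monotone_convergence _ _ _ m D mD g (fun n => measurable_funTS (mg n))
  (fun n x _ => g0 n x) (fun x _ => gnd x).
rewrite (eq_integral f); last by move=> x _; rewrite glim.
rewrite -(fineK ffin) => /fine_cvgP[_ /cvgrPdist_lt/(_ _ e20)[N _ /(_ N (leqnn N))]] /=.
move=> /ltr_normlW; set F := fine _; set G := fine _ => FG.
have Gfin : \int[m]_(x in D) g N x \is a fin_num.
  rewrite ge0_fin_numE; last by apply: integral_ge0.
  by apply: le_lt_trans foo; apply: ge0_le_integral => //; exact: measurable_funTS.
have mfg : measurable_fun setT (fun x => f x - g N x) by exact: emeasurable_funB.
have gN x : g N x \is a fin_num.
  rewrite ge0_fin_numE//; apply: le_lt_trans (_ : N%:R%:E < +oo); last exact: ltry.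
  by rewrite /g ge_min lexx orbT.
have fg0 x : 0 <= f x - g N x by rewrite sube_ge0 ?gN ?orbT// ?gf.
have split_int A : measurable A -> \int[m]_(x in A) f x =
    \int[m]_(x in A) g N x + \int[m]_(x in A) (f x - g N x).
  move=> mA; rewrite -ge0_integralD//; [|exact: measurable_funTS..].
  by apply: eq_integral => x _; rewrite addeC subeK.
have h2 : \int[m]_(x in D) (f x - g N x) < (e / 2)%:E.
  have := split_int D mD; rewrite -(fineK ffin) -(fineK Gfin) -/F -/G.
  case: (\int[m]_(x in D) (f x - g N x)) => [r| |] //.
  by move=> [FE]; rewrite lte_fin; lra.
exists (e / 2 / N.+1%:R)%R; first by rewrite divr_gt0.
move=> E mE ED mEr; rewrite split_int// [e]splitr EFinD.
apply: lee_ltD.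
- have h : \int[m]_(x in E) g N x <= \int[m]_(x in D) g N x.
    by apply: ge0_subset_integral => //; exact: measurable_funTS.
  rewrite ge0_fin_numE; first by apply: le_lt_trans h _; rewrite ltey_eq Gfin.
  by apply: integral_ge0.
- apply: (@le_trans _ _ (\int[m]_(x in E) cst N%:R%:E x)).
    apply: ge0_le_integral => //; first exact: measurable_funTS.
    by move=> x _; rewrite /g ge_min lexx orbT.
  rewrite integral_cst//; apply: le_trans (_ : N.+1%:R%:E * (e / 2 / N.+1%:R)%:E <= _).
    by apply: lee_pmul => //; [rewrite lee_fin ler_nat|exact: ltW].
  by rewrite -EFinM lee_fin mulrC divfK.
- apply: le_lt_trans h2; apply: ge0_subset_integral => //; exact: measurable_funTS.
Qed.
End integral_smallness.

Section esup_fun.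
Context {T : Type} {R : realType}.
Implicit Types G : (T -> \bar R)^nat.

Definition esup_fun G x : \bar R := ereal_sup (range (G^~ x)).

Lemma esup_fun_ge G j x : (G j x <= esup_fun G x)%E.
Proof. by apply: ereal_sup_ubound; exists j. Qed.

Lemma esup_fun_le G x M : (forall j, (G j x <= M)%E) -> (esup_fun G x <= M)%E.
Proof. by move=> GM; apply: ge_ereal_sup => _ [j _ <-]. Qed.

End esup_fun.

Lemma esup_fun_measurable d (T : measurableType d) {R : realType} (G : (T -> \bar R)^nat) : (forall j, measurable_fun setT (G j)) ->
  measurable_fun setT (esup_fun G).
Proof.
move=> mG; have := measurable_fun_esups mG 0; congr measurable_fun.
apply/funext => x; rewrite /esups/= /esup_fun; congr ereal_sup.
by apply/seteqP; split => y [j _ <-]; exists j.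
Qed.

(** * Calculus of upper gradients *)

Section lip_upper_gradient_theory.
Context {R : realType} {X : pmetricType R}.
Local Notation mu := (@lebesgue_measure R).
Local Open Scope ereal_scope.
Implicit Types (u v w : X -> R) (G H : X -> \bar R) (A : set X).

Lemma borel_nonneg_cst (k : R) : (0 <= k)%R -> borel_nonneg (fun _ : X => k%:E).
Proof. by move=> k0; split => [|x]; [exact: measurable_cst|rewrite lee_fin]. Qed.

Lemma borel_nonnegD G H : borel_nonneg G -> borel_nonneg H ->
  borel_nonneg (fun x => G x + H x).
Proof.
by move=> [mG G0] [mH H0]; split => [|x]; [exact: emeasurable_funD|rewrite adde_ge0].
Qed.

Lemma borel_nonnegZ (k : R) G : (0 <= k)%R -> borel_nonneg G ->
  borel_nonneg (fun x => k%:E * G x).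
Proof.
move=> k0 [mG G0]; split => [|x]; last by rewrite mule_ge0.
exact: measurable_funeM.
Qed.

Lemma borel_nonneg_restrict G A : measurable (A : set (borel X)) -> borel_nonneg G ->
  borel_nonneg (G \_ A).
Proof.
move=> mA [mG G0]; split => [|x]; last by rewrite patchE; case: ifPn.
by apply/measurable_restrict => //; exact: measurable_funTS.
Qed.

Lemma borel_nonneg_esup (Gs : (X -> \bar R)^nat) : (forall j, borel_nonneg (Gs j)) ->
  borel_nonneg (esup_fun Gs).
Proof.
move=> bG; split => [|x].
  by apply: (@esup_fun_measurable _ (borel X)) => j; exact: (bG j).1.
by apply: le_trans (esup_fun_ge Gs 0 x); exact: (bG 0%N).2.
Qed.

Lemma curve_integral_le l (c : R -> X) a b G H : lipschitz_curve l c -> borel_nonneg G ->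
  borel_nonneg H -> (forall x, G x <= H x) ->
  \int[mu]_(t in `[a, b]) G (c t) <= \int[mu]_(t in `[a, b]) H (c t).
Proof.
move=> cl [mG G0] [mH H0] GH; apply: ge0_le_integral => //.
- apply: measurable_funTS; exact: (curve_comp_measurable cl mG).
- apply: measurable_funTS; exact: (curve_comp_measurable cl mH).
Qed.

Lemma lip_upper_gradient_le w G H : borel_nonneg G -> borel_nonneg H ->
  (forall x, G x <= H x) -> lip_upper_gradient w G -> lip_upper_gradient w H.
Proof.
move=> bG bH GH wG l c a b l0 cl ab; apply: le_trans (wG l c a b l0 cl ab) _.
by rewrite lee_wpmul2l ?lee_fin//; exact: (curve_integral_le _ _ cl).
Qed.

Lemma lip_upper_gradient_contraction w v G :
  (forall x y, `|v x - v y| <= `|w x - w y|)%R ->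
  lip_upper_gradient w G -> lip_upper_gradient v G.
Proof.
move=> vw wG l c a b l0 cl ab; apply: le_trans (wG l c a b l0 cl ab).
by rewrite lee_fin.
Qed.

Lemma lip_upper_gradientD u w v G H : borel_nonneg G -> borel_nonneg H ->
  (forall x y, `|u x - u y| <= `|w x - w y| + `|v x - v y|)%R ->
  lip_upper_gradient w G -> lip_upper_gradient v H ->
  lip_upper_gradient u (fun x => G x + H x).
Proof.
move=> [mG G0] [mH H0] uwv wG vH l c a b l0 cl ab.
apply: (@le_trans _ _ (`|w (c b) - w (c a)|%:E + `|v (c b) - v (c a)|%:E)).
  by rewrite -EFinD lee_fin.
rewrite ge0_integralD//; first last.
- apply: measurable_funTS; exact: (curve_comp_measurable cl mH).
- apply: measurable_funTS; exact: (curve_comp_measurable cl mG).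
rewrite ge0_muleDr ?integral_ge0//.
by apply: leeD; [exact: wG|exact: vH].
Qed.

Lemma lip_upper_gradient_cst w (k : R) : (0 <= k)%R ->
  (forall x y, `|w x - w y| <= k * mdist x y)%R -> lip_upper_gradient w (fun=> k%:E).
Proof.
move=> k0 wk l c a b l0 cl ab.
rewrite integral_cst//= lebesgue_measure_itv/= lte_fin.
have h : (`|w (c b) - w (c a)| <= l * (k * (b - a)))%R.
  apply: le_trans (wk _ _) _; rewrite [leRHS]mulrCA ler_wpM2l//.
  by apply: le_trans (cl _ _) _; rewrite ger0_norm// subr_ge0.
move: ab; rewrite le_eqVlt => /predU1P[->|->]; last by rewrite -EFinB -!EFinM lee_fin.
by rewrite ltxx mule0 mule0 subrr normr0.
Qed.

Lemma lip_upper_gradientZ w (k : R) G : (0 <= k)%R -> borel_nonneg G ->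
  lip_upper_gradient w G -> lip_upper_gradient (fun x => k * w x)%R (fun x => k%:E * G x).
Proof.
move=> k0 [mG G0] wG l c a b l0 cl ab.
rewrite ge0_integralZl//; last by apply: measurable_funTS; exact: (curve_comp_measurable cl mG).
rewrite -mulrBr normrM ger0_norm// EFinM muleCA lee_wpmul2l ?lee_fin//.
exact: wG.
Qed.

Lemma lip_upper_gradient_cutoff w G (phi : X -> R) (k M : R) : borel_nonneg G ->
  (0 <= k)%R -> (0 <= M)%R -> (forall x, `|phi x| <= 1)%R ->
  (forall x y, `|phi x - phi y| <= k * mdist x y)%R ->
  (forall x, `|w x| <= M)%R -> lip_upper_gradient w G ->
  lip_upper_gradient (fun x => phi x * w x)%R (fun x => G x + (M * k)%:E).
Proof.
move=> bG k0 M0 phi1 phik wM wG.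
have Mk : (0 <= M * k)%R by rewrite mulr_ge0.
apply: (lip_upper_gradientD (v := fun x => (M * phi x)%R) bG (borel_nonneg_cst Mk) _ wG).
- move=> x y.
  have -> : (phi x * w x - phi y * w y = phi x * (w x - w y) + w y * (phi x - phi y))%R by ring.
  apply: le_trans (ler_normD _ _) _; rewrite !normrM; apply: lerD.
    by rewrite ler_piMl.
  by rewrite -mulrBr normrM ler_wpM2r// (ger0_norm M0).
- apply: lip_upper_gradient_cst => // x y.
  by rewrite -mulrBr normrM (ger0_norm M0) -mulrA ler_wpM2l.
Qed.

Lemma lip_upper_gradient_esup w (ws : (X -> R)^nat) (Gs : (X -> \bar R)^nat) :
  (forall j, borel_nonneg (Gs j)) -> (forall j, lip_upper_gradient (ws j) (Gs j)) ->
  (forall x y (e : R), 0 < e -> exists j, `|w x - w y| <= `|ws j x - ws j y| + e)%R ->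
  lip_upper_gradient w (esup_fun Gs).
Proof.
move=> bG wG h l c a b l0 cl ab; apply/lee_addgt0Pr => e e0.
have [j hj] := h (c b) (c a) e e0.
apply: (@le_trans _ _ (`|ws j (c b) - ws j (c a)|%:E + e%:E)); first by rewrite -EFinD lee_fin.
rewrite leeD2r//; apply: le_trans (wG j l c a b l0 cl ab) _.
rewrite lee_wpmul2l ?lee_fin//; apply: (curve_integral_le _ _ cl) => //.
  exact: borel_nonneg_esup.
by move=> x; exact: esup_fun_ge.
Qed.

(** Along a curve the oscillation of [ws j] is at most [2 ^- j.+1] times the integral of the
    weighted supremum, and the partial sums [1 - 2 ^- N] of these factors stay below 1. *)
Lemma lip_upper_gradient_series w (ws : (X -> R)^nat) (Gs : (X -> \bar R)^nat) :
  (forall j, borel_nonneg (Gs j)) -> (forall j, lip_upper_gradient (ws j) (Gs j)) ->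
  (forall x y (e : R), 0 < e -> exists N,
    `|w x - w y| <= \sum_(j < N) `|ws j x - ws j y| + e)%R ->
  lip_upper_gradient w (esup_fun (fun j x => (2 ^+ j.+1)%:E * Gs j x)).
Proof.
move=> bG wG h l c a b l0 cl ab; apply/lee_addgt0Pr => e e0.
have p0 j : (0 <= 2 ^+ j.+1 :> R)%R by rewrite exprn_ge0.
have bG2 j : borel_nonneg (fun x => (2 ^+ j.+1)%:E * Gs j x) by exact: borel_nonnegZ.
set S := esup_fun _; have bS : borel_nonneg S by exact: borel_nonneg_esup.
have [N hN] := h (c b) (c a) e e0.
apply: (@le_trans _ _ ((\sum_(j < N) `|ws j (c b) - ws j (c a)|)%:E + e%:E)).
  by rewrite -EFinD lee_fin.
rewrite leeD2r//; set I := _ * \int[mu]_(t in _) _.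
have I0 : 0 <= I by rewrite mule_ge0// integral_ge0// => t _; exact: bS.2.
have step j : `|ws j (c b) - ws j (c a)|%:E <= (2 ^- j.+1)%:E * I.
  rewrite -(@lee_pmul2l _ (2 ^+ j.+1)%:E) ?lte_fin ?exprn_gt0//.
  rewrite [leRHS]muleA -[(_%:E * _%:E)%E in leRHS]EFinM divff ?expf_neq0// mul1e.
  apply: (@le_trans _ _ ((2 ^+ j.+1)%:E * (l%:E * \int[mu]_(t in `[a, b]) Gs j (c t)))).
    by rewrite lee_wpmul2l ?lee_fin//; exact: wG.
  rewrite muleCA lee_wpmul2l ?lee_fin// -ge0_integralZl//.
  - by apply: (curve_integral_le a b cl (bG2 j) bS) => x; exact: (esup_fun_ge (fun j x => (2 ^+ j.+1)%:E * Gs j x)).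
  - apply: measurable_funTS; exact: (curve_comp_measurable cl (bG j).1).
  - by move=> t _; exact: (bG j).2.
apply: (@le_trans _ _ ((1 - 2 ^- N)%:E * I)); last first.
  rewrite -[leRHS]mul1e lee_wpmul2r// lee_fin gerDl oppr_le0 invr_ge0.
  exact: exprn_ge0.
elim: N {hN} => [|N ih]; first by rewrite big_ord0 expr0 invr1 subrr mul0e.
rewrite big_ord_recr/= EFinD.
have -> : (1 - 2 ^- N.+1 = (1 - 2 ^- N) + 2 ^- N.+1 :> R)%R.
  by rewrite exprS; field; rewrite expf_neq0.
rewrite EFinD ge0_muleDl.
- by apply: leeD.
- by rewrite lee_fin subr_ge0 invf_le1 ?exprn_gt0// exprn_ege1// ler1n.
- by rewrite lee_fin invr_ge0.
Qed.

End lip_upper_gradient_theory.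

(** * Restriction of an upper gradient to a set *)

Section hitting.
Context {R : realType}.
Local Notation mu := (@lebesgue_measure R).
Local Open Scope ereal_scope.

(* Only the pieces before the first and after the last time outside [S] count. *)
Lemma hitting_times (F : R -> R) (Theta : R -> \bar R) (S : set R) (l a b : R) :
  measurable_fun setT Theta -> (forall t, 0 <= Theta t) -> measurable S ->
  (0 <= l)%R -> (a <= b)%R ->
  (forall s t, (a <= s)%R -> (s <= t)%R -> (t <= b)%R ->
    `|F t - F s|%:E <= l%:E * \int[mu]_(x in `[s, t]) Theta x) ->
  (forall t, (a <= t <= b)%R ->
    (forall e : R, (0 < e)%R -> exists r, [/\ (a <= r <= b)%R, (`|r - t| < e)%R & ~ S r]) ->
    F t = 0%R) ->
  `|F b - F a|%:E <= l%:E * \int[mu]_(x in `[a, b]) (Theta \_ S) x.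
Proof.
move=> mT T0 mS l0 ab FT FZ.
have mTS : measurable_fun setT (Theta \_ S).
  by apply/measurable_restrict => //; exact: measurable_funTS.
have TS0 t : 0 <= (Theta \_ S) t by rewrite patchE; case: ifPn.
pose Z := [set t | (a <= t <= b)%R /\ ~ S t].
have [[z0 Zz0]|Zempty] := pselect (Z !=set0); last first.
  have -> : \int[mu]_(x in `[a, b]) (Theta \_ S) x = \int[mu]_(x in `[a, b]) Theta x.
    apply: eq_integral => t; rewrite inE/= in_itv/= => tab; rewrite patchE ifT// inE.
    by apply: contrapT => St; apply: Zempty; exists t.
  exact: FT.
have Zub : has_ubound Z by exists b => t [/andP[]].
have Zlb : has_lbound Z by exists a => t [/andP[]].
have Zn : Z !=set0 by exists z0.
have supZ z : Z z -> (z <= sup Z)%R by move=> Zz; exact: ub_le_sup.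
have infZ z : Z z -> (inf Z <= z)%R by move=> Zz; exact: ge_inf.
have supb : (sup Z <= b)%R by apply: ge_sup => // t [/andP[]].
have infa : (a <= inf Z)%R by apply: lb_le_inf => // t [/andP[]].
have is_ : (inf Z <= sup Z)%R by rewrite (le_trans (infZ z0 Zz0))// supZ.
have asup := le_trans infa is_; have infb := le_trans is_ supb.
have Fsup : F (sup Z) = 0%R.
  apply: FZ; first by rewrite asup supb.
  move=> e e0; have [r Zr sr] : exists2 r, Z r & (sup Z - e < r)%R.
    by apply: sup_adherent => //; split.
  exists r; case: (Zr) => rab nSr; split => //.
  by rewrite ler0_norm ?subr_le0 ?supZ// opprB ltrBlDr -ltrBlDl.
have Finf : F (inf Z) = 0%R.
  apply: FZ; first by rewrite infa infb.
  move=> e e0; have [r Zr sr] : exists2 r, Z r & (r < inf Z + e)%R.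
    by apply: inf_adherent => //; split.
  exists r; case: (Zr) => rab nSr; split => //.
  by rewrite ger0_norm ?subr_ge0 ?infZ// ltrBlDl.
have h1 : `|F b|%:E <= l%:E * \int[mu]_(x in `[sup Z, b]) (Theta \_ S) x.
  rewrite -[F b]subr0 -Fsup; apply: le_trans (FT _ _ asup supb (lexx _)) _.
  rewrite lee_wpmul2l ?lee_fin// -integral_itv_obnd_cbnd; last exact: measurable_funTS.
  rewrite -[leRHS]integral_itv_obnd_cbnd; last exact: measurable_funTS.
  rewrite le_eqVlt; apply/orP; left; apply/eqP; apply: eq_integral => t.
  rewrite inE/= in_itv/= => /andP[st tb]; rewrite patchE ifT// inE; apply: contrapT => nSt.
  have : Z t by split => //; rewrite (le_trans asup (ltW st)) tb.
  by move=> /supZ; rewrite leNgt st.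
have h2 : `|F a|%:E <= l%:E * \int[mu]_(x in `[a, inf Z]) (Theta \_ S) x.
  rewrite -normrN -[(- F a)%R]add0r -Finf; apply: le_trans (FT _ _ (lexx _) infa infb) _.
  rewrite lee_wpmul2l ?lee_fin// -integral_itv_bndo_bndc; last exact: measurable_funTS.
  rewrite -[leRHS]integral_itv_bndo_bndc; last exact: measurable_funTS.
  rewrite le_eqVlt; apply/orP; left; apply/eqP; apply: eq_integral => t.
  rewrite inE/= in_itv/= => /andP[st tb]; rewrite patchE ifT// inE; apply: contrapT => nSt.
  have : Z t by split => //; rewrite st (le_trans (ltW tb) infb).
  by move=> /infZ; rewrite leNgt tb.
rewrite (segment_integral_split mTS TS0 asup supb) (segment_integral_split mTS TS0 infa is_).
have I0 x y : 0 <= \int[mu]_(t in `[x, y]) (Theta \_ S) t by exact: integral_ge0.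
rewrite (ge0_muleDr _ (adde_ge0 (I0 _ _) (I0 _ _)) (I0 _ _)) (ge0_muleDr _ (I0 _ _) (I0 _ _)).
apply: (@le_trans _ _ (`|F a|%:E + `|F b|%:E)).
  by rewrite -EFinD lee_fin [leRHS]addrC ler_normB.
apply: leeD h1; apply: le_trans h2 _.
by rewrite leeDl// mule_ge0.
Qed.

End hitting.

Section restriction.
Context {R : realType} {X : pmetricType R}.
Local Notation mu := (@lebesgue_measure R).
Local Open Scope ereal_scope.
Implicit Types (w : X -> R) (G : X -> \bar R) (A : set X).

(** The times spent in [A] form an open set, so a limit of times outside [A] is again outside, where
    [w] vanishes; this is what [hitting_times] asks for. *)
Lemma lip_upper_gradient_open w G A : borel_nonneg G -> open A ->
  (forall x, ~ A x -> w x = 0%R) -> lip_upper_gradient w G ->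
  lip_upper_gradient w (G \_ A).
Proof.
move=> bG oA wA wG l c a b l0 cl ab.
have cc := lipschitz_curve_continuous cl.
have oS : open (c @^-1` A) by apply: open_comp => // x _; exact: cc.
have -> : \int[mu]_(t in `[a, b]) (G \_ A) (c t) =
    \int[mu]_(t in `[a, b]) ((G \o c) \_ (c @^-1` A)) t.
  by apply: eq_integral => t _; rewrite !patchE.
apply: (@hitting_times _ (w \o c) (G \o c)) => //.
- exact: (curve_comp_measurable cl bG.1).
- by move=> t; exact: bG.2.
- exact: open_measurable.
- by move=> s t as_ st tb; exact: wG.
- move=> t tab h; apply: wA => Act.
  have /nbhs_ballP[e /= e0 eA] : nbhs t (c @^-1` A) by apply: open_nbhs_nbhs; split.
  by have [r [_ rt nr]] := h e e0; apply: nr; apply: eA; rewrite /ball/= distrC.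
Qed.

(* Where the integral of [G] is finite [w] is continuous along the curve; the
   other curves are taken care of by [e * G]. *)
Lemma lip_upper_gradient_borel w G A (e : R) : borel_nonneg G -> (0 < e)%R ->
  measurable (A : set (borel X)) -> (forall x, ~ A x -> w x = 0%R) ->
  lip_upper_gradient w G ->
  lip_upper_gradient w (fun x => (G \_ A) x + e%:E * G x).
Proof.
move=> bG e0 mA wA wG l c a b l0 cl ab.
have mGc := curve_comp_measurable cl bG.1.
have bGA := borel_nonneg_restrict mA bG.
rewrite ge0_integralD//; first last.
- by apply: measurable_funTS; exact: (curve_comp_measurable cl (borel_nonnegZ (ltW e0) bG).1).
- by move=> x _; rewrite mule_ge0 ?lee_fin ?(ltW e0)//; exact: bG.2.
- by apply: measurable_funTS; exact: (curve_comp_measurable cl bGA.1).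
- by move=> x _; exact: bGA.2.
rewrite ge0_integralZl ?lee_fin ?(ltW e0)//; first last.
- by move=> x _; exact: bG.2.
- exact: measurable_funTS.
have I0 : 0 <= \int[mu]_(x in `[a, b]) (G (c x)) by apply: integral_ge0 => t _; exact: bG.2.
have IA0 : 0 <= \int[mu]_(x in `[a, b]) ((G \_ A) (c x)) by apply: integral_ge0 => t _; exact: bGA.2.
have [Ioo|Ifin] := eqVneq (\int[mu]_(x in `[a, b]) (G (c x))) +oo.
  move: l0; rewrite le_eqVlt => /predU1P[l0|l0].
    by have := wG l c a b; rewrite -l0 !mul0e => ->//; rewrite l0.
  rewrite Ioo gt0_muley ?lte_fin// addey// ?gt0_muley ?leey ?lte_fin//.
  by rewrite -ltNye (lt_le_trans _ IA0)// ltNy0.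
have {}Ifin : \int[mu]_(x in `[a, b]) (G (c x)) < +oo by rewrite ltey.
apply: (@le_trans _ _ (l%:E * \int[mu]_(x in `[a, b]) (G \_ A) (c x))); last first.
  by rewrite lee_wpmul2l ?lee_fin// leeDl// mule_ge0// lee_fin ltW.
have -> : \int[mu]_(t in `[a, b]) (G \_ A) (c t) =
    \int[mu]_(t in `[a, b]) ((G \o c) \_ (c @^-1` A)) t.
  by apply: eq_integral => t _; rewrite !patchE.
apply: (@hitting_times _ (w \o c) (G \o c)) => //.
- by move=> t; exact: bG.2.
- rewrite -[X in measurable X]setTI.
  exact: (continuous_curve_borel (lipschitz_curve_continuous cl)).
- by move=> s t as_ st tb; exact: wG.
move=> t /andP[a_t tb] h; apply/eqP; rewrite -normr_eq0 eq_le normr_ge0 andbT.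
apply/ler_addgt0Pl => z z0; rewrite addr0.
have [d d0 hd] := @integral_absolutely_continuous _ _ R mu (G \o c) _ (@segment_measurable R a b) mGc
  (fun t => bG.2 (c t)) Ifin _ (divr_gt0 z0 (ltr_wpDl l0 ltr01)).
have [r [/andP[ar rb] rt nr]] := h d d0.
have wcr : w (c r) = 0%R by exact: wA.
have key s s' : (a <= s)%R -> (s <= s')%R -> (s' <= b)%R -> (s' - s < d)%R ->
    (`|w (c s') - w (c s)| <= z)%R.
  move=> as_ ss sb sd; rewrite -lee_fin; apply: le_trans (wG l c s s' l0 cl ss) _.
  apply: (@le_trans _ _ (l%:E * (z / (l + 1))%:E)); last first.
    rewrite -EFinM lee_fin mulrA ler_pdivrMr ?ltr_wpDl// mulrC ler_pM2l//.
    by rewrite lerDl.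
  rewrite lee_wpmul2l ?lee_fin//; apply/ltW; apply: hd => //.
    by apply: subset_itv; rewrite bnd_simp.
  rewrite (_ : _ `[s, s']%classic = mu `[s, s']%classic)// lebesgue_measure_itv/= lte_fin.
  by case: ifPn => _; rewrite -?EFinB lte_fin.
have [tr|rt'] := leP t r.
  have := key t r a_t tr rb; rewrite wcr sub0r normrN; apply.
  by rewrite -(ger0_norm (_ : 0 <= r - t)%R)// subr_ge0.
have := key r t ar (ltW rt') tb; rewrite wcr subr0; apply.
by rewrite -(ger0_norm (_ : 0 <= t - r)%R) 1?distrC// subr_ge0 ltW.
Qed.

End restriction.

(** * Chains, their energy and the infimum over chains *)

Section chains.
Context {R : realType} {X : pmetricType R}.
Implicit Types (A F : X -> R) (x y : X) (s : seq X) (r t : R).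

Fixpoint chain_length x s : R :=
  if s is y :: s' then mdist x y + chain_length y s' else 0.

Fixpoint chain_energy A x s : R :=
  if s is y :: s' then A x * mdist x y + chain_energy A y s' else 0.

(* The chain [x :: s] run through by jumps at the times given by its length. *)
Fixpoint chain_walk x s t : X :=
  if s is y :: s' then
    if t < mdist x y then x else chain_walk y s' (t - mdist x y)
  else x.

Definition short_step r x y := mdist x y <= r.

Lemma chain_length_ge0 x s : 0 <= chain_length x s.
Proof. by elim: s x => //= y s ih x; rewrite addr_ge0// mdist_ge0. Qed.

Lemma chain_energy_ge A (k : R) x s : (forall z, k <= A z) ->
  k * chain_length x s <= chain_energy A x s.
Proof.
move=> kA; elim: s x => [|y s ih] x /=; first by rewrite mulr0.
by rewrite mulrDr lerD// ler_wpM2r ?mdist_ge0.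
Qed.

Lemma chain_energy_le A B x s : (forall z, A z <= B z) ->
  chain_energy A x s <= chain_energy B x s.
Proof.
move=> AB; elim: s x => //= y s ih x.
by rewrite lerD// ler_wpM2r ?mdist_ge0.
Qed.

Lemma chain_walk_dist x s t : 0 <= t -> mdist x (chain_walk x s t) <= t.
Proof.
elim: s x t => [|y s ih] x t t0 /=; first by rewrite mdistxx.
case: ltP => xyt; first by rewrite mdistxx.
apply: le_trans (metric_triangle _ y _) _; rewrite -lerBrDl.
by apply: ih; rewrite subr_ge0.
Qed.

Lemma chain_walk0 x s : chain_walk x s 0 = x.
Proof.
apply/esym/mdist_positivity/eqP; rewrite eq_le mdist_ge0 andbT.
exact: chain_walk_dist.
Qed.

Lemma chain_walk_end x s t : chain_length x s <= t -> chain_walk x s t = last x s.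
Proof.
elim: s x t => //= y s ih x t h.
have xyt : mdist x y <= t by rewrite (le_trans _ h)// lerDl chain_length_ge0.
by rewrite ltNge xyt/=; apply: ih; rewrite lerBrDl.
Qed.

Lemma chain_walk_lipschitz r x s t t' : 0 <= r -> path (short_step r) x s ->
  mdist (chain_walk x s t) (chain_walk x s t') <= `|t - t'| + r.
Proof.
move=> r0; wlog tt : t t' / t <= t'.
  move=> h xs; have [tt|/ltW tt] := leP t t'; first exact: h.
  by rewrite metric_sym distrC; exact: h.
elim: s x t t' tt => [|y s ih] x t t' tt /=.
  by rewrite mdistxx addr_ge0.
move=> /andP[xy sy]; rewrite ler0_norm ?subr_le0// opprB.
case: (ltP t' (mdist x y)) => t'xy.
  by rewrite (le_lt_trans tt t'xy) mdistxx addr_ge0// subr_ge0.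
case: (ltP t (mdist x y)) => txy; last first.
  have tt' : t - mdist x y <= t' - mdist x y by rewrite lerD2r.
  by have := ih y _ _ tt' sy; rewrite ler0_norm ?subr_le0//; lra.
have h := chain_walk_dist y s (_ : 0 <= t' - mdist x y).
rewrite subr_ge0 in h; have {}h := h t'xy.
apply: le_trans (metric_triangle _ y _) _.
by move: xy; rewrite /short_step; lra.
Qed.

Lemma chain_walk_in (P : X -> Prop) x s t : (forall z, z \in x :: s -> P z) ->
  P (chain_walk x s t).
Proof.
elim: s x t => [|y s ih] x t h /=; first by apply: h; rewrite mem_head.
case: ifP => _; first by apply: h; rewrite mem_head.
by apply: ih => z zs; apply: h; rewrite in_cons zs orbT.
Qed.

(* An excursion away from [S] is paid for with density [k]. *)
Lemma chain_excursion A (S : set X) (k e r : R) x s : 0 <= k -> 0 <= r ->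
  (forall z, 0 <= A z) -> (forall z, e <= cdist S z -> k <= A z) ->
  path (short_step r) x s -> forall z, z \in x :: s ->
  k * cdist S z <= chain_energy A x s + k * Num.max (cdist S x) (e + r).
Proof.
move=> k0 r0 A0 Ak; have E0 x' s' : 0 <= chain_energy A x' s'.
  by have := chain_energy_ge x' s' A0; rewrite mul0r.
elim: s x => [|y s ih] x /=.
  by move=> _ z; rewrite inE => /eqP ->; rewrite add0r ler_wpM2l// le_max lexx.
move=> /andP[xy sy] z; rewrite inE => /predU1P[->|zs].
  rewrite -[leLHS]add0r lerD// ?ler_wpM2l// ?le_max ?lexx// addr_ge0//.
  by rewrite mulr_ge0// mdist_ge0.
apply: le_trans (ih y sy z zs) _; rewrite [leRHS]addrAC [leRHS]addrC lerD2l.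
have yx := cdist_lipschitz S y x; rewrite metric_sym in yx.
have [ex|xe] := leP e (cdist S x).
  apply: le_trans (_ : k * (mdist x y + Num.max (cdist S x) (e + r)) <= _).
    rewrite ler_wpM2l// ge_max; apply/andP; split.
      by apply: le_trans yx _; rewrite addrC lerD2l le_max lexx.
    by rewrite -[leLHS]add0r lerD ?mdist_ge0// le_max lexx orbT.
  by rewrite mulrDr lerD2r ler_wpM2r ?mdist_ge0// Ak.
apply: le_trans (_ : k * (e + r) <= _).
  rewrite ler_wpM2l// ge_max lexx andbT; apply: le_trans yx _.
  by apply: lerD => //; exact: ltW.
rewrite -[leLHS]add0r lerD// ?mulr_ge0 ?mdist_ge0//.
by rewrite ler_wpM2l// le_max lexx orbT.
Qed.

(** [Psi] stands for a primitive of [A] along [c]. While the walk rests at [x] the curve is within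
    [e] of [x], so [A (c t)] exceeds [A x] by at most [k * e]. The term [r] is for the instant of
    the jump, when the walk is already at the next point. *)
Lemma chain_primitive_le A (k e r : R) (c : R -> X) (Psi : R -> R) t0 x s :
  0 <= k -> (forall y z, `|A y - A z| <= k * mdist y z) -> 0 <= t0 ->
  (forall u v M, 0 <= u -> u <= v -> (forall t, u <= t <= v -> A (c t) <= M) ->
    Psi v - Psi u <= M * (v - u)) ->
  path (short_step r) x s ->
  (forall t, 0 <= t -> t <= chain_length x s ->
    mdist (c (t0 + t)) (chain_walk x s t) <= e) ->
  Psi (t0 + chain_length x s) - Psi t0 <=
    chain_energy A x s + k * (e + r) * chain_length x s.
Proof.
move=> k0 Ak + PsiM; elim: s x t0 => [|y s ih] x t0 t00 /=.
  by move=> _ _; rewrite addr0 subrr mulr0 addr0.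
move=> /andP[xy sy] cw.
have d0 := mdist_ge0 x y; have l0 := chain_length_ge0 y s.
have h1 : Psi (t0 + mdist x y) - Psi t0 <= (A x + k * (e + r)) * mdist x y.
  have := PsiM t0 (t0 + mdist x y) (A x + k * (e + r)) t00.
  rewrite lerDl => /(_ d0); have -> : t0 + mdist x y - t0 = mdist x y by ring.
  apply => t /andP[t1 t2]; rewrite -lerBlDl.
  apply: le_trans (ler_norm _) _; apply: le_trans (Ak _ _) _; rewrite ler_wpM2l//.
  have t30 : 0 <= t - t0 by rewrite subr_ge0.
  have t3d : t - t0 <= mdist x y by rewrite lerBlDl.
  have := cw (t - t0) t30 (le_trans t3d _); rewrite lerDl => /(_ l0).
  rewrite [t0 + _]addrC subrK.
  case: ltP => txy h; first by apply: le_trans h _; rewrite lerDl (le_trans d0).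
  move: h; rewrite (_ : t - t0 - mdist x y = 0); last by apply/eqP; rewrite subr_eq0 eq_le t3d txy.
  rewrite chain_walk0 => h.
  apply: le_trans (metric_triangle _ y _) _; rewrite lerD//.
  by rewrite metric_sym.
have h2 := ih y (t0 + mdist x y) (addr_ge0 t00 d0) sy.
have {}h2 : Psi (t0 + mdist x y + chain_length y s) - Psi (t0 + mdist x y) <=
    chain_energy A y s + k * (e + r) * chain_length y s.
  apply: h2 => t t1 t2.
  have := cw (mdist x y + t) (addr_ge0 d0 t1).
  rewrite lerD2l => /(_ t2); rewrite ltNge lerDl t1/= addrA.
  by have -> : mdist x y + t - mdist x y = t by ring.
rewrite addrA; move: h1 h2; lra.
Qed.

End chains.

Section chain_infimum.
Context {R : realType} {X : pmetricType R}.
Variables (A F : X -> R) (B k r m : R).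
Hypotheses (A0 : forall x, 0 <= A x) (AB : forall x, A x <= B) (k0 : 0 <= k)
  (Ak : forall x y, `|A x - A y| <= k * mdist x y)
  (r0 : 0 < r) (Fm : forall x, m <= F x).

Definition chain_inf x : R :=
  inf [set F (last x s) + chain_energy A x s | s in [set s | path (short_step r) x s]].

Let E0 x s : 0 <= chain_energy A x s.
Proof. by have := chain_energy_ge x s A0; rewrite mul0r. Qed.

Let lb x : has_lbound
  [set F (last x s) + chain_energy A x s | s in [set s | path (short_step r) x s]].
Proof. by exists m => _ [s _ <-]; rewrite -[m]addr0 lerD. Qed.

Let ne x : [set F (last x s) + chain_energy A x s | s in [set s | path (short_step r) x s]] !=set0.
Proof. by exists (F x + 0), [::]. Qed.

Lemma chain_inf_le x : chain_inf x <= F x.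
Proof. by apply: ge_inf => //; exists [::] => //=; rewrite addr0. Qed.

Lemma chain_inf_ge x : m <= chain_inf x.
Proof. by apply: lb_le_inf => // _ [s _ <-]; rewrite -[m]addr0 lerD. Qed.

Lemma chain_inf_lt x y : chain_inf x < y ->
  exists2 s, path (short_step r) x s & F (last x s) + chain_energy A x s < y.
Proof. by move=> /inf_lt-/(_ (ne x))[_ [s xs <-] sy]; exists s. Qed.

Lemma chain_inf_step x y : mdist x y <= r -> chain_inf x <= chain_inf y + A x * mdist x y.
Proof.
move=> xy; rewrite -lerBlDr; apply: lb_le_inf => // _ [s ys <-].
rewrite lerBlDr -addrA [chain_energy _ _ _ + _]addrC.
by apply: ge_inf => //; exists (y :: s) => //=; apply/andP.
Qed.

Lemma chain_inf_local x y : mdist x y <= r ->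
  `|chain_inf x - chain_inf y| <= (A x + k * mdist x y) * mdist x y.
Proof.
move=> xy; have d0 := mdist_ge0 x y.
have h1 := chain_inf_step xy.
have := @chain_inf_step y x; rewrite metric_sym => /(_ xy) h2.
have h3 : A y * mdist x y <= (A x + k * mdist x y) * mdist x y.
  rewrite ler_wpM2r// -lerBlDl; apply: le_trans (ler_norm _) _.
  by rewrite distrC.
have h4 : A x * mdist x y <= (A x + k * mdist x y) * mdist x y.
  by rewrite ler_wpM2r// lerDl mulr_ge0.
by rewrite ler_norml; apply/andP; split; lra.
Qed.

Lemma chain_inf_continuous : continuous chain_inf.
Proof.
move=> x; apply/cvg_ballP => e e0.
have B0 : 0 <= B := le_trans (A0 x) (AB x).
apply/nbhs_ballP; exists (Num.min r (e / (B + 1))) => /=.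
  by rewrite lt_min r0 divr_gt0// ltr_wpDl.
move=> y; rewrite ballEmdist /ball/= lt_min => /andP[xr].
rewrite ltr_pdivlMr ?ltr_wpDl// => xe; apply: le_lt_trans xe.
have d0 := mdist_ge0 x y.
have h1 := chain_inf_step (ltW xr).
have := @chain_inf_step y x; rewrite metric_sym => /(_ (ltW xr)) h2.
have h3 : A x * mdist x y <= mdist x y * (B + 1).
  by rewrite mulrC ler_wpM2l// (le_trans (AB x))// lerDl.
have h4 : A y * mdist x y <= mdist x y * (B + 1).
  by rewrite mulrC ler_wpM2l// (le_trans (AB y))// lerDl.
by rewrite ler_norml; apply/andP; split; lra.
Qed.

(** Shortly after the time [s] the curve is one admissible step away from [c s], so
    [chain_inf_local] bounds the increment by [A (c s)] times the distance up to a quadratic error.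
    [increments_le] sums these bounds, once for [chain_inf] and once for its opposite. *)
Lemma chain_inf_upper_gradient : lip_upper_gradient chain_inf (EFin \o A).
Proof.
move=> l c a b l0 cl ab.
have cA : continuous A := lipschitz_continuous Ak.
have m2 : measurable_fun setT (A \o c).
  apply: (@measurableT_comp _ _ _ _ (borel X)) => //; first exact: continuous_borel.
  exact: continuous_curve_borel (lipschitz_curve_continuous cl).
have b2 t : 0 <= (A \o c) t <= B by rewrite /= A0 AB.
rewrite -(primitiveE m2 b2 ab) -EFinM lee_fin.
pose Q t := l * primitive (A \o c) a t.
have Qa : Q a = 0 by rewrite /Q primitivexx mulr0.
have key s t : a <= s -> s <= t -> t <= b -> t - s < r / (l + 1) ->
    `|chain_inf (c t) - chain_inf (c s)| <= Q t - Q s + 2 * (k * l ^+ 2) * (t - s) ^+ 2.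
  move=> as_ st tb; rewrite ltr_pdivlMr ?ltr_wpDl// => tsr.
  have ts0 : 0 <= t - s by rewrite subr_ge0.
  have dl : mdist (c s) (c t) <= l * (t - s).
    by apply: le_trans (cl _ _) _; rewrite distrC ger0_norm.
  have dr : mdist (c s) (c t) <= r.
    by apply: le_trans dl _; apply: le_trans (ltW tsr); rewrite mulrC ler_wpM2l// lerDl.
  rewrite distrC; apply: le_trans (chain_inf_local dr) _.
  have d0 := mdist_ge0 (c s) (c t).
  apply: (@le_trans _ _ ((A (c s) + k * (l * (t - s))) * (l * (t - s)))).
    apply: ler_pM => //; first by rewrite addr_ge0// mulr_ge0.
    by rewrite lerD2l ler_wpM2l.
  have h2 : (A (c s) - k * (l * (t - s))) * (l * (t - s)) <= Q t - Q s.
    rewrite /Q -mulrBr.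
    have h0 := @primitive_ge _ _ _ m2 b2 a _ _ (Num.max 0 (A (c s) - k * (l * (t - s)))) as_ st.
    apply: le_trans (_ : Num.max 0 (A (c s) - k * (l * (t - s))) * (l * (t - s)) <= _).
      by rewrite ler_wpM2r ?mulr_ge0// le_max lexx orbT.
    rewrite mulrCA ler_wpM2l//; apply: h0; first by rewrite le_max lexx.
    move=> x /andP[x1 x2] /=; rewrite ge_max A0/= lerBlDr -lerBlDl.
    apply: le_trans (ler_norm _) _; apply: le_trans (Ak _ _) _; rewrite ler_wpM2l//.
    apply: le_trans (cl _ _) _; rewrite ler_wpM2l//.
    by rewrite distrC ger0_norm ?subr_ge0//; lra.
  have -> : 2 * (k * l ^+ 2) * (t - s) ^+ 2 = 2 * (k * (l * (t - s)) ^+ 2) by ring.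
  by rewrite -lerBlDr; apply: le_trans h2; lra.
have d0 : 0 < r / (l + 1) by rewrite divr_gt0// ltr_wpDl.
rewrite ler_norml; apply/andP; split.
  have := @increments_le _ (fun t => - chain_inf (c t)) Q a b (2 * (k * l ^+ 2)) _ ab d0.
  rewrite Qa subr0 /Q => h; rewrite lerNl; apply: le_trans (h _); first by lra.
  move=> s t as_ st tb tsr; apply: le_trans (key s t as_ st tb tsr).
  by rewrite -normrN; apply: le_trans (ler_norm _); lra.
have := @increments_le _ (chain_inf \o c) Q a b (2 * (k * l ^+ 2)) _ ab d0.
rewrite Qa subr0 /Q => h; apply: h.
move=> s t as_ st tb tsr; apply: le_trans (key s t as_ st tb tsr).
exact: ler_norm.
Qed.

End chain_infimum.

(** * Limits along an ultrafilter *)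

Section ultralimits.
Context {R : realType} {X : pmetricType R}.
Variable U : set_system nat.
Hypotheses (UU : UltraFilter U) (Uoo : \oo `<=` U).

Let UF : ProperFilter U := @ultra_proper _ _ UU.

Let US (A B : set nat) : U A -> A `<=` B -> U B.
Proof. by move=> UA AB; apply: filterS UA. Qed.

Let UI (A B : set nat) : U A -> U B -> U (A `&` B).
Proof. exact: filterI. Qed.

Let UE (A : set nat) : (forall n, A n) -> U A.
Proof. by move=> h; apply: filterE. Qed.

Let Uex (A : set nat) : U A -> exists n, A n.
Proof. exact: filter_ex. Qed.

Lemma ultra_setU (A B : set nat) : U (A `|` B) -> U A \/ U B.
Proof.
move=> UAB; have [|UA] := in_ultra_setVsetC A UU; first by left.
by right; apply: (US (UI UAB UA)) => n [[]].
Qed.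

Lemma ultra_near (A : set nat) N : (forall n, (N <= n)%N -> A n) -> U A.
Proof. by move=> h; apply: Uoo; exists N. Qed.

Lemma ultra_ord (P : nat -> set nat) N : (forall i, (i < N)%N -> U (P i)) ->
  U [set n | forall i, (i < N)%N -> P i n].
Proof.
elim: N => [|N ih] h; first exact: UE.
have h' := UI (ih (fun i iN => h i (ltnW iN))) (h N (ltnSn N)).
by apply: (US h') => n [h1 h2] i; rewrite ltnS leq_eqVlt => /predU1P[->//|]; exact: h1.
Qed.

Definition totally_bounded_set (S : set X) := forall e : R, 0 < e ->
  exists s : seq X, forall x, S x -> exists2 z, z \in s & mdist z x < e.

(** At each scale the ultrafilter selects one of finitely many balls, with centre [z k]. A sequence
    [u (v k)] picked inside the first [k + 1] selected balls is Cauchy, and its limit in [D] is the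
    limit of [u] along the ultrafilter. *)
Lemma ultralimit_exists (D : set X) (u : nat -> X) : complete_set D ->
  U [set n | D (u n)] ->
  (forall e : R, 0 < e -> exists s : seq X, U [set n | exists2 z, z \in s & mdist z (u n) < e]) ->
  exists2 x, D x & forall e : R, 0 < e -> U [set n | mdist x (u n) < e].
Proof.
move=> cD UD tb.
have net (e : R) : 0 < e -> exists z, U [set n | mdist z (u n) < e].
  move=> e0; have [s] := tb e e0; elim: s => [|z s ih] h.
    by have [n []] := Uex h.
  have /ultra_setU[h1|h1] : U ([set n | mdist z (u n) < e] `|`
      [set n | exists2 z, z \in s & mdist z (u n) < e]).
  - by apply: (US h) => n [y]; rewrite inE => /predU1P[->|ys] yn; [left|right; exists y].
  - by exists z.
  - exact: ih.
have /choice[z hz] : forall k : nat, exists z, U [set n | mdist z (u n) < k.+1%:R^-1].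
  by move=> k; apply: net; rewrite invr_gt0 ltr0n.
have /choice[v hv] : forall k : nat, exists n, D (u n) /\
    forall i, (i < k.+1)%N -> mdist (z i) (u n) < i.+1%:R^-1.
  move=> k.
  have [n [h1 h2]] := Uex (UI UD (ultra_ord (N := k.+1) (fun i _ => hz i))).
  by exists n.
have zv i k : (i <= k)%N -> mdist (z i) (u (v k)) < i.+1%:R^-1.
  by move=> ik; have [_] := hv k; apply; rewrite ltnS.
have small (e : R) : 0 < e -> exists N : nat, N.+1%:R^-1 < e.
  by move=> e0; have [N] := ltr_add_invr e0; rewrite add0r => h; exists N.
have [||x Dx vx] := cD (u \o v).
- by move=> k; have [] := hv k.
- apply/cauchy_ballP => e e0; have e20 : 0 < e / 2 by rewrite divr_gt0.
  have [N hN] := small _ e20.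
  pose V := [set u (v k) | k in [set k | (N <= k)%N]].
  have FV : (u \o v @ \oo) V by exists N => // k Nk; exists k.
  exists (V, V); first by split.
  move=> [_ _] [[a Na <-] [b Nb <-]]; rewrite ballEmdist /=.
  apply: le_lt_trans (metric_triangle _ (z N) _) _; rewrite metric_sym [e]splitr.
  by apply: ltrD; apply: lt_trans hN; exact: zv.
exists x => // e e0.
have e20 : 0 < e / 2 by rewrite divr_gt0.
have e40 : 0 < e / 2 / 2 by rewrite divr_gt0.
have [N hN] := small _ e40.
have [k Nk xk] : exists2 k, (N <= k)%N & mdist x (u (v k)) < e / 2.
  have /cvg_ballP/(_ _ e20)[N' _ h] := vx.
  exists (maxn N N'); first exact: leq_maxl.
  by have := h (maxn N N') (leq_maxr _ _); rewrite /= ballEmdist.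
apply: (US (hz N)) => n /= zn.
apply: le_lt_trans (metric_triangle _ (u (v k)) _) _; rewrite [e]splitr; apply: ltrD => //.
apply: le_lt_trans (metric_triangle _ (z N) _) _; rewrite metric_sym [e / 2]splitr.
apply: ltrD; first by apply: lt_trans hN; exact: zv.
by apply: lt_trans hN; exact: zn.
Qed.

(** The limit is the supremum of the levels [t] for which [t <= u n] holds on a set of the
    ultrafilter. *)
Lemma ultralimit_real (u : nat -> R) (M : R) : (forall n, 0 <= u n <= M) ->
  exists2 x, 0 <= x <= M & forall e : R, 0 < e -> U [set n | `|x - u n| < e].
Proof.
move=> uM; pose S := [set t | U [set n | t <= u n]].
have S0 : S 0 by apply: UE => n; case/andP: (uM n).
have SM t : S t -> t <= M.
  by move=> /Uex[n /= h]; apply: le_trans h _; case/andP: (uM n).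
have hs : has_sup S by split; [exists 0|exists M].
exists (sup S).
  by rewrite ub_le_sup//=; [apply: ge_sup => //; exists 0|case: hs].
move=> e e0; have [t St te] := sup_adherent e0 hs.
have nS : ~ S (sup S + e).
  by move=> /(ub_le_sup hs.2); rewrite -subr_ge0; lra.
have [//|h] := in_ultra_setVsetC [set n | sup S + e <= u n] UU.
apply: (US (UI St h)) => n [/= h1 /negP]; rewrite -ltNge => h2.
by rewrite ltr_norml; apply/andP; split; lra.
Qed.

End ultralimits.

(** * Increasing sequences of Lipschitz densities *)

Section density.
Context {R : realType} {X : pmetricType R}.
Variables (kap : R) (Q : nat -> set X).
Hypothesis kap0 : 0 < kap.

(** The index [n] is both the number of terms and the slope of the cutoffs: each [density n] is
    bounded and Lipschitz, and the sequence increases. The floor [kap] makes the energy of a chain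
    control its length. *)
Definition density n x : R :=
  kap + \sum_(k < n) kap * 2 ^+ k * Num.min 1 (n%:R * cdist (Q k) x).

Definition density_sup : X -> \bar R := esup_fun (fun n x => (density n x)%:E).

Let c0 k : 0 <= kap * 2 ^+ k.
Proof. by rewrite mulr_ge0 ?exprn_ge0// ltW. Qed.

Let t0 n k x : 0 <= Num.min 1 (n%:R * cdist (Q k) x).
Proof. by rewrite le_min ler01 mulr_ge0// cdist_ge0. Qed.

Lemma density_ge n x : kap <= density n x.
Proof. by rewrite lerDl sumr_ge0// => k _; rewrite mulr_ge0. Qed.

Lemma density_ge0 n x : 0 <= density n x.
Proof. by rewrite (le_trans (ltW kap0))// density_ge. Qed.

Lemma density_le n x : density n x <= kap + \sum_(k < n) kap * 2 ^+ k.
Proof.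
rewrite lerD2l; apply: ler_sum => k _.
by rewrite ler_piMr// ge_min lexx.
Qed.

Lemma density_mono n m x : (n <= m)%N -> density n x <= density m x.
Proof.
move=> nm; rewrite lerD2l (big_ord_widen m (fun k => kap * 2 ^+ k * Num.min 1 (n%:R * cdist (Q k) x)) nm).
rewrite [leLHS]big_mkcond/=; apply: ler_sum => k _; case: ifP => _; last by rewrite mulr_ge0.
rewrite ler_wpM2l// le_min ge_min lexx/= ge_min; apply/orP; right.
by rewrite ler_wpM2r ?cdist_ge0// ler_nat.
Qed.

Lemma density_lipschitz n x y :
  `|density n x - density n y| <= (\sum_(k < n) kap * 2 ^+ k * n%:R) * mdist x y.
Proof.
have -> : density n x - density n y = \sum_(k < n) kap * 2 ^+ k *
    (Num.min 1 (n%:R * cdist (Q k) x) - Num.min 1 (n%:R * cdist (Q k) y)).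
  rewrite /density opprD addrACA subrr add0r -sumrB.
  by apply: eq_bigr => k _; rewrite mulrBr.
apply: le_trans (ler_norm_sum _ _ _) _; rewrite mulr_suml; apply: ler_sum => k _.
rewrite normrM ger0_norm// -!mulrA ler_wpM2l ?(ltW kap0)//.
rewrite ler_wpM2l ?exprn_ge0//; apply: le_trans (dist_min_le _ _ _) _.
by rewrite -mulrBr normrM ger0_norm// ler_wpM2l// cdist_lipschitz_norm.
Qed.

Lemma density_far n k x : (k < n)%N -> 1 <= n%:R * cdist (Q k) x ->
  kap * 2 ^+ k <= density n x.
Proof.
move=> kn h; rewrite /density (bigD1 (Ordinal kn))//= min_l// mulr1.
rewrite addrCA lerDl addr_ge0 ?(ltW kap0)// sumr_ge0// => i _.
by rewrite mulr_ge0.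
Qed.

Lemma density_borel n : borel_nonneg (EFin \o density n).
Proof.
split; last by move=> x; rewrite lee_fin density_ge0.
by apply/measurable_EFinP; apply: continuous_borel; exact: lipschitz_continuous (density_lipschitz n).
Qed.

Lemma density_sup_borel : borel_nonneg density_sup.
Proof. by apply: borel_nonneg_esup => n; exact: density_borel. Qed.

Lemma density_le_sup n x : ((density n x)%:E <= density_sup x)%E.
Proof. exact: (esup_fun_ge (fun n x => (density n x)%:E)). Qed.

Lemma curve_integral_density_sup l (c : R -> X) a b y : lipschitz_curve l c ->
  (forall n, (\int[lebesgue_measure]_(t in `[a, b]) (density n (c t))%:E <= y)%E) ->
  (\int[lebesgue_measure]_(t in `[a, b]) density_sup (c t) <= y)%E.
Proof.
move=> cl h.
have nd t : {homo (fun n => (density n (c t))%:E) : n m / (n <= m)%N >-> (n <= m)%E}.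
  by move=> n m nm; rewrite lee_fin density_mono.
have -> : (\int[lebesgue_measure]_(t in `[a, b]) density_sup (c t) =
    \int[lebesgue_measure]_(t in `[a, b]) limn (fun n => (density n (c t))%:E))%E.
  apply: eq_integral => t _; apply/esym/cvg_lim => //.
  exact: (ereal_nondecreasing_cvgn (nd t)).
rewrite (monotone_convergence lebesgue_measure (@segment_measurable R a b)
    (g' := fun n t => (density n (c t))%:E)).
- apply: lime_le; last exact: nearW.
  apply: ereal_nondecreasing_is_cvgn => n m nm.
  apply: (curve_integral_le a b cl (density_borel n) (density_borel m)) => x.
  by rewrite lee_fin density_mono.
- by move=> n; apply: measurable_funTS; exact: (curve_comp_measurable cl (density_borel n).1).
- by move=> n t _; exact: (density_borel n).2.
- by move=> t _; exact: nd.
Qed.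

End density.

(** * Lower bound for chain infima on a totally bounded set *)

Section chain_approximation.
Context {R : realType} {X : pmetricType R}.
Variables (kap : R) (Q : nat -> set X).
Hypothesis kap0 : 0 < kap.

Lemma totally_bounded_setU (S T : set X) : totally_bounded_set S -> totally_bounded_set T ->
  totally_bounded_set (S `|` T).
Proof.
move=> hS hT e e0; have [s hs] := hS e e0; have [t ht] := hT e e0.
exists (s ++ t) => x [/hs|/ht] [z zs zx]; exists z => //; rewrite mem_cat zs ?orbT//.
Qed.

(** [D'] contains the [eta]-neighbourhood of [D], so chains confined near the subsets [Q k] and [K]
    of [D] run inside a complete set and limits of their points exist. The two ends of a chain are
    treated differently: at the end point lower semicontinuity of [F] is used, at the starting point
    continuity of [f] on [K]. *)
Lemma chain_approximation (D D' K : set X) (eta M : R) (f F : X -> R) :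
  complete_set D' -> 0 < eta -> (forall x y, D x -> mdist x y < eta -> D' y) ->
  (forall k, Q k `<=` D) -> (forall k, totally_bounded_set (Q k)) ->
  K `<=` D -> totally_bounded_set K -> closed K ->
  (forall x, `|f x| <= M) -> (forall x, f x <= F x) ->
  (forall x (e : R), 0 < e -> exists2 d : R, 0 < d & forall y, mdist x y < d -> F x - e < F y) ->
  (forall x (e : R), K x -> 0 < e ->
    exists2 d : R, 0 < d & forall y, K y -> mdist x y < d -> `|f x - f y| < e) ->
  lip_upper_gradient f (density_sup kap Q) ->
  forall del : R, 0 < del -> exists n, forall x, K x ->
    f x - del <= chain_inf (density kap Q n) F n.+1%:R^-1 x.
Proof.
move=> cD' eta0 DD' QD tbQ KD tbK cK fM fF lscF cf fG del del0.
apply: contrapT => nex.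
have r0 n : (0 : R) < n.+1%:R^-1 by rewrite invr_gt0 ltr0n.
have Fm x : - M <= F x.
  by apply: le_trans (fF x); have := fM x; rewrite ler_norml => /andP[].
pose A n := density kap Q n.
have A0 n x : 0 <= A n x by exact: density_ge0.
(* near-optimal chains violating the claim at every scale *)
have /choice[xs hxs] : forall n, exists xs : X * seq X, [/\ K xs.1,
    path (short_step n.+1%:R^-1) xs.1 xs.2 &
    F (last xs.1 xs.2) + chain_energy (A n) xs.1 xs.2 < f xs.1 - del].
  move=> n; have : ~ forall x, K x -> f x - del <= chain_inf (A n) F n.+1%:R^-1 x.
    by move=> h; apply: nex; exists n.
  move=> /existsNP[x /not_implyP[Kx /negP]]; rewrite -ltNge => /chain_inf_lt[s ps hs].
  by exists (x, s).
pose x n := (xs n).1; pose s n := (xs n).2.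
have Kx n : K (x n) by case: (hxs n).
have ps n : path (short_step n.+1%:R^-1) (x n) (s n) by case: (hxs n).
have hE n : F (last (x n) (s n)) + chain_energy (A n) (x n) (s n) < f (x n) - del.
  by case: (hxs n).
have EM n : chain_energy (A n) (x n) (s n) <= 2 * M.
  have := hE n; have := Fm (last (x n) (s n)).
  by have := fM (x n); rewrite ler_norml => /andP[_]; lra.
pose Lam n := chain_length (x n) (s n).
(* [L] bounds the lengths of all the chains: their energies are at most [2 * M] and the density is
   at least [kap]. *)
pose L := 2 * M / kap.
have LamL n : 0 <= Lam n <= L.
  rewrite chain_length_ge0/= ler_pdivlMr// mulrC.
  apply: le_trans (EM n); apply: chain_energy_ge => z; exact: density_ge.
have L0 : 0 <= L by have /andP[h1 h2] := LamL 0%N; exact: le_trans h2.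
have M0 : 0 <= 2 * M by move: L0; rewrite /L pmulr_lge0// invr_gt0.
have small (e : R) : 0 < e -> exists N : nat, forall n, (N <= n)%N -> n.+1%:R^-1 < e.
  move=> e0; have [N] := ltr_add_invr e0; rewrite add0r => h; exists N => n Nn.
  by apply: le_lt_trans h; rewrite lef_pV2 ?posrE// ler_nat ltnS.
have big (y : R) : exists N, forall n, (N <= n)%N -> y <= n%:R.
  exists (Num.bound `|y|) => n Nn; apply: le_trans (ler_norm _) _.
  by rewrite (le_trans (ltW (archi_boundP (normr_ge0 y))))// ler_nat.
have [U [UU Uoo]] := @ultraFilterLemma _ (\oo : set_system nat) _.
have UF : ProperFilter U := @ultra_proper _ _ UU.
have US (P P' : set nat) : U P -> P `<=` P' -> U P' by move=> ? ?; apply: filterS; eassumption.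
have UI (P P' : set nat) : U P -> U P' -> U (P `&` P') by exact: filterI.
have Uex (P : set nat) : U P -> exists n, P n by exact: filter_ex.
(* all the chains eventually stay close to a totally bounded set *)
have near_tb (e : R) : 0 < e -> exists2 k : nat, True & exists N, forall n, (N <= n)%N ->
    forall z, z \in x n :: s n -> cdist (Q k `|` K) z < e.
  move=> e0; have e30 : 0 < e / 3 by rewrite divr_gt0.
  (* Moving from distance [2 e / 3] to distance [e] costs at least [kap 2^k e / 3], which is to
     exceed the bound [2 * M] on the energy; [k < 2^k] yields such a [k]. *)
  have [k hk] := big (2 * M / (kap * (e / 3)) + 1).
  have {}hk : 2 * M < kap * 2 ^+ k * (e / 3).
    rewrite (_ : kap * _ * _ = 2 ^+ k * (kap * (e / 3))); last by ring.
    rewrite -ltr_pdivrMr ?mulr_gt0//.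
    apply: lt_le_trans (_ : k%:R <= _); first by have := hk k (leqnn k); lra.
    by rewrite -natrX ler_nat ltnW// ltn_expl.
  exists k => //; have [N1 h1] := small _ e30; have [N2 h2] := big (e / 3)^-1.
  exists (maxn N1 (maxn N2 k.+1)) => n; rewrite !geq_max => /and3P[n1 n2 kn] z zs.
  have k0 : 0 < kap * 2 ^+ k by rewrite mulr_gt0// exprn_gt0.
  have := @chain_excursion _ _ (A n) (Q k `|` K) (kap * 2 ^+ k) (e / 3) n.+1%:R^-1
    (x n) (s n) (ltW k0) (ltW (r0 n)) (A0 n).
  have far y : e / 3 <= cdist (Q k `|` K) y -> kap * 2 ^+ k <= A n y.
    move=> ey; apply: density_far => //.
    have ey' : e / 3 <= cdist (Q k) y.
      apply: le_trans ey _; apply: lb_le_inf; first by exists 1; left.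
      move=> _ [->|[a Qa <-]]; first exact: cdist_le1.
      by apply: cdist_le; left.
    rewrite -[leLHS](mulVf (lt0r_neq0 e30)); apply: ler_pM => //; [by rewrite invr_ge0 ltW|exact: ltW|exact: h2].
  move=> /(_ far (ps n) z zs); rewrite (cdist_eq0 (or_intror (Kx n))) max_r; last first.
    by rewrite addr_ge0// ltW.
  have := EM n; have h3 := h1 n n1 => h4 h5.
  rewrite -(ltr_pM2l k0); apply: le_lt_trans h5 _.
  have : kap * 2 ^+ k * (e / 3 + n.+1%:R^-1) <= kap * 2 ^+ k * (e / 3 + e / 3).
    by rewrite ler_pM2l// lerD2l ltW.
  have -> : kap * 2 ^+ k * e = kap * 2 ^+ k * (e / 3 + e / 3) + kap * 2 ^+ k * (e / 3) by field.
  by move=> h6; apply: le_lt_trans (lerD h4 h6) _; rewrite addrC ltrD2l.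
pose walk n t := chain_walk (x n) (s n) t.
have walk_lip n t t' : mdist (walk n t) (walk n t') <= `|t - t'| + n.+1%:R^-1.
  by apply: chain_walk_lipschitz => //; exact/ltW.
(* The limit of the walks is taken at each time separately. By the choice of [eta] the walks
   eventually run in [D'], and the totally bounded sets close to them provide the finite nets. *)
have /choice[c hc] : forall t, exists y, D' y /\ forall e : R, 0 < e -> U [set n | mdist y (walk n t) < e].
  move=> t; have [||y Dy hy] := @ultralimit_exists _ _ U UU D' (walk^~ t) cD'.
  - have e10 : 0 < Num.min eta 1 by rewrite lt_min eta0 ltr01.
    have [k _ [N hN]] := near_tb _ e10.
    apply: (ultra_near Uoo (N := N)) => n Nn /=.
    apply: (chain_walk_in (P := fun y => D' y)) => z /(hN n Nn) h.
    have [|a Sa za] := cdist_lt h; first by rewrite ge_min lexx orbT.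
    apply: (DD' a); first by case: Sa => [/QD|/KD].
    by rewrite metric_sym; apply: lt_le_trans za _; rewrite ge_min lexx.
  - move=> e e0; have e20 : 0 < Num.min (e / 2) 1 by rewrite lt_min divr_gt0// ltr01.
    have [k _ [N hN]] := near_tb _ e20.
    have [l hl] := @totally_bounded_setU _ _ (tbQ k) tbK (e / 2) (divr_gt0 e0 (ltr0Sn _ _)).
    exists l; apply: (ultra_near Uoo (N := N)) => n Nn /=.
    apply: (chain_walk_in (P := fun y => exists2 z, z \in l & mdist z y < e)) => z /(hN n Nn) h.
    have [|a Sa za] := cdist_lt h; first by rewrite ge_min lexx orbT.
    have [z' z'l z'a] := hl a Sa; exists z' => //.
    apply: le_lt_trans (metric_triangle _ a _) _; rewrite [e]splitr; apply: ltrD => //.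
    by rewrite metric_sym; apply: lt_le_trans za _; rewrite ge_min lexx.
  - by exists y.
have {}hc : forall t (e : R), 0 < e -> U [set n | mdist (c t) (walk n t) < e].
  by move=> t; exact: (hc t).2.
have cl : lipschitz_curve 1 c.
  move=> t t'; rewrite mul1r; apply/ler_addgt0Pr => e e0.
  have e30 : 0 < e / 3 by rewrite divr_gt0.
  have [N hN] := small _ e30.
  have [n [[/= n1 n2] n3]] := Uex _ (UI _ _ (UI _ _ (hc t _ e30) (hc t' _ e30))
    (ultra_near Uoo (N := N) hN)).
  have := metric_triangle (c t) (walk n t) (c t').
  have := metric_triangle (walk n t) (walk n t') (c t').
  rewrite [mdist (walk n t') _]metric_sym; have := walk_lip n t t'.
  by move: n1 n2 n3 => /=; move: (n.+1%:R^-1) => rr; lra.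
(* Pointwise convergence is uniform on [0, L]: the curve is 1-Lipschitz and the walks are so up to
   [1 / (n + 1)], so a finite grid of step [e / 4] is enough. *)
have unif (e : R) : 0 < e -> U [set n | forall t, 0 <= t <= L -> mdist (c t) (walk n t) <= e].
  move=> e0; have e40 : 0 < e / 4 by rewrite divr_gt0.
  have [N hN] := big (L / (e / 4)).
  have hNU := ultra_ord UU (N := N.+1) (fun i _ => hc (i%:R * (e / 4)) _ e40).
  have [N' hN'] := small _ e40.
  apply: (US _ _ (UI _ _ hNU (ultra_near Uoo (N := N') hN'))) => n [/= n1 n2] t /andP[t0 tL].
  pose i := Num.trunc (t / (e / 4)).
  have te0 : 0 <= t / (e / 4) by rewrite divr_ge0// ltW.
  have /andP[i1 i2] := Num.Theory.truncn_itv te0.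
  rewrite ler_pdivlMr// in i1; rewrite ltr_pdivrMr// in i2.
  have iN : (i < N.+1)%N.
    rewrite ltnS -(ler_nat R); apply: le_trans (hN N (leqnn N)).
    by apply: (@le_trans _ _ (t / (e / 4))); [rewrite ler_pdivlMr|rewrite ler_pM2r ?invr_gt0].
  have h1 := n1 i iN.
  have h2 := cl t (i%:R * (e / 4)); have h3 := walk_lip n (i%:R * (e / 4)) t.
  have := metric_triangle (c t) (c (i%:R * (e / 4))) (walk n t).
  have := metric_triangle (c (i%:R * (e / 4))) (walk n (i%:R * (e / 4))) (walk n t).
  rewrite mul1r ger0_norm ?subr_ge0// in h2.
  rewrite ler0_norm ?subr_le0// in h3.
  move: i2; rewrite -natr1 mulrDl mul1r; move: h1 h2 h3 n2.
  by move: (n.+1%:R^-1) => rr; lra.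
(* [L'] is the limit of the lengths. On [0, L'] the limit curve joins a limit of the starting points
   to a limit of the end points. *)
have [L' /andP[L'0 L'L] hL'] := ultralimit_real UU LamL.
have c0 (e : R) : 0 < e -> U [set n | mdist (c 0) (x n) < e].
  by move=> e0; apply: (US _ _ (hc 0 e e0)) => n /=; rewrite /walk chain_walk0.
have cL' (e : R) : 0 < e -> U [set n | mdist (c L') (last (x n) (s n)) < e].
  move=> e0; have e30 : 0 < e / 3 by rewrite divr_gt0.
  have [N hN] := small _ e30.
  apply: (US _ _ (UI _ _ (UI _ _ (hc L' _ e30) (hL' _ e30)) (ultra_near Uoo (N := N) hN))).
  move=> n [[/= n1 n2] n3].
  have := walk_lip n L' (Lam n); rewrite {2}/walk chain_walk_end// => h.
  have := metric_triangle (c L') (walk n L') (last (x n) (s n)).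
  by move: n1 n2 n3 h => /=; move: (n.+1%:R^-1) => rr; lra.
have Kc0 : K (c 0).
  apply: contrapT => nK; have c00 := cdist_gt0 cK nK.
  have [n /= h] := Uex _ (c0 _ c00).
  by have := cdist_le (c 0) (Kx n); rewrite leNgt h.
(* The density is frozen at the index [m] while the chains are those of index [n >= m]: the
   Lipschitz constant of [A m] does not depend on [n], and [A m <= A n]. Monotone convergence in [m]
   follows afterwards. *)
have energy m (e : R) : 0 < e ->
    (\int[lebesgue_measure]_(t in `[0%R, L']) (density kap Q m (c t))%:E <=
      (f (c 0) - F (c L') - del + e)%:E)%E.
  move=> e0.
  have mA : measurable_fun setT (A m \o c).
    by have /measurable_EFinP := curve_comp_measurable cl (density_borel Q kap0 m).1.
  pose B := kap + \sum_(k < m) kap * 2 ^+ k.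
  have bA t : 0 <= (A m \o c) t <= B by rewrite /= A0 density_le.
  have B0 : 0 <= B by apply: le_trans (A0 m (c 0)) _; exact: density_le.
  rewrite -(primitiveE mA bA L'0) lee_fin.
  pose k := \sum_(k < m) kap * 2 ^+ k * m%:R.
  have k0 : 0 <= k.
    by rewrite /k sumr_ge0// => i _; rewrite !mulr_ge0// ?exprn_ge0// ltW.
  (* The error [e] is shared equally by four terms: semicontinuity of [F] at [c L'], continuity of
     [f] at [c 0], the distance between curve and walk ([e1]), and the difference between [L'] and
     the length of the chain ([e2]). *)
  pose e1 := e / 4 / (k * (L + 1) + 1).
  have kL0 : 0 < k * (L + 1) + 1 by rewrite ltr_wpDl// mulr_ge0// addr_ge0.
  have e10 : 0 < e1 by rewrite !divr_gt0.
  pose e2 := e / 4 / (B + 1).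
  have e20 : 0 < e2 by rewrite !divr_gt0// ltr_wpDl.
  have e40 : 0 < e / 4 by rewrite divr_gt0.
  have [d1 d10 hd1] := lscF (c L') _ e40.
  have [d2 d20 hd2] := cf (c 0) _ Kc0 e40.
  have e120 : 0 < e1 / 2 by rewrite divr_gt0.
  have [N hN] := small _ e120.
  have [n [[[[[/= n1 n2] n3] n4] n5] n6]] := Uex _ (UI _ _ (UI _ _ (UI _ _ (UI _ _ (UI _ _
    (unif _ e120) (hL' _ e20)) (cL' _ d10)) (c0 _ d20)) (ultra_near Uoo (N := N) hN))
    (ultra_near Uoo (N := m) (fun n mn => mn))).
  have {}hd1 := hd1 _ n3; have {}hd2 := hd2 _ (Kx n) n4.
  pose Psi t := primitive (A m \o c) 0 t.
  have Psi0 : Psi 0 = 0 by rewrite /Psi primitivexx.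
  have /andP[Ln0 LnL] := LamL n.
  have h1 : Psi (Lam n) <= chain_energy (A m) (x n) (s n) + k * e1 * Lam n.
    have := @chain_primitive_le _ _ (A m) k (e1 / 2) n.+1%:R^-1 c Psi 0 (x n) (s n) k0
      (density_lipschitz Q kap0 m) (lexx 0).
    rewrite add0r Psi0 subr0 => h; apply: le_trans (h _ (ps n) _) _.
    - by move=> u v M' u0 uv hM; exact: (primitive_le mA bA).
    - by move=> t t0 tL; rewrite add0r; apply: n1; rewrite t0 (le_trans tL).
    - rewrite lerD2l ler_wpM2r// ler_wpM2l//; move: n5 => /=; move: (n.+1%:R^-1) => rr; lra.
  have h2 : Psi L' <= Psi (Lam n) + B * e2.
    have [LL|LL] := leP L' (Lam n).
      have := primitive_ge mA bA L'0 LL (lexx 0) (fun t _ => (andP (bA t)).1).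
      by rewrite mul0r -/(Psi _) -/(Psi _); have := mulr_ge0 B0 (ltW e20); lra.
    have := primitive_le mA bA Ln0 (ltW LL) (fun t _ => (andP (bA t)).2).
    rewrite -/(Psi _) -/(Psi _) lerBlDl => /le_trans; apply; rewrite lerD2l ler_wpM2l//.
    by apply/ltW; apply: le_lt_trans n2; exact: ler_norm.
  have h3 : chain_energy (A m) (x n) (s n) <= chain_energy (A n) (x n) (s n).
    by apply: chain_energy_le => z; exact: density_mono.
  have h4 : k * e1 * Lam n <= e / 4.
    apply: (@le_trans _ _ (k * e1 * (L + 1))).
      apply: ler_wpM2l; first by apply: mulr_ge0 => //; exact: ltW.
      by apply: le_trans LnL _; rewrite lerDl.
    have -> : k * e1 * (L + 1) = e / 4 * (k * (L + 1) / (k * (L + 1) + 1)).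
      by rewrite /e1; field; rewrite lt0r_neq0.
    by rewrite ler_piMr ?(ltW e40)// ler_pdivrMr// mul1r lerDl.
  have h5 : B * e2 <= e / 4.
    have B10 : 0 < B + 1 by rewrite ltr_wpDl.
    have -> : B * e2 = e / 4 * (B / (B + 1)) by rewrite /e2; field; rewrite lt0r_neq0.
    by rewrite ler_piMr ?(ltW e40)// ler_pdivrMr// mul1r lerDl.
  rewrite -/(Psi L'); have := hE n; move: hd2; rewrite ltr_norml => /andP[hd2 hd3].
  by move: h1 h2 h3 h4 h5 hd1 hd2 hd3; lra.
have tot : (\int[lebesgue_measure]_(t in `[0%R, L']) density_sup kap Q (c t) <=
    (f (c 0) - F (c L') - del)%:E)%E.
  apply/lee_addgt0Pr => e e0; rewrite -EFinD.
  by apply: (curve_integral_density_sup kap0 cl) => m; exact: energy.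
(* The upper gradient inequality bounds [f (c 0) - f (c L')] by this integral, and [f <= F] at
   [c L'] then contradicts [0 < del]. *)
have := le_trans (fG 1 c 0 L' ler01 cl L'0) _; rewrite mul1e => /(_ _ tot).
rewrite lee_fin distrC => h; have := le_trans (ler_norm _) h; have := fF (c L').
by lra.
Qed.

End chain_approximation.

(** * Inner regularity and Lusin's theorem for the completed measure *)

Section completed_measure.
Context {R : realType} {X : pmetricType R}.
Variable mu : {measure set (borel X) -> \bar R}.
Local Notation cara := (caratheodory_type (mu^*)%mu).
Local Notation nu := (@completed_measure_extension _ _ _ mu).
Local Open Scope ereal_scope.

Lemma borel_cara (E : set X) : measurable (E : set (borel X)) -> measurable (E : set cara).
Proof. exact: caratheodory_measurable_mu_ext. Qed.

Lemma completed_borelE (E : set X) : measurable (E : set (borel X)) ->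
  nu (E : set cara) = mu (E : set (borel X)).
Proof. by move=> mE; rewrite /completed_measure_extension/= measurable_mu_extE. Qed.

Lemma borel_cara_fun d (T : measurableType d) (f : X -> T) :
  measurable_fun setT (f : borel X -> T) -> measurable_fun setT (f : cara -> T).
Proof.
move=> mf _ B mB; rewrite setTI; apply: borel_cara.
by rewrite -[X in measurable X]setTI; exact: mf.
Qed.

Lemma completed_hull (E : set cara) (e : R) : (0 < e)%R -> nu E < +oo ->
  exists H : set X, [/\ measurable (H : set (borel X)), E `<=` H &
    mu (H : set (borel X)) < nu E + e%:E].
Proof.
move=> e0 Eoo.
have Efin : nu E \is a fin_num by rewrite ge0_fin_numE.
have : nu E < nu E + e%:E by rewrite lteDl// lte_fin.
rewrite {1}/completed_measure_extension /mu_ext => /ereal_inf_lt[_ [A [mA EA] <-] h].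
exists (\bigcup_k A k); split => //.
  by apply: bigcup_measurable => k _; exact: mA.
apply: le_lt_trans h; apply: measure_sigma_subadditive => //.
by apply: bigcup_measurable => k _; exact: mA.
Qed.

Variable D : set X.
Hypotheses (cD : closed D) (Doo : mu (D : set (borel X)) < +oo).

Let mDb : measurable (D : set (borel X)) := closed_borel cD.
Let mD : measurable (D : set cara) := borel_cara mDb.

Lemma nuD : nu (D : set cara) < +oo. Proof. by rewrite completed_borelE. Qed.

Lemma sub_nu_lty (E : set cara) : measurable E -> E `<=` D -> nu E < +oo.
Proof.
move=> mE ED; apply: le_lt_trans nuD.
by apply: le_measure; rewrite ?inE.
Qed.

(** A Borel hull [H] of [D \ E] with small excess meets [E] in a small set, and [D \ H] is a Borel
    subset of [E], to which the regularity of finite Borel measures applies. *)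
Lemma inner_closed (E : set cara) (e : R) : measurable E -> E `<=` D -> (0 < e)%R ->
  exists Q : set X, [/\ closed Q, Q `<=` E & nu (E `\` Q) < e%:E].
Proof.
move=> mE ED e0; have e20 : (0 < e / 2)%R by rewrite divr_gt0.
have mDE : measurable (D `\` E : set cara) by exact: measurableD.
have DEoo : nu (D `\` E) < +oo by apply: sub_nu_lty => // x [].
have [H [mH DEH hH]] := completed_hull e20 DEoo.
have mH' := borel_cara mH.
have EHsmall : nu (E `&` H) < (e / 2)%:E.
  have HE : nu H = nu (H `\` E) + nu (H `&` E).
    rewrite -measureU//; [|exact: measurableD|exact: measurableI|]; first by rewrite setUC setUIDK.
    by apply/seteqP; split => // x [[_ nE] [_ ?]].
  have h1 : nu (D `\` E) <= nu (H `\` E).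
    apply: le_measure; rewrite ?inE//; first exact: measurableD.
    by move=> x [Dx nEx]; split => //; exact: DEH.
  rewrite -completed_borelE// HE in hH.
  have hfin : nu (D `\` E) \is a fin_num by rewrite ge0_fin_numE.
  rewrite setIC -(lteD2lE _ _ hfin); apply: le_lt_trans hH.
  by rewrite leeD2r.
have fin : mrestr mu mDb setT < +oo by rewrite /mrestr setTI.
pose E' : set X := D `\` H.
have mE' : measurable (E' : set (borel X)) by exact: measurableD.
have [Q [V [cQ oV QE EV hQ]]] := finite_borel_regular fin mE' e20.
exists Q; split => //.
  by move=> x /QE[Dx nHx]; apply: contrapT => nEx; apply: nHx; exact: DEH.
have mQ : measurable (Q : set cara) by apply: borel_cara; exact: closed_borel.
apply: (@le_lt_trans _ _ (nu (E `&` H) + nu (E' `\` Q : set cara))).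
  have mE'' : measurable (E' : set cara) by exact: borel_cara.
  apply: le_trans (measureU2 _ _ _); last 2 first.
  - exact: measurableI.
  - exact: measurableD.
  apply: le_measure; rewrite ?inE//; first exact: measurableD.
    by apply: measurableU; [exact: measurableI|exact: measurableD].
  move=> x [Ex nQx]; have [Hx|nHx] := pselect (H x); first by left.
  by right; split => //; split => //; exact: ED.
rewrite [e]splitr EFinD; apply: lteD => //.
rewrite completed_borelE; last by apply: measurableD => //; exact: closed_borel.
apply: le_lt_trans hQ; rewrite /= /mrestr; apply: le_measure; rewrite ?inE.
- by apply: measurableD => //; exact: closed_borel.
- apply: measurableI => //; apply: measurableD; [exact: open_borel|exact: closed_borel].
- by move=> x [E'x nQx]; split; [split => //; exact: EV|case: E'x].
Qed.

Hypothesis sep : separable X.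

Lemma dense_sequence : exists z : nat -> X, forall x (e : R), (0 < e)%R ->
  exists k, (mdist (z k) x < e)%R.
Proof.
have [S cS dS] := sep.
have /pcard_surjP[z zS] := cS.
exists z => x e e0.
have [|y [/= xy Sy]] := dS (interior (ball x e)) _ (@open_interior _ _).
  by exists x; apply: nbhs_singleton; apply: nbhs_interior; exact: nbhsx_ballx.
have [k _ zk] := zS y Sy; exists k; rewrite zk metric_sym.
by have := interior_subset xy; rewrite ballEmdist.
Qed.

Lemma nonincreasing_small (F : nat -> set X) :
  (forall n, measurable (F n : set (borel X))) -> (F 0%N `<=` D) ->
  (forall n k, (n <= k)%N -> F k `<=` F n) -> (forall x, exists n, ~ F n x) ->
  forall e : R, (0 < e)%R -> exists n, mu (F n : set (borel X)) < e%:E.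
Proof.
move=> mF FD Fn F0 e e0.
have fin n : mu (F n : set (borel X)) \is a fin_num.
  rewrite ge0_fin_numE//; apply: le_lt_trans Doo; apply: le_measure; rewrite ?inE//.
  by move=> x /(Fn 0%N n (leq0n _)) /FD.
have F0' : \bigcap_n F n = set0.
  by rewrite -subset0 => x h; have [n nF] := F0 x; apply: nF; exact: h.
have := @nonincreasing_cvg_mu _ _ _ mu F; rewrite F0' measure0.
have h0 : mu (F 0%N : set (borel X)) < +oo by rewrite ltey_eq fin.
move=> /(_ h0 mF measurable0) h.
have /fine_cvgP[_ /cvgrPdist_lt/(_ e e0)[N _ /(_ N (leqnn N))]] : mu \o F @ \oo --> 0%:E.
  by apply: h => n k nk; apply/subsetPset; exact: Fn.
rewrite /= sub0r normrN ger0_norm ?fine_ge0// => h'; exists N.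
by rewrite -(fineK (fin N)) lte_fin.
Qed.

Lemma closed_ball_mdist z (r : R) : closed [set x : X | (mdist z x <= r)%R].
Proof.
have -> : [set x : X | (mdist z x <= r)%R] = [set x | (- r <= - mdist z x)%R].
  by apply/seteqP; split => x /=; rewrite lerN2.
apply: closed_superlevel; apply: (@lipschitz_continuous _ _ _ 1) => x y; rewrite mul1r.
have h1 := metric_triangle z x y; have h2 := metric_triangle z y x.
by rewrite metric_sym in h2; rewrite [mdist x z]metric_sym [mdist y x]metric_sym in h2;
  rewrite ler_norml; apply/andP; split; lra.
Qed.

(** Ulam's argument: at each scale [1 / (m + 1)], finitely many closed balls around a dense sequence
    cover [D] up to measure [e / 2^(m+1)]. The intersection over all scales is totally bounded. *)
Lemma totally_bounded_inner (e : R) : (0 < e)%R ->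
  exists C : set X, [/\ closed C, totally_bounded_set C, C `<=` D &
    mu (D `\` C : set (borel X)) <= e%:E].
Proof.
move=> e0; have [z hz] := dense_sequence.
pose B m k := [set x : X | (mdist (z k) x <= m.+1%:R^-1)%R].
have cB m k : closed (B m k) by exact: closed_ball_mdist.
have mB m k : measurable (B m k : set (borel X)) by exact: closed_borel.
pose F m n := D `\` \bigcup_(k < n) B m k.
have mF m n : measurable (F m n : set (borel X)).
  by apply: measurableD => //; exact: bigcup_measurable.
have pe m : (0 < e / (2 ^ m.+1)%:R)%R by rewrite divr_gt0// ltr0n expn_gt0.
have /choice[N hN] : forall m, exists n, mu (F m n : set (borel X)) < (e / (2 ^ m.+1)%:R)%:E.
  move=> m; apply: nonincreasing_small => //.
  - by move=> x [].
  - by move=> n k nk x [Dx h]; split => // -[j /= jn Bj]; apply: h; exists j => //=; exact: leq_trans nk.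
  - move=> x; have [|k hk] := hz x (m.+1%:R^-1)%R; first by rewrite invr_gt0 ltr0n.
    by exists k.+1 => -[_]; apply; exists k => //=; exact: ltW.
exists (D `&` \bigcap_m \bigcup_(k < N m) B m k); split.
- apply: closedI => //; apply: closed_bigI => m _.
  by rewrite bigcup_mkord; apply: closed_bigsetU => k _.
- move=> d d0; have [m] := ltr_add_invr d0; rewrite add0r => hm.
  exists [seq z k | k <- iota 0 (N m)] => x [Dx /(_ m I)[k /= kN Bk]].
  exists (z k); last by apply: le_lt_trans hm.
  by apply: map_f; rewrite mem_iota.
- by move=> x [].
apply: (@le_trans _ _ (mu (\bigcup_m F m (N m)))).
  apply: le_measure; rewrite ?inE//.
  - apply: measurableD => //; apply: measurableI => //; apply: bigcapT_measurable => m.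
    exact: bigcup_measurable.
  - exact: bigcup_measurable.
  - move=> x [Dx h]; have : ~ (\bigcap_m \bigcup_(k < N m) B m k) x by move=> ?; apply: h.
    by move=> /existsNP[m /not_implyP[_ hm]]; exists m => //.
apply: le_trans (@measure_sigma_subadditive _ _ _ mu _ (fun m => F m (N m)) _ _ _) _ => //.
  exact: bigcup_measurable.
apply: le_trans (_ : (\sum_(0 <= i <oo) (e / (2 ^ i.+1)%:R)%:E <= _)).
  by apply: lee_nneseries => // i _; exact/ltW.
by apply: epsilon_trick0; exact: ltW.
Qed.

Lemma totally_bounded_subset (S T : set X) : S `<=` T -> totally_bounded_set T ->
  totally_bounded_set S.
Proof. by move=> ST hT e /hT[s hs]; exists s => x /ST /hs. Qed.

Lemma inner_regular (E : set cara) (e : R) : measurable E -> E `<=` D -> (0 < e)%R ->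
  exists Q : set X, [/\ closed Q, totally_bounded_set Q, Q `<=` E & nu (E `\` Q) < e%:E].
Proof.
move=> mE ED e0; have e20 : (0 < e / 2)%R by rewrite divr_gt0.
have [Q [cQ QE hQ]] := inner_closed mE ED e20.
have [C [cC tC CD hC]] := totally_bounded_inner e20.
have mQ := borel_cara (closed_borel cQ); have mC := borel_cara (closed_borel cC).
exists (Q `&` C); split.
- exact: closedI.
- by apply: totally_bounded_subset tC => x [].
- by move=> x [/QE].
apply: (@le_lt_trans _ _ (nu (E `\` Q) + nu (D `\` C : set cara))).
  apply: le_trans (measureU2 _ _ _); last 2 first.
  - exact: measurableD.
  - exact: measurableD.
  apply: le_measure; rewrite ?inE//.
    exact: (measurableD mE (measurableI _ _ mQ mC)).
    exact: (measurableU _ _ (measurableD mE mQ) (measurableD mD mC)).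
  move=> x [Ex nQC]; have [Qx|nQx] := pselect (Q x); last by left.
  by right; split => [|Cx]; [exact: ED|exact: nQC].
rewrite [e]splitr EFinD; apply: lte_leD => //.
  rewrite ge0_fin_numE//; apply: (sub_nu_lty (measurableD mD mC)); exact: subDsetl.
by rewrite completed_borelE//; apply: measurableD => //; exact: closed_borel.
Qed.

(** For each rational [q k], the parts of [D] where [f < q k] and where [f >= q k] are replaced by
    closed subsets. On the intersection [K] of their unions [f] is continuous: for rationals
    [a < f x < b], the point [x] has positive distance from the closed set on which [f < a] and from
    the one on which [f >= b]. *)
Lemma lusin (f : X -> R) (e : R) : measurable_fun setT (f : cara -> R) -> (0 < e)%R ->
  exists K : set X, [/\ closed K, totally_bounded_set K, K `<=` D,
    nu (D `\` K : set cara) <= e%:E &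
    forall x (d : R), K x -> (0 < d)%R -> exists2 r : R, (0 < r)%R &
      forall y, K y -> (mdist x y < r -> `|f x - f y| < d)%R].
Proof.
move=> mf e0.
(* [q] enumerates the rationals; a number that codes none yields 0. *)
pose q k : R := ratr (odflt 0%R (unpickle k : option rat)).
have qex (a b : R) : (a < b)%R -> exists k, (a < q k < b)%R.
  move=> /rat_in_itvoo[r]; rewrite in_itv/= => arb.
  by exists (pickle r); rewrite /q pickleK.
pose E k : set cara := D `&` [set x | f x < q k]%R.
have mE k : measurable (E k).
  by apply: measurableI => //; rewrite -[X in measurable X]setTI; exact: measurable_fun_ltr.
have pe k : (0 < e / (2 ^ k.+1)%:R / 2)%R by rewrite !divr_gt0// ltr0n expn_gt0.
have /choice[Q hQ] : forall k, exists Q : set X * set X,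
    [/\ closed Q.1 /\ closed Q.2, totally_bounded_set Q.1 /\ totally_bounded_set Q.2,
     Q.1 `<=` E k, Q.2 `<=` D `\` E k &
     nu (D `\` (Q.1 `|` Q.2) : set cara) <= (e / (2 ^ k.+1)%:R)%:E].
  move=> k.
  have mDE : measurable (D `\` E k : set cara) by exact: measurableD.
  have [|Q1 [c1 t1 Q1E h1]] := inner_regular (mE k) _ (pe k); first by move=> x [].
  have [|Q2 [c2 t2 Q2E h2]] := inner_regular mDE _ (pe k); first by move=> x [].
  exists (Q1, Q2); split => //=.
  have m1 := borel_cara (closed_borel c1); have m2 := borel_cara (closed_borel c2).
  rewrite [X in _ <= X%:E]splitr EFinD.
  apply: le_trans (_ : nu (E k `\` Q1) + nu ((D `\` E k) `\` Q2 : set cara) <= _).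
    apply: le_trans (measureU2 _ _ _); last 2 first.
    - exact: measurableD.
    - exact: measurableD.
    apply: le_measure; rewrite ?inE//.
      by apply: measurableD => //; exact: measurableU.
      by apply: measurableU; exact: measurableD.
    move=> x [Dx nQ]; have [Ex|nEx] := pselect (E k x).
      by left; split => // Q1x; apply: nQ; left.
    by right; split => // Q2x; apply: nQ; right.
  by apply: leeD; exact: ltW.
pose K := \bigcap_k ((Q k).1 `|` (Q k).2).
have KD : K `<=` D.
  by move=> x /(_ 0%N I); have [_ _ h1 h2 _] := hQ 0%N => -[/h1[]|/h2[]].
exists K; split => //.
- by apply: closed_bigI => k _; have [[c1 c2] _ _ _ _] := hQ k; exact: closedU.
- have [_ [t1 t2] _ _ _] := hQ 0%N.
  by apply: totally_bounded_subset (totally_bounded_setU t1 t2) => x /(_ 0%N I).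
- pose G k : set cara := D `\` ((Q k).1 `|` (Q k).2).
  have mG k : measurable (G k).
    have [[c1 c2] _ _ _ _] := hQ k; apply: measurableD => //.
    by apply: measurableU; apply: borel_cara; exact: closed_borel.
  have mK : measurable (K : set cara).
    apply: bigcapT_measurable => k; have [[c1 c2] _ _ _ _] := hQ k.
    by apply: measurableU; apply: borel_cara; exact: closed_borel.
  apply: (@le_trans _ _ (nu (\bigcup_k G k))).
    apply: le_measure; rewrite ?inE//.
    + exact: measurableD.
    + exact: bigcup_measurable.
    + move=> x [Dx /existsNP[k /not_implyP[_ hk]]]; exists k => //.
  apply: le_trans (@measure_sigma_subadditive _ _ _ nu _ G _ _ _) _ => //.
    exact: bigcup_measurable.
  apply: le_trans (_ : (\sum_(0 <= i <oo) (e / (2 ^ i.+1)%:R)%:E <= _)).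
    by apply: lee_nneseries => // i _; case: (hQ i).
  by apply: epsilon_trick0; exact: ltW.
move=> x d Kx d0.
have [a /andP[a1 a2]] := qex (f x - d)%R (f x) ltac:(by rewrite ltrBlDr ltrDl).
have [b /andP[b1 b2]] := qex (f x) (f x + d)%R ltac:(by rewrite ltrDl).
have out (S : set X) : closed S -> ~ S x -> exists2 r : R, (0 < r)%R &
    forall y, (mdist x y < r)%R -> ~ S y.
  move=> cS nS; exists (cdist S x); first exact: cdist_gt0.
  by move=> y xy Sy; have := cdist_le x Sy; rewrite leNgt xy.
have [[_ cb2] _ _ Qb2 _] := hQ b; have [[ca1 _] _ Qa1 _ _] := hQ a.
have [|r1 r10 h1] := out _ cb2.
  by move=> /Qb2[Dx]; apply; split.
have [|r2 r20 h2] := out _ ca1.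
  by move=> /Qa1[Dx] /=; rewrite ltNge (ltW a2).
exists (Num.min r1 r2); first by rewrite lt_min r10.
move=> y Ky; rewrite lt_min => /andP[y1 y2].
have fb : (f y < q b)%R.
  have [_ _ Qb1 _ _] := hQ b.
  by have [/Qb1[]|/(h1 y y1)] := Ky b I.
have fa : (q a <= f y)%R.
  have [_ _ _ Qa2 _] := hQ a.
  have [/(h2 y y2)//|/Qa2[Dy nE]] := Ky a I.
  by rewrite leNgt; apply/negP => h; apply: nE; split.
by rewrite ltr_norml; apply/andP; split; lra.
Qed.

End completed_measure.

(** * Integrals of [p]-th powers *)

Section power_integral.
Local Open Scope ereal_scope.
Context d (T : measurableType d) {R : realType} (m : {measure set T -> \bar R}).
Variable p : R.
Hypothesis p1 : (1 <= p)%R.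
Implicit Types (f g : T -> \bar R) (D A : set T).

Let p0 : (0 <= p)%R := le_trans ler01 p1.
Let pn0 : p != 0%R := lt0r_neq0 (lt_le_trans ltr01 p1).

Lemma poweR_le (x y : \bar R) : 0 <= x -> x <= y -> x `^ p <= y `^ p.
Proof.
move=> x0 xy; apply: gt0_ler_poweR => //; rewrite in_itv/= ?x0 ?leey//.
by rewrite (le_trans x0 xy).
Qed.

Definition power_integral D f := \int[m]_(x in D) (f x) `^ p.

Lemma poweR_measurable f : measurable_fun setT f -> measurable_fun setT (fun x => f x `^ p).
Proof. by move=> mf; apply: (measurableT_comp (measurable_poweR p)). Qed.

Lemma power_integral_ge0 D f : 0 <= power_integral D f.
Proof. by apply: integral_ge0 => x _; exact: poweR_ge0. Qed.

Lemma power_integral_le D f g : measurable D -> measurable_fun setT f ->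
  measurable_fun setT g -> (forall x, D x -> 0 <= f x) -> (forall x, D x -> f x <= g x) ->
  power_integral D f <= power_integral D g.
Proof.
move=> mD mf mg f0 fg; apply: ge0_le_integral => //.
- by move=> x _; exact: poweR_ge0.
- exact/measurable_funTS/poweR_measurable.
- exact/measurable_funTS/poweR_measurable.
- by move=> x Dx; apply: poweR_le; [exact: f0|exact: fg].
Qed.

Lemma power_integral_subset D A f : measurable D -> measurable A -> A `<=` D ->
  measurable_fun setT f -> power_integral A f <= power_integral D f.
Proof.
move=> mD mA AD mf; apply: ge0_subset_integral => //.
- exact/measurable_funTS/poweR_measurable.
- by move=> x _; exact: poweR_ge0.
Qed.

Lemma power_integral_restrict D A f :
  power_integral D (f \_ A) = power_integral (D `&` A) f.
Proof.
rewrite /power_integral integral_mkcondr; apply: eq_integral => x _.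
by rewrite !patchE; case: ifP => // _; rewrite poweR0r.
Qed.

Lemma power_integralZ D f (k : R) : measurable D -> measurable_fun setT f ->
  (forall x, D x -> 0 <= f x) -> (0 <= k)%R ->
  power_integral D (fun x => k%:E * f x) = (k `^ p)%:E * power_integral D f.
Proof.
move=> mD mf f0 k0; rewrite /power_integral -ge0_integralZl_EFin ?powR_ge0//.
- by apply: eq_integral => x; rewrite inE => Dx; rewrite poweRM ?f0.
- by move=> x _; exact: poweR_ge0.
- exact/measurable_funTS/poweR_measurable.
Qed.

Lemma power_integral_cst D (k : R) : measurable D ->
  power_integral D (fun=> k%:E) = (k `^ p)%:E * m D.
Proof. by move=> mD; rewrite /power_integral integral_cst. Qed.

(** A sum is at most twice the larger term. This crude form of Minkowski's inequality keeps [p]-th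
    powers throughout and avoids roots. *)
Lemma power_integralD D f g : measurable D -> measurable_fun setT f ->
  measurable_fun setT g -> (forall x, 0 <= f x) -> (forall x, 0 <= g x) ->
  power_integral D (fun x => f x + g x) <=
    (2 `^ p)%:E * (power_integral D f + power_integral D g).
Proof.
move=> mD mf mg f0 g0.
have mfp := measurable_funTS (D := D) (poweR_measurable mf).
have mgp := measurable_funTS (D := D) (poweR_measurable mg).
rewrite /power_integral -ge0_integralD//; last 2 first.
- by move=> x _; exact: poweR_ge0.
- by move=> x _; exact: poweR_ge0.
rewrite -ge0_integralZl_EFin ?powR_ge0//; last 2 first.
- by move=> x _; rewrite adde_ge0// poweR_ge0.
- exact: emeasurable_funD.
apply: ge0_le_integral => //.
- by move=> x _; exact: poweR_ge0.
- by apply/measurable_funTS/poweR_measurable; exact: emeasurable_funD.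
- by apply: measurable_funeM; exact: emeasurable_funD.
move=> x _; rewrite -poweR_EFin.
apply: (@le_trans _ _ ((2%:E * maxe (f x) (g x)) `^ p)).
  apply: poweR_le; first exact: adde_ge0.
  rewrite -[2%R]/(1 + 1)%R EFinD ge0_muleDl// !mul1e.
  by apply: leeD; rewrite le_max lexx ?orbT.
rewrite poweRM//; last by rewrite le_max f0.
rewrite lee_wpmul2l ?poweR_ge0//; case: (leP (f x) (g x)) => _.
  by rewrite leeDr// poweR_ge0.
by rewrite leeDl// poweR_ge0.
Qed.

(** Pointwise, each term is at most the [p]-th root of the sum [S] of the [p]-th powers, hence so is
    the supremum. *)
Lemma power_integral_esup D (fs : (T -> \bar R)^nat) : measurable D ->
  (forall j, measurable_fun setT (fs j)) -> (forall j x, 0 <= fs j x) ->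
  power_integral D (esup_fun fs) <= \sum_(0 <= j <oo) power_integral D (fs j).
Proof.
move=> mD mfs fs0; rewrite /power_integral -integral_nneseries//; last 2 first.
- by move=> j; exact/measurable_funTS/poweR_measurable.
- by move=> j x _; exact: poweR_ge0.
apply: ge0_le_integral => //.
- by move=> x _; exact: poweR_ge0.
- apply/measurable_funTS/poweR_measurable; exact: esup_fun_measurable.
- apply: ge0_emeasurable_sum => [j x _ _|j _]; first exact: poweR_ge0.
  exact/measurable_funTS/poweR_measurable.
move=> x _; set S := (X in _ <= X).
have fsS j : fs j x `^ p <= S.
  have h := @nneseries_lim_ge R (fun j => fs j x `^ p) xpredT 0 j.+1
    (fun j _ _ => poweR_ge0 _ _).
  apply: le_trans h; rewrite big_nat_recr//= leeDr//.
  by apply: sume_ge0 => i _; exact: poweR_ge0.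
have S0 : 0 <= S by apply: le_trans (fsS 0%N); exact: poweR_ge0.
have root (u y : \bar R) : 0 <= y -> y `^ p <= u -> y <= u `^ p^-1.
  move=> y0 yu; have := @gt0_ler_poweR _ p^-1 _ (y `^ p) u.
  rewrite -poweRrM divff// poweRe1//; apply => //.
  - by rewrite invr_ge0.
  - by rewrite in_itv/= poweR_ge0 leey.
  - by rewrite in_itv/= leey andbT (le_trans _ yu)// poweR_ge0.
apply: (@le_trans _ _ ((S `^ p^-1) `^ p)); last first.
  by rewrite -poweRrM mulVf// poweRe1.
apply: poweR_le; first by apply: le_trans (esup_fun_ge fs 0 x); exact: fs0.
by apply: esup_fun_le => j; apply: root.
Qed.

End power_integral.

Lemma sum_le_esup {R : realType} (v : (\bar R)^nat) n : (forall j, 0 <= v j)%E ->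
  (\sum_(j < n) v j <= ereal_sup (range (fun j => (2 ^+ j.+1)%:E * v j)))%E.
Proof.
move=> v0; set S := ereal_sup _.
have vS j : ((2 ^+ j.+1)%:E * v j <= S)%E by apply: ereal_sup_ubound; exists j.
have S0 : (0 <= S)%E.
  by apply: le_trans (vS 0%N); rewrite mule_ge0// lee_fin exprn_ge0.
have step j : (v j <= (2 ^- j.+1)%:E * S)%E.
  rewrite -(@lee_pmul2l _ (2 ^+ j.+1)%:E) ?lte_fin ?exprn_gt0//.
  by rewrite [leRHS]muleA -[(_%:E * _%:E)%E in leRHS]EFinM divff ?expf_neq0// mul1e.
apply: (@le_trans _ _ ((1 - 2 ^- n)%:E * S)%E); last first.
  rewrite -[leRHS]mul1e lee_wpmul2r// lee_fin gerDl oppr_le0 invr_ge0.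
  exact: exprn_ge0.
elim: n => [|n ih]; first by rewrite big_ord0 expr0 invr1 subrr mul0e.
rewrite big_ord_recr/=.
have -> : (1 - 2 ^- n.+1 = (1 - 2 ^- n) + 2 ^- n.+1 :> R)%R.
  by rewrite exprS; field; rewrite expf_neq0.
rewrite EFinD ge0_muleDl.
- by apply: leeD.
- by rewrite lee_fin subr_ge0 invf_le1 ?exprn_gt0// exprn_ege1// ler1n.
- by rewrite lee_fin invr_ge0.
Qed.

(** * The Vitali-Caratheodory theorem *)

Section vitali_caratheodory.
Context {R : realType} {X : pmetricType R}.
Variables (mu : {measure set (borel X) -> \bar R}) (p : R) (D : set X).
Local Notation cara := (caratheodory_type (mu^*)%mu).
Local Notation nu := (@completed_measure_extension _ _ _ mu).
Local Open Scope ereal_scope.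
Hypotheses (p1 : (1 <= p)%R) (cD : closed D) (Doo : mu (D : set (borel X)) < +oo)
  (sep : separable X).

Let mD : measurable (D : set cara) := borel_cara mu (closed_borel cD).

(** Off the first [N] sets the density reaches [kap + kap + 2 kap + ... + 2^(N-1) kap = kap 2^N]
    once the cutoffs have saturated. With [N] the first index of a set containing [x] this is the
    bound assumed on [y]; at a point of no [Q k] the density is infinite. *)
Lemma density_sup_ge (kap : R) (Q : nat -> set X) (y : \bar R) x : (0 < kap)%R ->
  (forall k, closed (Q k)) -> 0 <= y ->
  (forall k, Q k x -> y <= (kap * 2 ^+ k)%:E) -> y <= density_sup kap Q x.
Proof.
move=> kap0 cQ y0 hy.
have c0 k : (0 <= kap * 2 ^+ k)%R by rewrite mulr_ge0 ?exprn_ge0// ltW.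
have t0 n k : (0 <= Num.min 1 (n%:R * cdist (Q k) x))%R.
  by rewrite le_min ler01 mulr_ge0// cdist_ge0.
(* if x avoids the first N sets then its density is at least kap 2^N *)
have key N : (forall k, (k < N)%N -> ~ Q k x) -> (kap * 2 ^+ N)%:E <= density_sup kap Q x.
  move=> nQ.
  have [n [Nn hn]] : exists n, (N <= n)%N /\
      forall k, (k < N)%N -> (1 <= n%:R * cdist (Q k) x)%R.
    elim: N nQ => [|N ih] nQ; first by exists 0%N.
    have [n [Nn hn]] := ih (fun k kN => nQ k (ltnW kN)).
    have d0 : (0 < cdist (Q N) x)%R by apply: cdist_gt0 => //; exact: nQ.
    pose n' := Num.bound (cdist (Q N) x)^-1.
    have hn' : (1 <= n'%:R * cdist (Q N) x)%R.
      rewrite -ler_pdivrMr// mul1r; apply/ltW/archi_boundP.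
      by rewrite invr_ge0 ltW.
    exists (maxn n.+1 n'); split; first by rewrite (leq_trans _ (leq_maxl _ _)).
    move=> k; rewrite ltnS leq_eqVlt => /predU1P[->|kN].
      apply: le_trans hn' _; rewrite ler_wpM2r ?cdist_ge0// ler_nat; exact: leq_maxr.
    apply: le_trans (hn k kN) _; rewrite ler_wpM2r ?cdist_ge0// ler_nat.
    by rewrite (leq_trans _ (leq_maxl _ _)).
  apply: le_trans (density_le_sup kap Q n x); rewrite lee_fin /density.
  apply: (@le_trans _ _ (kap + \sum_(k < N) kap * 2 ^+ k)%R).
    elim: N {nQ Nn hn} => [|N ih]; first by rewrite big_ord0 addr0 expr0 mulr1.
    by rewrite big_ord_recr/= addrA exprS; move: ih; lra.
  rewrite lerD2l (big_ord_widen n (fun k => kap * 2 ^+ k)%R Nn) [leLHS]big_mkcond/=.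
  apply: ler_sum => k _; case: ifP => [kN|_]; last by rewrite mulr_ge0.
  by rewrite min_l ?mulr1// hn.
have [[k Qk]|nQ] := pselect (exists k, Q k x).
  have /ex_minnP[j /asboolP Qj jmin] : exists k, `[< Q k x >] by exists k; apply/asboolP.
  apply: le_trans (hy j Qj) _; apply: key => i ij Qi.
  by have := jmin i (introT (asboolP _) Qi); rewrite leqNgt ij.
have : +oo <= density_sup kap Q x.
  rewrite leye_eq; apply/eqP/eqyP => r r0.
  have [N hN] : exists N : nat, (r / kap <= N%:R)%R.
    by exists (Num.bound (r / kap)); apply/ltW/archi_boundP; rewrite divr_ge0// ltW.
  apply: le_trans (key N _); last by move=> k _ Qk; apply: nQ; exists k.
  rewrite lee_fin -ler_pdivrMl// mulrC; apply: le_trans hN _.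
  by rewrite -natrX ler_nat ltnW// ltn_expl.
by move=> h; apply: le_trans h; rewrite leey.
Qed.

(** The levels [kap 2^k] below [g x] add up to at most [2 g x]. A level with [g x <= kap 2^k]
    contributes only if [x] is outside [Q k], that is, in the exceptional set of that level; the
    weights [2^(k+1)] bound the sum of these contributions by a supremum. *)
Lemma density_sup_le (kap : R) (Q : nat -> set X) (g : X -> \bar R) x : (0 < kap)%R ->
  0 <= g x -> density_sup kap Q x <= kap%:E + 2%:E * g x +
    esup_fun (fun k x => (2 ^+ k.+1)%:E * ((cst (kap * 2 ^+ k)%:E) \_
      ([set x | g x <= (kap * 2 ^+ k)%:E] `\` Q k)) x) x.
Proof.
move=> kap0 g0; set S := esup_fun _ x.
have c0 k : (0 <= kap * 2 ^+ k)%R by rewrite mulr_ge0 ?exprn_ge0// ltW.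
pose u k : \bar R := ((cst (kap * 2 ^+ k)%:E) \_
      ([set x | g x <= (kap * 2 ^+ k)%:E] `\` Q k)) x.
have u0 k : 0 <= u k by rewrite /u patchE; case: ifP => // _; rewrite lee_fin.
have S0 : 0 <= S.
  apply: le_trans (_ : (2 ^+ 1)%:E * u 0%N <= _); first by rewrite mule_ge0// lee_fin exprn_ge0.
  exact: (esup_fun_ge (fun k x => (2 ^+ k.+1)%:E * ((cst (kap * 2 ^+ k)%:E) \_
      ([set x | g x <= (kap * 2 ^+ k)%:E] `\` Q k)) x) 0 x).
apply: esup_fun_le => n.
case gx : (g x) g0 => [r| |] // r0; last first.
  rewrite gt0_muley ?lte_fin// addey// addye ?leey//.
  by rewrite -ltNye (lt_le_trans _ S0)// ltNy0.
apply: (@le_trans _ _ (kap%:E + 2%:E * r%:E + \sum_(k < n) u k)); last first.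
  by rewrite leeD2l//; exact: sum_le_esup.
have uE k : u k = (fine (u k))%:E.
  by rewrite /u patchE; case: ifP.
under eq_bigr do rewrite uE.
rewrite sumEFin -EFinM -!EFinD lee_fin /density -addrA lerD2l.
pose b k : R := (if `[< Q k x >] then 0 else 1)%R.
apply: (@le_trans _ _ (\sum_(k < n) kap * 2 ^+ k * b k)%R).
  apply: ler_sum => k _; rewrite ler_wpM2l// /b; case: asboolP => Qk.
    by rewrite cdist_eq0// mulr0 ge_min lexx orbT.
  by rewrite ge_min lexx.
elim: n => [|n ih]; first by rewrite !big_ord0 addr0 mulr_ge0.
have [rn|rn] := leP r (kap * 2 ^+ n)%R; last first.
  (* all the levels up to n lie below g x *)
  apply: (@le_trans _ _ (\sum_(k < n.+1) kap * 2 ^+ k)%R).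
    by apply: ler_sum => k _; rewrite ler_piMr// /b; case: ifP.
  apply: (@le_trans _ _ (2 * (kap * 2 ^+ n)))%R.
    elim: n {ih rn} => [|n ih].
      by rewrite big_ord_recr big_ord0/= add0r ler_peMl// ?lerDl.
    by rewrite big_ord_recr/=; move: ih; rewrite exprS; lra.
  apply: (@le_trans _ _ (2 * r)%R); first by rewrite ler_pM2l// ltW.
  by rewrite lerDl sumr_ge0// => k _; rewrite fine_ge0.
rewrite big_ord_recr/= [X in (_ <= _ + X)%R]big_ord_recr/= addrA.
apply: lerD => //; rewrite /b; case: asboolP => Qk; first by rewrite mulr0 fine_ge0.
by rewrite mulr1 /u patchE ifT// inE; split => //=; rewrite gx lee_fin.
Qed.

(** [Q k] is an inner approximation of the part of [D] where [g <= kap 2^k]. The constant is the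
    [p]-th power of [2 * 2 * 2]: one factor splits off the exceptional sets, one splits [kap] from
    [2 g], and one comes from the factor of [g]. *)
Lemma vitali_caratheodory (g : X -> \bar R) (kap e : R) :
  measurable_fun setT (g : cara -> \bar R) -> (forall x, 0 <= g x) ->
  (0 < kap)%R -> (0 < e)%R ->
  exists Q : nat -> set X, [/\ forall k, closed (Q k), forall k, totally_bounded_set (Q k),
    forall k, Q k `<=` D, forall x, D x -> g x <= density_sup kap Q x &
    power_integral nu p D (density_sup kap Q) <=
      (8 `^ p)%:E * ((kap `^ p)%:E * nu (D : set cara) + power_integral nu p D g) + e%:E].
Proof.
move=> mg g0 kap0 e0.
have c0 k : (0 < kap * 2 ^+ k)%R by rewrite mulr_gt0 ?exprn_gt0.
pose E k : set cara := D `&` [set x | g x <= (kap * 2 ^+ k)%:E].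
have mE k : measurable (E k).
  apply: measurableI => //; rewrite -[X in measurable X]setTI.
  exact: emeasurable_fun_infty_c.
(* [a k] is the weighted height on the [k]-th exceptional set, whose measure has to compensate the
   [p]-th power of [a k]. *)
pose a k : R := (2 ^+ k.+1 * (kap * 2 ^+ k))%R.
have a0 k : (0 < a k)%R by rewrite mulr_gt0// exprn_gt0.
pose e' := (e / 2 `^ p)%R.
have e'0 : (0 < e')%R by rewrite divr_gt0// powR_gt0.
have pe k : (0 < e' / (2 ^ k.+1)%:R / a k `^ p)%R.
  by rewrite !divr_gt0// ?powR_gt0// ltr0n expn_gt0.
have /choice[Q hQ] : forall k, exists Q : set X, [/\ closed Q, totally_bounded_set Q,
    Q `<=` E k & nu (E k `\` Q) < (e' / (2 ^ k.+1)%:R / a k `^ p)%:E].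
  by move=> k; apply: (inner_regular cD Doo sep (mE k) _ (pe k)) => x [].
have cQ k : closed (Q k) by case: (hQ k).
exists Q; split.
- exact: cQ.
- by move=> k; case: (hQ k).
- by move=> k x; have [_ _ h _] := hQ k; move=> /h[].
- move=> x Dx; apply: density_sup_ge => // k Qx.
  by have [_ _ h _] := hQ k; have [] := h x Qx.
pose u k x : \bar R := ((cst (kap * 2 ^+ k)%:E) \_
      ([set x | g x <= (kap * 2 ^+ k)%:E] `\` Q k)) x.
have mQ k : measurable (Q k : set cara) by apply: borel_cara; exact: closed_borel.
have mL k : measurable ([set x | g x <= (kap * 2 ^+ k)%:E] `\` Q k : set cara).
  apply: measurableD => //; rewrite -[X in measurable X]setTI.
  exact: emeasurable_fun_infty_c.
have mu_ k : measurable_fun setT (u k : cara -> \bar R).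
  by apply/measurable_restrict => //; exact: measurable_cst.
have u0 k x : 0 <= u k x by rewrite /u patchE; case: ifP => // _; rewrite lee_fin ltW.
pose v k x := (2 ^+ k.+1)%:E * u k x.
have v0 k x : 0 <= v k x by rewrite mule_ge0// lee_fin exprn_ge0.
have mv k : measurable_fun setT (v k : cara -> \bar R) by exact: measurable_funeM.
have md : measurable_fun setT (density_sup kap Q : cara -> \bar R).
  by apply: borel_cara_fun; exact: (density_sup_borel Q kap0).1.
have mS : measurable_fun setT (esup_fun v : cara -> \bar R) by exact: (@esup_fun_measurable _ cara).
have S0 x : 0 <= esup_fun v x by apply: le_trans (esup_fun_ge v 0 x).
have m1 : measurable_fun setT ((fun x => 2%:E * g x) : cara -> \bar R) by exact: measurable_funeM.
have m2 : measurable_fun setT ((fun x => kap%:E + 2%:E * g x) : cara -> \bar R).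
  by apply: emeasurable_funD.
have kap00 : (0 <= kap)%R := ltW kap0.
apply: (@le_trans _ _ (power_integral nu p D (fun x => (kap%:E + 2%:E * g x) + esup_fun v x))).
  apply: (power_integral_le nu p1 mD md (emeasurable_funD m2 mS)).
  - by move=> x _; exact: (density_sup_borel Q kap0).2.
  - by move=> x _; exact: density_sup_le.
apply: le_trans (power_integralD _ _ _ _ _ _ _) _ => //.
  by move=> x; rewrite adde_ge0// ?lee_fin// mule_ge0.
have h2 : power_integral nu p D (esup_fun v) <= e'%:E.
  apply: le_trans (power_integral_esup _ _ _ _ _) _ => //.
  apply: le_trans (_ : (\sum_(0 <= i <oo) (e' / (2 ^ i.+1)%:R)%:E <= _)); last first.
    by apply: epsilon_trick0; exact: ltW.
  apply: lee_nneseries => [*|k _]; first exact: power_integral_ge0.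
  have -> : power_integral nu p D (v k) = power_integral nu p (D `&`
      ([set x | g x <= (kap * 2 ^+ k)%:E] `\` Q k)) (fun=> (a k)%:E).
    rewrite -power_integral_restrict// /power_integral; apply: eq_integral => x _.
    congr (_ `^ p); rewrite /v /u !patchE; case: ifP => _; last by rewrite mule0.
    by rewrite -EFinM.
  rewrite power_integral_cst; last exact: measurableI.
  rewrite setIDA -/(E k).
  apply: (@le_trans _ _ ((a k `^ p)%:E * (e' / (2 ^ k.+1)%:R / a k `^ p)%:E)).
    by rewrite lee_wpmul2l ?lee_fin ?powR_ge0//; apply/ltW; case: (hQ k).
  by rewrite -EFinM lee_fin mulrC divfK// gt_eqF// powR_gt0.
have h1 : power_integral nu p D (fun x => kap%:E + 2%:E * g x) <=
    (2 `^ p)%:E * ((kap `^ p)%:E * nu (D : set cara) + (2 `^ p)%:E * power_integral nu p D g).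
  apply: le_trans (power_integralD _ _ _ _ _ _ _) _ => //.
  - by move=> x; rewrite mule_ge0.
  - by rewrite power_integral_cst// power_integralZ.
have N0 : 0 <= (kap `^ p)%:E * nu (D : set cara) by rewrite mule_ge0 ?lee_fin ?powR_ge0.
have G0 := power_integral_ge0 nu p D g.
have p2 : (1 <= 2 `^ p :> R)%R.
  by rewrite -[leLHS](powRr0 2); apply: ler_powR; [rewrite ler1n|exact: le_trans p1].
apply: (@le_trans _ _ ((2 `^ p)%:E * ((2 `^ p)%:E * ((kap `^ p)%:E * nu (D : set cara) +
    (2 `^ p)%:E * power_integral nu p D g) + e'%:E))).
  by rewrite lee_wpmul2l ?lee_fin ?powR_ge0//; exact: leeD.
rewrite ge0_muleDr ?mule_ge0 ?adde_ge0 ?mule_ge0 ?lee_fin ?powR_ge0 ?(ltW e'0)//.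
apply: leeD; last by rewrite -EFinM lee_fin /e' mulrC divfK// gt_eqF// powR_gt0.
have -> : (8 `^ p = 2 `^ p * (2 `^ p * 2 `^ p) :> R)%R.
  by rewrite -!powRM//; congr (_ `^ _)%R; ring.
rewrite !EFinM -!muleA !lee_wpmul2l ?lee_fin ?powR_ge0//.
rewrite (ge0_muleDr _ N0 G0); apply: leeD => //.
by rewrite -[leLHS]mul1e lee_wpmul2r// lee_fin.
Qed.

End vitali_caratheodory.

(** * Continuous functions that agree with [f] on [K] *)

Section uniform_series.
Context {R : realType} {X : pmetricType R}.

Lemma geometric_tail n m : \sum_(n <= j < n + m) (2 ^- j.+1 : R) <= 2 ^- n.
Proof.
suff -> : \sum_(n <= j < n + m) (2 ^- j.+1 : R) = 2 ^- n - 2 ^- (n + m).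
  by rewrite gerDl oppr_le0 invr_ge0 exprn_ge0.
elim: m => [|m ih]; first by rewrite addn0 big_geq// subrr.
rewrite addnS big_nat_recr/= ?leq_addr// ih exprS.
by field; rewrite !expf_neq0.
Qed.

Lemma uniform_series (u : nat -> X -> R) :
  (forall j x, `|u j x| <= 2 ^- j.+1) -> (forall j, continuous (u j)) ->
  exists2 h : X -> R, continuous h &
    forall n x, `|h x - \sum_(0 <= j < n) u j x| <= 2 ^- n.
Proof.
move=> ub uc.
have cv x : cvgn (series (u^~ x)).
  apply: normed_cvg; apply: (@series_le_cvg _ _ (fun j => 2 ^- j.+1 : R)).
  - by move=> n /=; exact: normr_ge0.
  - by move=> n; rewrite invr_ge0 exprn_ge0.
  - move=> n; exact: ub.
  - apply: nondecreasing_is_cvgn.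
      by move=> n m nm; apply: nondecreasing_series => // *; rewrite invr_ge0 exprn_ge0.
    exists 1 => _ [n _ <-]; have := geometric_tail 0 n.
    by rewrite add0n expr0 invr1.
pose h x := limn (series (u^~ x)).
have hS n x : `|h x - \sum_(0 <= j < n) u j x| <= 2 ^- n.
  apply/ler_addgt0Pr => e e0.
  have /cvgrPdist_lt/(_ e e0)[N _ hN] := cv x.
  have h1 : `|h x - \sum_(0 <= j < n + N) u j x| < e := hN (n + N)%N (leq_addl _ _).
  have -> : h x - \sum_(0 <= j < n) u j x =
      (h x - \sum_(0 <= j < n + N) u j x) + \sum_(n <= j < n + N) u j x.
    by rewrite (big_cat_nat (leq0n n) (leq_addr N n))/=; ring.
  apply: le_trans (ler_normD _ _) _; rewrite addrC; apply: lerD; last exact: ltW.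
  apply: le_trans (ler_norm_sum _ _ _) _; apply: le_trans (geometric_tail n N).
  by apply: ler_sum => j _; exact: ub.
exists h => // x; apply/cvg_ballP => e e0.
have e30 : 0 < e / 3 by rewrite divr_gt0.
have [n hn] : exists n : nat, (2 ^- n : R) < e / 3.
  exists (Num.bound (e / 3)^-1); rewrite invf_plt ?posrE ?exprn_gt0//.
  apply: lt_trans (archi_boundP _) _; first by rewrite invr_ge0 ltW.
  by rewrite -natrX ltr_nat ltn_expl.
have cS : continuous (fun y => \sum_(0 <= j < n) u j y).
  elim: n {hn} => [|n ih] y.
    under eq_fun do rewrite big_geq//.
    exact: cvg_cst.
  under eq_fun do rewrite big_nat_recr//=.
  by apply: cvgD; [exact: ih|exact: uc].
have /cvg_ballP/(_ _ e30) := cS x; apply: filterS => y.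
rewrite /ball/= => xy; have := hS n x; have := hS n y.
move: xy hn; rewrite !ltr_norml !ler_norml => /andP[? ?] ? /andP[? ?] /andP[? ?].
by apply/andP; split; lra.
Qed.

End uniform_series.

Section exact_extension.
Context {R : realType} {X : pmetricType R}.
Implicit Types (f h : X -> R) (Q : nat -> set X).

Definition continuous_on (K : set X) f := forall x (d : R), K x -> 0 < d ->
  exists2 r : R, 0 < r & forall y, K y -> mdist x y < r -> `|f x - f y| < d.

Lemma densityZ (c kap : R) Q n x : density (c * kap) Q n x = c * density kap Q n x.
Proof.
rewrite /density mulrDr mulr_sumr; congr (_ + _).
by apply: eq_bigr => k _; rewrite !mulrA.
Qed.

Lemma density_supZ (c kap : R) Q x : 0 < c ->
  density_sup (c * kap) Q x = (c%:E * density_sup kap Q x)%E.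
Proof.
move=> c0; apply/eqP; rewrite eq_le; apply/andP; split.
  apply: esup_fun_le => n; rewrite densityZ EFinM lee_wpmul2l ?lee_fin ?(ltW c0)//.
  exact: density_le_sup.
rewrite muleC -lee_pdivlMr//; apply: esup_fun_le => n; rewrite lee_pdivlMr// -EFinM mulrC.
by rewrite -densityZ; exact: density_le_sup.
Qed.

(** The function to minimize equals [f] on [K] and [M] elsewhere, which is lower semicontinuous
    since [K] is closed and [f <= M]. A chain infimum is below it, hence below [f] on [K];
    [chain_approximation] gives the other inequality. *)
Lemma chain_step (kap : R) Q (D D' K : set X) (eta M del : R) f : 0 < kap ->
  complete_set D' -> 0 < eta -> (forall x y, D x -> mdist x y < eta -> D' y) ->
  (forall k, Q k `<=` D) -> (forall k, totally_bounded_set (Q k)) ->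
  K `<=` D -> totally_bounded_set K -> closed K ->
  (forall x, `|f x| <= M) -> continuous_on K f ->
  lip_upper_gradient f (density_sup kap Q) -> 0 < del ->
  exists h, [/\ continuous h, forall x, `|h x| <= M,
    lip_upper_gradient h (density_sup kap Q) & forall x, K x -> `|f x - h x| <= del].
Proof.
move=> kap0 cD' eta0 DD' QD tQ KD tK cK fM fK fG del0.
pose F x := if `[< K x >] then f x else M.
have fF x : f x <= F x.
  by rewrite /F; case: asboolP => // _; rewrite (le_trans (ler_norm _)).
have FM x : F x <= M.
  by rewrite /F; case: asboolP => // _; rewrite (le_trans (ler_norm _)).
have Fm x : - M <= F x.
  by apply: le_trans (fF x); have := fM x; rewrite ler_norml => /andP[].
have Flsc x (e : R) : 0 < e -> exists2 d : R, 0 < d & forall y, mdist x y < d -> F x - e < F y.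
  move=> e0; have [Kx|nKx] := pselect (K x).
    have [r r0 hr] := fK x e Kx e0; exists r => // y xy.
    rewrite /F (asboolT Kx); case: asboolP => Ky.
      by have := hr y Ky xy; rewrite ltr_norml => /andP[_]; lra.
    by rewrite ltrBlDr (le_lt_trans (ler_norm _))// (le_lt_trans (fM x))// ltrDl.
  exists (cdist K x); first exact: cdist_gt0.
  move=> y xy; rewrite /F (asboolF nKx); case: asboolP => Ky; last by rewrite ltrBlDr ltrDl.
  by have := cdist_le x Ky; rewrite leNgt xy.
have [n hn] := chain_approximation kap0 cD' eta0 DD' QD tQ KD tK cK fM fF Flsc fK fG del0.
have r0 : (0 : R) < n.+1%:R^-1 by rewrite invr_gt0 ltr0n.
have A0 := density_ge0 Q kap0 n; have AB := density_le Q kap0 n.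
have Ak := density_lipschitz Q kap0 n.
have k0 : 0 <= \sum_(k < n) kap * 2 ^+ k * n%:R.
  by rewrite sumr_ge0// => i _; rewrite !mulr_ge0// ?exprn_ge0// ltW.
exists (chain_inf (density kap Q n) F n.+1%:R^-1); split.
- exact: (chain_inf_continuous A0 AB r0 Fm).
- move=> x; rewrite ler_norml; apply/andP; split; first exact: chain_inf_ge.
  by apply: le_trans (FM x); exact: (@chain_inf_le _ _ _ _ _ (- M)).
- apply: (lip_upper_gradient_le (density_borel Q kap0 n) (density_sup_borel Q kap0)).
    by move=> x; exact: density_le_sup.
  exact: (chain_inf_upper_gradient A0 AB k0 Ak r0 Fm).
- move=> x Kx; have := hn x Kx.
  have := @chain_inf_le _ _ _ F n.+1%:R^-1 (- M) A0 Fm x; rewrite /F (asboolT Kx) -/F => h1 h2.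
  by rewrite ger0_norm ?subr_ge0//; lra.
Qed.

End exact_extension.

Section exact_extension.
Context {R : realType} {X : pmetricType R}.
Implicit Types (f h : X -> R) (Q : nat -> set X).

Lemma cutoff_lipschitz (K : set X) (r : R) : 0 < r ->
  let psi x := Num.max 0 (1 - cdist K x / r) in
  [/\ forall x y, `|psi x - psi y| <= r^-1 * mdist x y, forall x, 0 <= psi x <= 1,
    forall x, K x -> psi x = 1 & forall x, r <= cdist K x -> psi x = 0].
Proof.
move=> r0 psi; split.
- move=> x y; apply: le_trans (dist_max_le _ _ _) _.
  have -> : 1 - cdist K x / r - (1 - cdist K y / r) = - (r^-1 * (cdist K x - cdist K y)) by ring.
  rewrite normrN normrM ger0_norm ?invr_ge0 ?(ltW r0)//.
  by rewrite ler_wpM2l ?invr_ge0 ?(ltW r0)// cdist_lipschitz_norm.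
- move=> x; rewrite /psi le_max lexx ge_max ler01/= gerBl.
  by rewrite divr_ge0 ?cdist_ge0// ltW.
- by move=> x Kx; rewrite /psi cdist_eq0// mul0r subr0 max_r.
- by move=> x rx; rewrite /psi max_l// subr_le0 ler_pdivlMr// mul1r.
Qed.

(** Each correction step doubles the density, since [g - h] inherits the gradients of both terms.
    The doubling is harmless because the correction of step [j + 1] is multiplied by a cutoff living
    within distance [rho j] of [K]: its gradient counts only on a set that can be made as small as
    desired. The radii are left free for this reason. *)
Lemma exact_extension (kap : R) Q (D D' K : set X) (eta M : R) f (rho : nat -> R) : 0 < kap ->
  complete_set D' -> 0 < eta -> (forall x y, D x -> mdist x y < eta -> D' y) ->
  (forall k, Q k `<=` D) -> (forall k, totally_bounded_set (Q k)) ->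
  K `<=` D -> totally_bounded_set K -> closed K -> 0 < M ->
  (forall x, `|f x| <= M) -> continuous_on K f ->
  lip_upper_gradient f (density_sup kap Q) -> (forall j, 0 < rho j) ->
  exists h, [/\ continuous h, forall x, `|f x - h x| <= 2 * M + 1, forall x, K x -> f x = h x &
    lip_upper_gradient (fun x => f x - h x)
      (esup_fun (fun j x => (2 ^+ j.+1)%:E * ((2 ^+ j.+1)%:E *
        (((fun x => density_sup kap Q x + 1) \_
          (if j is i.+1 then [set x | (cdist K x < rho i)%R] else setT)) x)))%E)].
Proof.
move=> kap0 cD' eta0 DD' QD tQ KD tK cK M0 fM fK fG rho0.
(* The bound by [rho i] makes [delta / rho], the gradient due to the cutoff, at most 1; the bound by
   [2 ^- i.+1] makes the series converge uniformly. *)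
pose delta j : R := if j is i.+1 then Num.min (rho i) (2 ^- i.+1) else M.
have del0 j : 0 < delta j.
  by case: j => [//|j]; rewrite /delta lt_min rho0 invr_gt0 exprn_gt0.
have p0 j : 0 < 2 ^+ j :> R by rewrite exprn_gt0.
pose P j g := [/\ forall x, `|g x| <= delta j, continuous_on K g &
  lip_upper_gradient g (density_sup (2 ^+ j * kap) Q)].
have /choice[N hN] : forall jg : nat * (X -> R), exists hg : (X -> R) * (X -> R),
    P jg.1 jg.2 -> [/\ continuous hg.1, forall x, `|hg.1 x| <= delta jg.1,
      lip_upper_gradient hg.1 (density_sup (2 ^+ jg.1 * kap) Q),
      forall x, K x -> hg.2 x = jg.2 x - hg.1 x & P jg.1.+1 hg.2].
  move=> [j g]; have [|nP] := pselect (P j g); last by exists (g, g).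
  move=> [gd gK gG].
  have jk0 : 0 < 2 ^+ j * kap by rewrite mulr_gt0.
  have [h [ch hd hG hK]] := chain_step jk0 cD' eta0 DD' QD tQ KD tK cK gd gK gG (del0 j.+1).
  (* [g - h] is known to be small on [K] only; clamping makes it small everywhere and does not
     change it on [K]. *)
  pose g' x := clamp (- delta j.+1) (delta j.+1) (g x - h x).
  have g'K x : K x -> g' x = g x - h x.
    by move=> Kx; rewrite /g' clamp_id// -ler_norml; exact: hK.
  exists (h, g') => _; split => //=; split.
  - move=> x; rewrite ler_norml; apply: clamp_itv.
    by have := ltW (del0 j.+1); lra.
  - move=> x d Kx d0; have d20 : 0 < d / 2 by rewrite divr_gt0.
    have [r1 r10 h1] := gK x _ Kx d20.
    have /cvg_ballP/(_ _ d20)/nbhs_ballP[r2 /= r20 h2] := ch x.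
    exists (Num.min r1 r2); first by rewrite lt_min r10.
    move=> y Ky; rewrite lt_min => /andP[/(h1 y Ky) xy1 xy2].
    have {}h2 : `|h x - h y| < d / 2 by apply: h2; rewrite ballEmdist.
    rewrite !g'K//.
    have -> : g x - h x - (g y - h y) = (g x - g y) - (h x - h y) by ring.
    by apply: le_lt_trans (ler_normB _ _) _; rewrite [d]splitr ltrD.
  - apply: (@lip_upper_gradient_contraction _ _ (fun x => g x - h x)).
      by move=> x y; exact: clamp_lipschitz.
    have bj := density_sup_borel Q jk0.
    have kj0 : 0 < 2 ^+ j.+1 * kap by rewrite mulr_gt0.
    have := @lip_upper_gradientD _ _ (fun x => g x - h x) g h _ _ bj bj _ gG hG.
    have e1 x : (density_sup (2 ^+ j * kap) Q x + density_sup (2 ^+ j * kap) Q x =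
        density_sup (2 ^+ j.+1 * kap) Q x)%E.
      by rewrite exprS -mulrA [in RHS]density_supZ// mule_natl.
    rewrite (funext e1); apply => x y.
    have -> : g x - h x - (g y - h y) = (g x - g y) - (h x - h y) by ring.
    exact: ler_normB.
pose fs := fix fs j := if j is i.+1 then (N (i, fs i)).2 else f.
pose hs j := (N (j, fs j)).1.
have Pfs j : P j (fs j).
  elim: j => [|j ih]; last by have [] := hN (j, fs j) ih.
  by split => //; rewrite expr0 mul1r.
have hsP j : [/\ continuous (hs j), forall x, `|hs j x| <= delta j,
    lip_upper_gradient (hs j) (density_sup (2 ^+ j * kap) Q) &
    forall x, K x -> fs j.+1 x = fs j x - hs j x].
  by have [] := hN (j, fs j) (Pfs j).
pose psi j x := Num.max 0 (1 - cdist K x / rho j).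
have psiP j := cutoff_lipschitz K (rho0 j).
pose u j x := psi j x * hs j.+1 x.
have ub j x : `|u j x| <= 2 ^- j.+1.
  have [_ /(_ x)/andP[s0 s1] _ _] := psiP j; have [_ /(_ x) hd _ _] := hsP j.+1.
  rewrite normrM ger0_norm//; apply: (@le_trans _ _ (delta j.+1)).
    by rewrite -[leRHS]mul1r ler_pM.
  by rewrite /delta ge_min lexx orbT.
have uc j : continuous (u j).
  move=> x; have [ch _ _ _] := hsP j.+1; have [sl _ _ _] := psiP j.
  by apply: cvgM; [exact: (lipschitz_continuous sl)|exact: ch].
have [h' ch' hh'] := uniform_series ub uc.
have [ch0 hd0 hG0 hK0] := hsP 0%N.
exists (fun x => hs 0%N x + h' x); split.
- by move=> x; apply: cvgD; [exact: ch0|exact: ch'].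
- move=> x; have := hh' 0%N x; rewrite big_geq// subr0 expr0 invr1 => h1.
  rewrite opprD addrA; apply: le_trans (ler_normB _ _) _; apply: lerD => //.
  apply: le_trans (ler_normB _ _) _; rewrite mulr2n mulrDl mul1r; exact: lerD.
- move=> x Kx; apply/eqP; rewrite -subr_eq0 -normr_eq0 eq_le normr_ge0 andbT.
  apply/ler_addgt0Pl => e e0; rewrite addr0.
  have e20 : 0 < e / 2 by rewrite divr_gt0.
  have [n hn] : exists n : nat, (2 ^- n : R) < e / 2.
    exists (Num.bound (e / 2)^-1); rewrite invf_plt ?posrE//.
    apply: lt_trans (archi_boundP _) _; first by rewrite invr_ge0 ltW.
    by rewrite -natrX ltr_nat ltn_expl.
  have tel m : f x = \sum_(0 <= j < m) hs j x + fs m x.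
    elim: m => [|m ih]; first by rewrite big_geq// add0r.
    rewrite big_nat_recr//= {1}ih; have [_ _ _ /(_ x Kx)] := hsP m.
    by rewrite /= => ->; ring.
  have -> : f x - (hs 0%N x + h' x) =
      fs n.+1 x - (h' x - \sum_(0 <= j < n) u j x).
    rewrite (tel n.+1) big_nat_recl//=.
    have -> : \sum_(0 <= i < n) hs i.+1 x = \sum_(0 <= j < n) u j x.
      apply: eq_bigr => j _; have [_ _ /(_ x Kx) e1 _] := psiP j.
      by rewrite /u (_ : psi j x = 1)// mul1r.
    by ring.
  apply: le_trans (ler_normB _ _) _; rewrite [e]splitr; apply: lerD.
    have [/(_ x) h1 _ _] := Pfs n.+1; apply: le_trans h1 _.
    rewrite /delta ge_min; apply/orP; right; apply: le_trans (ltW hn).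
    by rewrite lef_pV2 ?posrE// exprS ler_peMl ?ler1n// ltW.
  by apply: le_trans (hh' n x) _; exact: ltW.
have bd := density_sup_borel Q kap0.
have bd1 : borel_nonneg (fun x => density_sup kap Q x + 1)%E.
  by apply: borel_nonnegD => //; exact: (borel_nonneg_cst ler01).
pose U j := if j is i.+1 then [set x | cdist K x < rho i] else setT.
have oU j : open (U j).
  case: j => [|j]; first exact: openT.
  apply: (@open_comp _ _ (cdist K) [set y | y < rho j]); last exact: open_lt.
  by move=> x _; exact: cdist_continuous.
(* The zeroth piece is not cut off, so its gradient counts on the whole space; the other pieces are
   the terms of the series. *)
pose w j x := if j is i.+1 then u i x else f x - hs 0%N x.
have bG j : borel_nonneg (fun x => (2 ^+ j.+1)%:E *
    (((fun x => density_sup kap Q x + 1) \_ (U j)) x))%E.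
  apply: borel_nonnegZ; first exact/ltW.
  by apply: borel_nonneg_restrict => //; exact: open_borel.
apply: (@lip_upper_gradient_series _ _ _ w) => //.
- case=> [|j].
    apply: (@lip_upper_gradient_le _ _ _ (fun x => density_sup kap Q x + density_sup kap Q x)%E) => //.
    + exact: borel_nonnegD.
    + move=> x; rewrite patchE ifT ?inE// expr1.
      have -> : (density_sup kap Q x + density_sup kap Q x = 2%:E * density_sup kap Q x)%E.
        by rewrite mule_natl.
      by rewrite lee_wpmul2l ?lee_fin// leeDl.
    + rewrite expr0 mul1r in hG0.
      apply: (@lip_upper_gradientD _ _ _ f (hs 0%N)) => // x y.
      have -> : w 0%N x - w 0%N y = (f x - f y) - (hs 0%N x - hs 0%N y) by rewrite /w; ring.
      exact: ler_normB.
  have [_ hd hG _] := hsP j.+1; have [sl s01 _ s0] := psiP j.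
  have jk0 : 0 < 2 ^+ j.+1 * kap by rewrite mulr_gt0.
  have bj := density_sup_borel Q jk0.
  have ri0 : 0 <= (rho j)^-1 by rewrite invr_ge0 ltW.
  have s1 x : `|psi j x| <= 1 by have /andP[? ?] := s01 x; rewrite ger0_norm.
  have uG := lip_upper_gradient_cutoff bj ri0 (ltW (del0 j.+1)) s1 sl hd hG.
  have bu : borel_nonneg (fun x => density_sup (2 ^+ j.+1 * kap) Q x + (delta j.+1 * (rho j)^-1)%:E)%E.
    apply: borel_nonnegD => //; apply: (borel_nonneg_cst (mulr_ge0 (ltW (del0 _)) ri0)).
  have vanish x : ~ U j.+1 x -> u j x = 0.
    by move=> /= /negP; rewrite -leNgt => h; rewrite /u (_ : psi j x = 0) ?mul0r//; exact: s0.
  have := lip_upper_gradient_open bu (oU j.+1) vanish uG.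
  apply: lip_upper_gradient_le => //.
    by apply: borel_nonneg_restrict => //; exact: open_borel.
  move=> x; rewrite !patchE; case: ifP => _; last by rewrite mule0.
  rewrite density_supZ// ge0_muleDr ?lee_fin//; last exact: bd.2.
  have dr : delta j.+1 * (rho j)^-1 <= 1.
    by rewrite ler_pdivrMr// mul1r /delta ge_min lexx.
  apply: leeD.
    rewrite lee_wpmul2r ?lee_fin//; first exact: bd.2.
    by rewrite ler_eXn2l ?ltr1n.
  by rewrite mule1 lee_fin (le_trans dr)// exprn_ege1// ler1n.
move=> x y e e0; have e20 : 0 < e / 2 by rewrite divr_gt0.
have [n hn] : exists n : nat, (2 ^- n : R) < e / 2.
  exists (Num.bound (e / 2)^-1); rewrite invf_plt ?posrE//.
  apply: lt_trans (archi_boundP _) _; first by rewrite invr_ge0 ltW.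
  by rewrite -natrX ltr_nat ltn_expl.
exists n.+1; rewrite big_ord_recl/=.
have -> : f x - (hs 0%N x + h' x) - (f y - (hs 0%N y + h' y)) =
    (f x - hs 0%N x - (f y - hs 0%N y)) -
    ((h' x - \sum_(0 <= j < n) u j x) - (h' y - \sum_(0 <= j < n) u j y)) -
    (\sum_(0 <= j < n) u j x - \sum_(0 <= j < n) u j y) by ring.
apply: le_trans (ler_normB _ _) _; rewrite [leRHS]addrAC.
apply: lerD; last first.
  rewrite -sumrB big_mkord; apply: le_trans (ler_norm_sum _ _ _) _; exact: ler_sum.
apply: le_trans (ler_normB _ _) _; rewrite lerD2l.
apply: le_trans (ler_normB _ _) _; rewrite [e]splitr.
by apply: lerD; apply: le_trans (hh' _ _) _; exact: ltW.
Qed.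

End exact_extension.

Lemma measurable_norm_EFin {R : realType} d (T : measurableType d) (D : set T) (u : T -> R) :
  measurable_fun D u -> measurable_fun D (fun x => `|u x|%:E).
Proof. by move=> mu; apply/measurable_EFinP; exact: measurableT_comp. Qed.

(** * Continuous approximation on a ball *)

Section local_approximation.
Context {R : realType} {X : pmetricType R}.
Variables (mu : {measure set (borel X) -> \bar R}) (p : R) (D D' B : set X) (eta k : R)
  (phi : X -> R).
Local Notation cara := (caratheodory_type (mu^*)%mu).
Local Notation nu := (@completed_measure_extension _ _ _ mu).
Local Open Scope ereal_scope.
Hypotheses (p1 : (1 <= p)%R) (sep : separable X)
  (cD : closed D) (Doo : mu (D : set (borel X)) < +oo)
  (cD' : complete_set D') (eta0 : (0 < eta)%R)
  (DD' : forall x y, D x -> (mdist x y < eta)%R -> D' y)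
  (oB : open B) (BD : B `<=` D).

Let mD : measurable (D : set cara) := borel_cara mu (closed_borel cD).
Let mB : measurable (B : set cara) := borel_cara mu (open_borel oB).

Lemma cara_measurableD (S T : set X) : measurable (S : set cara) -> measurable (T : set cara) ->
  measurable (S `\` T : set cara).
Proof. exact: measurableD. Qed.

Lemma cara_measurable_restrict (A : set X) (u : X -> \bar R) : measurable (A : set cara) ->
  measurable_fun setT (u : cara -> \bar R) -> measurable_fun setT (u \_ A : cara -> \bar R).
Proof.
move=> mA mu'; apply/(measurable_restrictT _ mA); exact: measurable_funTS.
Qed.

Section approximation.
Hypotheses (k0 : (0 <= k)%R) (phi1 : forall x, (`|phi x| <= 1)%R)
  (phik : forall x y, (`|phi x - phi y| <= k * mdist x y)%R)
  (phiB : forall x, ~ B x -> phi x = 0%R).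

(** The order of the choices matters. The density dominating [g] comes before [K], whose complement
    [S] in [D] must be small for the absolute continuity of the [p]-th power of this density; the
    radii [rho j] depend on [K] and come last. As [h = f] on [K] and [phi = 0] off [B], the product
    lives on the open set [B \ K]. *)
Lemma local_approximation (f : X -> R) (g : X -> \bar R) (M e : R) :
  (0 < M)%R -> (forall x, `|f x| <= M)%R -> measurable_fun setT (f : cara -> R) ->
  borel_nonneg g -> lip_upper_gradient f g -> power_integral nu p D g < +oo -> (0 < e)%R ->
  exists h G, [/\ continuous (h : X -> R), borel_nonneg G,
    lip_upper_gradient (fun x => phi x * (f x - h x))%R G,
    forall x, (`|phi x * (f x - h x)| <= 2 * M + 1)%R &
    power_integral nu p setT (fun x => `|phi x * (f x - h x)|%:E) +
      power_integral nu p setT G <= e%:E].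
Proof.
move=> M0 fM mf bg fg goo e0.
have p0 : (0 < p)%R := lt_le_trans ltr01 p1.
pose M' : R := (2 * M + 1)%R.
have M'0 : (0 < M')%R by rewrite /M'; lra.
have e3 : (e / 3 + (e / 3 + e / 3) = e)%R by lra.
have [Q [cQ tQ QD gQ dQ]] := vitali_caratheodory p1 cD Doo sep
  (borel_cara_fun bg.1) bg.2 ltr01 ltr01.
set dens := density_sup 1 Q in gQ dQ.
have bd : borel_nonneg dens := density_sup_borel Q ltr01.
have gd x : g x <= dens x.
  have [Dx|nDx] := pselect (D x); first exact: gQ.
  apply: density_sup_ge => //; first exact: bg.2.
  by move=> j /QD.
have fG : lip_upper_gradient f dens := lip_upper_gradient_le bg bd gd fg.
pose d1 x : \bar R := dens x + 1.
have bd1 : borel_nonneg d1 by apply: borel_nonnegD => //; exact: (borel_nonneg_cst ler01).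
have md1 : measurable_fun setT (d1 : cara -> \bar R) := borel_cara_fun bd1.1.
have nuDoo : nu (D : set cara) < +oo by exact: nuD.
have d1oo : power_integral nu p D d1 < +oo.
  apply: le_lt_trans (power_integralD nu p1 mD (borel_cara_fun bd.1) _ bd.2 _) _ => //.
  rewrite lte_mul_pinfty ?lee_fin ?powR_ge0// lte_add_pinfty//.
    apply: le_lt_trans dQ _; rewrite lte_add_pinfty ?ltry//.
    rewrite lte_mul_pinfty ?lee_fin ?powR_ge0// lte_add_pinfty//.
    by rewrite lte_mul_pinfty ?lee_fin ?powR_ge0.
  by rewrite power_integral_cst// lte_mul_pinfty ?lee_fin ?powR_ge0.
have mp : measurable_fun setT ((fun x => d1 x `^ p) : cara -> \bar R) := poweR_measurable p md1.
have abscont := integral_absolutely_continuous mD mp (fun x => poweR_ge0 (d1 x) p) d1oo.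
pose e1 : R := (e / 3 / 2 `^ p)%R.
have e10 : (0 < e1)%R by rewrite !divr_gt0// powR_gt0.
(* The weight is the [p]-th power of the factor of the [j]-th density in [exact_extension]. *)
have c0 j : (0 < (2 ^+ j.+1 * 2 ^+ j.+1) `^ p :> R)%R by rewrite powR_gt0// mulr_gt0// exprn_gt0.
have pe j : (0 < e1 / (2 ^ j.+1)%:R / (2 ^+ j.+1 * 2 ^+ j.+1) `^ p)%R.
  by rewrite !divr_gt0// ltr0n expn_gt0.
have /choice[dl hdl] : forall j : nat, exists d : R, (0 < d)%R /\
    forall E : set cara, measurable E -> E `<=` D -> nu E < d%:E ->
    power_integral nu p E d1 < (e1 / (2 ^ j.+1)%:R / (2 ^+ j.+1 * 2 ^+ j.+1) `^ p)%:E.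
  by move=> j; have [d d0 hd] := abscont _ (pe j); exists d.
(* The three bounds on the measure of [S] serve the zeroth density, the function [phi * (f - h)]
   itself, which is at most [M'], and the gradient [M' * k] due to [phi]. *)
pose s : R := (Num.min (dl 0%N / 2) (Num.min (e / 3 / M' `^ p) (e / 3 / (2 `^ p * ((M' * k) `^ p + 1)))))%R.
have s0 : (0 < s)%R.
  have [dl0 _] := hdl 0%N.
  have b0 : (0 < (M' * k) `^ p + 1)%R by rewrite ltr_wpDl ?powR_ge0.
  by rewrite !lt_min !divr_gt0// ?mulr_gt0// ?powR_gt0.
have [K [cK tK KD hK fK]] := lusin cD Doo sep mf s0.
have mK : measurable (K : set cara) by apply: borel_cara; exact: closed_borel.
pose S : set cara := D `\` K.
have mS : measurable S by exact: measurableD.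
have SD : S `<=` D by move=> x [].
(* Since [K] is closed, the points of [S] closer to [K] than [r] form sets that decrease to the
   empty set as [r] tends to 0. *)
have /choice[rho hrho] : forall j, exists r : R, (0 < r)%R /\
    nu (S `&` [set x | (cdist K x < r)%R] : set cara) < (dl j.+1)%:E.
  move=> j; have dj0 : (0 < dl j.+1)%R by case: (hdl j.+1).
  pose F n : set X := (D `\` K) `&` [set x | (cdist K x < n.+1%:R^-1)%R].
  have oF n : open [set x : X | (cdist K x < n.+1%:R^-1)%R].
    apply: (@open_comp _ _ (cdist K) [set y | (y < n.+1%:R^-1)%R]); last exact: open_lt.
    by move=> x _; exact: cdist_continuous.
  have mF n : measurable (F n : set (borel X)).
    apply: measurableI; last exact: open_borel.
    by apply: measurableD; exact: closed_borel.
  have [|||n hn] := nonincreasing_small cD Doo mF _ _ _ dj0.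
  - by move=> x [[]].
  - move=> n m nm x [Sx /= h]; split => //=; apply: lt_le_trans h _.
    by rewrite lef_pV2 ?posrE// ler_nat ltnS.
  - move=> x; have [Kx|nKx] := pselect (K x); first by exists 0%N => -[[]].
    have /ltr_add_invr[n] := cdist_gt0 cK nKx; rewrite add0r => hn.
    by exists n => -[_ /=]; rewrite ltNge (ltW hn).
  exists (n.+1%:R^-1)%R; split; first by rewrite invr_gt0 ltr0n.
  by rewrite (completed_borelE mu (mF n)).
have rho0 j : (0 < rho j)%R by case: (hrho j).
have [h [ch hM hKf hG]] := exact_extension ltr01 cD' eta0 DD' QD tQ KD tK cK M0 fM fK fG rho0.
pose U j : set X := if j is i.+1 then [set x | (cdist K x < rho i)%R] else setT.
have oU j : open (U j).
  case: j => [|j]; first exact: openT.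
  apply: (@open_comp _ _ (cdist K) [set y | (y < rho j)%R]); last exact: open_lt.
  by move=> x _; exact: cdist_continuous.
have mU j : measurable (U j : set cara) by apply: borel_cara; exact: open_borel.
pose T j x : \bar R := (2 ^+ j.+1)%:E * ((2 ^+ j.+1)%:E * (d1 \_ (U j)) x).
have bT j : borel_nonneg (T j).
  have bU : borel_nonneg (d1 \_ (U j)).
    by apply: borel_nonneg_restrict => //; exact: open_borel.
  by apply: borel_nonnegZ; rewrite ?exprn_ge0//; apply: borel_nonnegZ; rewrite ?exprn_ge0.
have bsup := borel_nonneg_esup bT.
have mT j : measurable_fun setT (T j : cara -> \bar R) := borel_cara_fun (bT j).1.
have oBK : open (B `\` K) by rewrite setDE; apply: openI => //; exact: closed_openC.
have Mk : (0 <= M' * k)%R by rewrite mulr_ge0// ltW.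
have bG0 : borel_nonneg (fun x => esup_fun T x + (M' * k)%:E).
  by apply: borel_nonnegD => //; exact: borel_nonneg_cst.
pose G := (fun x => esup_fun T x + (M' * k)%:E) \_ (B `\` K).
have w0 x : ~ (B `\` K) x -> (phi x * (f x - h x) = 0)%R.
  move=> nBK; have [Bx|nBx] := pselect (B x); last by rewrite phiB// mul0r.
  have Kx : K x by apply: contrapT => nK; apply: nBK.
  by rewrite hKf// subrr mulr0.
have wM x : (`|phi x * (f x - h x)| <= 2 * M + 1)%R.
  by rewrite normrM -[leRHS]mul1r ler_pM.
have mBK : measurable (B `\` K : set cara) by exact: cara_measurableD.
have BKS : B `\` K `<=` S by move=> x [/BD Dx nK].
exists h, G; split => //.
- by apply: borel_nonneg_restrict => //; exact: open_borel.
- apply: lip_upper_gradient_open => //.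
  exact: (lip_upper_gradient_cutoff bsup k0 (ltW M'0) phi1 phik hM hG).
have nuS : nu S <= s%:E := hK.
have hS0 : nu S < (dl 0%N)%:E.
  apply: le_lt_trans nuS _; rewrite lte_fin /s gt_min ltr_pdivrMr// ltr_pMr ?ltr1n//.
  by case: (hdl 0%N).
have TE j : power_integral nu p S (T j) <= (e1 / (2 ^ j.+1)%:R)%:E.
  have -> : power_integral nu p S (T j) =
      ((2 ^+ j.+1 * 2 ^+ j.+1) `^ p)%:E * power_integral nu p (S `&` U j) d1.
    have mr : measurable_fun setT (d1 \_ (U j) : cara -> \bar R) by exact: cara_measurable_restrict.
    have r0 x : 0 <= (d1 \_ (U j)) x by rewrite patchE; case: ifP => // _; exact: bd1.2.
    have k2 : (0 <= 2 ^+ j.+1 * 2 ^+ j.+1 :> R)%R by rewrite mulr_ge0 ?exprn_ge0.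
    rewrite -(power_integral_restrict nu p1 S) -[RHS](power_integralZ nu p mS mr (fun x _ => r0 x) k2).
    by apply: eq_integral => x _; rewrite /T muleA -EFinM.
  have h0 : power_integral nu p (S `&` U j) d1 <
      (e1 / (2 ^ j.+1)%:R / (2 ^+ j.+1 * 2 ^+ j.+1) `^ p)%:E.
    have [_ hj] := hdl j; apply: hj.
    - exact: measurableI.
    - by move=> x [[]].
    - case: j => [|j]; first by rewrite setIT.
      by case: (hrho j).
  apply: (@le_trans _ _ (((2 ^+ j.+1 * 2 ^+ j.+1) `^ p)%:E *
      (e1 / (2 ^ j.+1)%:R / (2 ^+ j.+1 * 2 ^+ j.+1) `^ p)%:E)).
    by rewrite lee_wpmul2l ?lee_fin ?powR_ge0//; exact: ltW.
  by rewrite -EFinM lee_fin mulrC divfK// gt_eqF.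
have supE : power_integral nu p S (esup_fun T) <= e1%:E.
  apply: le_trans (power_integral_esup nu p1 mS mT (fun j => (bT j).2)) _.
  apply: le_trans (_ : (\sum_(0 <= i <oo) (e1 / (2 ^ i.+1)%:R)%:E <= _)); last first.
    by apply: epsilon_trick0; exact: ltW.
  by apply: lee_nneseries => [*|j _]; [exact: power_integral_ge0|exact: TE].
have GE : power_integral nu p setT G <= (e / 3 + e / 3)%:E.
  rewrite /G power_integral_restrict// setTI.
  have mG0 : measurable_fun setT ((fun x => esup_fun T x + (M' * k)%:E) : cara -> \bar R).
    exact: borel_cara_fun bG0.1.
  apply: le_trans (power_integral_subset nu p mS mBK BKS mG0) _.
  apply: le_trans (power_integralD nu p1 mS (borel_cara_fun bsup.1) _ bsup.2 _) _ => //.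
  rewrite ge0_muleDr ?power_integral_ge0// EFinD; apply: leeD.
    apply: (@le_trans _ _ ((2 `^ p)%:E * e1%:E)).
      by rewrite lee_wpmul2l ?lee_fin ?powR_ge0.
    by rewrite -EFinM lee_fin /e1 mulrC divfK// gt_eqF// powR_gt0.
  rewrite power_integral_cst// muleA -EFinM.
  apply: (@le_trans _ _ ((2 `^ p * (M' * k) `^ p)%:E * (e / 3 / (2 `^ p * ((M' * k) `^ p + 1)))%:E)).
    rewrite lee_wpmul2l ?lee_fin ?mulr_ge0 ?powR_ge0//; apply: le_trans nuS _.
    by rewrite lee_fin /s !ge_min lexx !orbT.
  rewrite -EFinM lee_fin; set a := (2 `^ p)%R; set b := ((M' * k) `^ p)%R.
  have a0 : (0 < a)%R by rewrite powR_gt0.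
  have b0 : (0 <= b)%R by rewrite powR_ge0.
  have b1 : (0 < b + 1)%R by rewrite ltr_wpDl.
  have -> : (a * b * (e / 3 / (a * (b + 1))) = e / 3 * (b / (b + 1)))%R.
    by field; rewrite !gt_eqF.
  by rewrite ler_piMr ?divr_ge0 ?(ltW e0)// ler_pdivrMr// mul1r lerDl.
have wE : power_integral nu p setT (fun x => `|phi x * (f x - h x)|%:E) <= (e / 3)%:E.
  have mh : measurable_fun setT (h : cara -> R) by apply: borel_cara_fun; exact: continuous_borel.
  have mphi : measurable_fun setT (phi : cara -> R).
    by apply: borel_cara_fun; apply: continuous_borel; exact: lipschitz_continuous phik.
  have mw : measurable_fun setT ((fun x => `|phi x * (f x - h x)|%:E) : cara -> \bar R).
    exact: (measurable_norm_EFin (measurable_funM mphi (measurable_funB mf mh))).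
  have mc : measurable_fun setT ((fun=> M'%:E) \_ (B `\` K) : cara -> \bar R).
    by apply: cara_measurable_restrict => //; exact: measurable_cst.
  have cM x : `|phi x * (f x - h x)|%:E <= ((fun=> M'%:E) \_ (B `\` K)) x.
    rewrite patchE; case: ifPn => [_|]; first by rewrite lee_fin; exact: wM.
    by rewrite notin_setE => /w0 ->; rewrite normr0.
  have wge0 x : 0 <= `|phi x * (f x - h x)|%:E by rewrite lee_fin.
  have wc := power_integral_le nu p1 measurableT mw mc (fun x _ => wge0 x) (fun x _ => cM x).
  apply: le_trans wc _.
  rewrite power_integral_restrict// setTI.
  apply: le_trans (power_integral_subset nu p mS mBK BKS (@measurable_cst _ _ cara _ setT M'%:E)) _.
  rewrite power_integral_cst//.
  apply: (@le_trans _ _ ((M' `^ p)%:E * (e / 3 / M' `^ p)%:E)).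
    apply: lee_wpmul2l; [by rewrite lee_fin powR_ge0|apply: le_trans nuS _].
    by rewrite lee_fin /s !ge_min lexx orbT.
  by rewrite -EFinM lee_fin mulrC divfK// gt_eqF// powR_gt0.
by apply: le_trans (leeD wE GE) _; rewrite -EFinD e3.
Qed.

End approximation.

End local_approximation.

(** * Lower semicontinuous majorants on a ball *)

Lemma lsc_borel {R : realType} {X : pmetricType R} (v : X -> R) :
  (forall c, open [set x | c < v x]) -> measurable_fun setT (v : borel X -> R).
Proof.
move=> ov; apply: (measurability _ (RGenOInfty.measurableE R)).
move=> _ [_ [a ->] <-]; rewrite setTI; apply: open_borel.
have -> : v @^-1` `]a, +oo[%classic = [set x | a < v x]; last exact: ov.
by apply/seteqP; split => x /=; rewrite in_itv/= andbT.
Qed.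

Section local_majorant.
Context {R : realType} {X : pmetricType R}.
Variables (mu : {measure set (borel X) -> \bar R}) (p : R) (D D' B : set X) (eta : R).
Local Notation cara := (caratheodory_type (mu^*)%mu).
Local Notation nu := (@completed_measure_extension _ _ _ mu).
Local Open Scope ereal_scope.
Hypotheses (p1 : (1 <= p)%R) (sep : separable X)
  (cD : closed D) (Doo : mu (D : set (borel X)) < +oo)
  (cD' : complete_set D') (eta0 : (0 < eta)%R)
  (DD' : forall x y, D x -> (mdist x y < eta)%R -> D' y)
  (oB : open B) (BD : B `<=` D).

(** The term with [nu D] in [vitali_caratheodory] is due to the floor [kap]. For [kap <= 1] its
    [p]-th power is at most [kap], so a small [kap] moves this term into [e]. *)
Lemma vitali_caratheodory_small (g : X -> \bar R) (e : R) :
  measurable_fun setT (g : cara -> \bar R) -> (forall x, 0 <= g x) -> (0 < e)%R ->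
  exists kap (Q : nat -> set X), [/\ (0 < kap)%R,
    (forall k, closed (Q k)) /\ (forall k, totally_bounded_set (Q k)),
    forall k, Q k `<=` D, forall x, D x -> g x <= density_sup kap Q x &
    power_integral nu p D (density_sup kap Q) <=
      (8 `^ p)%:E * power_integral nu p D g + e%:E].
Proof.
move=> mg g0 e0.
have nuDoo : nu (D : set cara) < +oo by exact: nuD.
have nuf : nu (D : set cara) \is a fin_num by rewrite ge0_fin_numE.
set m := fine (nu (D : set cara)).
have nuE : nu (D : set cara) = m%:E by rewrite fineK.
have m0 : (0 <= m)%R by rewrite fine_ge0.
set c := (8 `^ p)%R : R.
have c0 : (0 < c)%R by rewrite powR_gt0.
pose kap : R := Num.min 1%R (e / 2 / c / (m + 1))%R.
have b0 : (0 < e / 2 / c / (m + 1))%R by rewrite !divr_gt0// ltr_wpDl.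
have k0 : (0 < kap)%R by rewrite lt_min ltr01.
have k1 : (kap <= 1)%R by rewrite ge_min lexx.
have kp : (kap `^ p <= kap)%R.
  rewrite -[leRHS]powRr1 ?(ltW k0)//; apply: ger_powR => //.
  by rewrite k0.
have e20 : (0 < e / 2)%R by rewrite divr_gt0.
have [Q [cQ tQ QD gQ dQ]] := vitali_caratheodory p1 cD Doo sep mg g0 k0 e20.
exists kap, Q; split => //.
apply: le_trans dQ _; rewrite ge0_muleDr ?mule_ge0 ?lee_fin ?powR_ge0 ?power_integral_ge0//.
rewrite nuE addeAC addeC; apply: leeD => //.
rewrite -!EFinM -EFinD lee_fin -/c.
have h : (c * (kap `^ p * m) <= e / 2)%R.
  apply: (@le_trans _ _ (c * ((e / 2 / c / (m + 1)) * m))%R).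
    rewrite ler_pM2l// ler_wpM2r//; apply: le_trans kp _; by rewrite ge_min lexx orbT.
  have m1 : (0 < m + 1)%R by rewrite ltr_wpDl.
  have -> : (c * (e / 2 / c / (m + 1) * m) = e / 2 * (m / (m + 1)))%R.
    by field; rewrite !gt_eqF.
  by rewrite ler_piMr ?(ltW e20)// ler_pdivrMr// mul1r lerDl.
lra.
Qed.

(** [F] is the minimum of [M] and a density dominating [|w|] on [B], and 0 off [B]; it is lower
    semicontinuous because [B] is open. [v] is the supremum of the chain infima of [F] for a density
    dominating [G]. Then [v <= F] controls the support and the norm of [v], and
    [chain_approximation], applied to the closed set of a single point, gives [|w| <= v] there. *)
Lemma local_majorant (w : X -> R) (G : X -> \bar R) (M e : R) :
  (0 < M)%R -> (forall x, `|w x| <= M)%R -> (forall x, ~ B x -> w x = 0%R) ->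
  measurable_fun setT (w : cara -> R) ->
  borel_nonneg G -> lip_upper_gradient w G -> (0 < e)%R ->
  exists v G', [/\ forall c, open [set x | (c < v x)%R], forall x, (`|w x| <= v x)%R,
    borel_nonneg G' /\ lip_upper_gradient v G', forall x, ~ B x -> v x = 0%R &
    power_integral nu p setT (fun x => (v x)%:E) + power_integral nu p setT G' <=
      (8 `^ p)%:E * (power_integral nu p setT (fun x => `|w x|%:E) + power_integral nu p setT G) + e%:E].
Proof.
move=> M0 wM wB mw bG wG e0.
have e2 : e%:E = (e / 2)%:E + (e / 2)%:E by rewrite -EFinD; congr EFin; lra.
have mD : measurable (D : set cara) := borel_cara mu (closed_borel cD).
have mB : measurable (B : set cara) := borel_cara mu (open_borel oB).
have e20 : (0 < e / 2)%R by rewrite divr_gt0.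
have mG : measurable_fun setT (G : cara -> \bar R) := borel_cara_fun bG.1.
have mw1 : measurable_fun setT ((fun x => `|w x|%:E) : cara -> \bar R) := measurable_norm_EFin mw.
have w0 x : 0 <= `|w x|%:E by rewrite lee_fin.
have [kap [Q [k0 [cQ tQ] QD gQ dQ]]] := vitali_caratheodory_small mG bG.2 e20.
have [kap' [Q' [k0' [cQ' tQ'] QD' gQ' dQ']]] := vitali_caratheodory_small mw1 w0 e20.
set dens := density_sup kap Q in gQ dQ.
set dens' := density_sup kap' Q' in gQ' dQ'.
have bd : borel_nonneg dens := density_sup_borel Q k0.
have bd' : borel_nonneg dens' := density_sup_borel Q' k0'.
have Gd x : G x <= dens x.
  have [Dx|nDx] := pselect (D x); first exact: gQ.
  apply: density_sup_ge => //; first exact: bG.2.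
  by move=> j /QD.
have wd : lip_upper_gradient (fun x => `|w x|)%R dens.
  apply: lip_upper_gradient_le bG bd Gd _.
  by apply: lip_upper_gradient_contraction wG => x y; exact: ler_dist_dist.
pose F x : R := if x \in B then fine (Order.min M%:E (dens' x)) else 0%R.
have FE x : B x -> (F x)%:E = Order.min M%:E (dens' x).
  move=> Bx; rewrite /F mem_set// fineK// fin_numE.
  rewrite gt_eqF ?lt_min ?ltNyr ?(lt_le_trans _ (bd'.2 x))//= lt_eqF//.
  by rewrite gt_min ltry.
have F0 x : (0 <= F x)%R.
  have [Bx|nBx] := pselect (B x); last by rewrite /F memNset.
  by rewrite -lee_fin FE// le_min lee_fin (ltW M0) bd'.2.
have FB x : ~ B x -> F x = 0%R by move=> nBx; rewrite /F memNset.
have wF x : (`|w x| <= F x)%R.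
  have [Bx|nBx] := pselect (B x); last by rewrite wB// normr0.
  by rewrite -lee_fin FE// le_min lee_fin wM gQ'//; exact: BD.
have Fd x : (F x)%:E <= dens' x.
  have [Bx|nBx] := pselect (B x); last by rewrite FB// bd'.2.
  by rewrite FE// ge_min lexx orbT.
have Flsc x (d : R) : (0 < d)%R ->
    exists2 r : R, (0 < r)%R & forall y, (mdist x y < r)%R -> (F x - d < F y)%R.
  move=> d0; have [Bx|nBx] := pselect (B x); last first.
    by exists 1%R => // y _; rewrite FB// sub0r (lt_le_trans _ (F0 y))// oppr_lt0.
  have : (F x - d)%:E < dens' x.
    by apply: lt_le_trans (Fd x); rewrite lte_fin gtrBl.
  move=> /ereal_sup_gt[_ [n _ <-]]; rewrite lte_fin => hn.
  pose k : R := (\sum_(i < n) kap' * 2 ^+ i * n%:R)%R.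
  have kl y : (`|density kap' Q' n x - density kap' Q' n y| <= k * mdist x y)%R.
    exact: density_lipschitz.
  have kk : (0 <= k)%R.
    by apply: sumr_ge0 => i _; rewrite !mulr_ge0 ?exprn_ge0 ?ler0n ?(ltW k0').
  have k1 : (0 < k + 1)%R by rewrite ltr_wpDl.
  have /nbhs_ballP[r /= r0 hr] := open_nbhs_nbhs (conj oB Bx).
  pose t : R := ((density kap' Q' n x - (F x - d)) / (k + 1))%R.
  have t0 : (0 < t)%R by rewrite divr_gt0// subr_gt0.
  exists (Num.min r t) => [|y]; first by rewrite lt_min r0.
  rewrite lt_min => /andP[xr xt].
  have By : B y by apply: hr; rewrite ballEmdist.
  rewrite -lte_fin (FE _ By) lt_min; apply/andP; split.
    rewrite lte_fin; apply: (@lt_le_trans _ _ (F x)); first by rewrite gtrBl.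
    by rewrite -lee_fin (FE _ Bx) ge_min lexx.
  apply: lt_le_trans (density_le_sup kap' Q' n y); rewrite lte_fin.
  move: xt; rewrite /t ltr_pdivlMr// => xt.
  have := kl y; rewrite ler_norml => /andP[_ h2].
  have z0 := mdist_ge0 x y; move: h2 xt; rewrite mulrDr mulr1 (mulrC (mdist x y)) => h2 xt.
  by lra.
pose h n := chain_inf (density kap Q n) F n.+1%:R^-1.
have h0 n x : (0 <= h n x)%R by exact: chain_inf_ge (density_ge0 Q k0 n) F0 x.
have hF n x : (h n x <= F x)%R by exact: chain_inf_le (density_ge0 Q k0 n) F0 x.
have r0 n : (0 < n.+1%:R^-1 :> R)%R by rewrite invr_gt0.
have ch n : continuous (h n).
  exact: chain_inf_continuous (density_ge0 Q k0 n) (density_le Q k0 n) (r0 n) F0.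
have hG n : lip_upper_gradient (h n) (EFin \o density kap Q n).
  apply: (chain_inf_upper_gradient (density_ge0 Q k0 n) (density_le Q k0 n) _
    (density_lipschitz Q k0 n) (r0 n) F0).
  by apply: sumr_ge0 => i _; rewrite !mulr_ge0 ?exprn_ge0 ?ler0n ?(ltW k0).
pose v x := sup (range (fun n => h n x)).
have vub x : has_sup (range (fun n => h n x)).
  by split; [exists (h 0%N x), 0%N|exists (F x) => _ [n _ <-]].
have hv n x : (h n x <= v x)%R by apply: sup_upper_bound => //; exists n.
have vF x : (v x <= F x)%R by apply: ge_sup => [|_ [n _ <-]//]; case: (vub x).
have v0 x : (0 <= v x)%R by exact: le_trans (h0 0%N x) (hv _ _).
have vgt c x : (c < v x)%R -> exists n, (c < h n x)%R.
  by move=> /(sup_gt (vub x).1)[_ [n _ <-]] ?; exists n.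
have ov c : open [set x | (c < v x)%R].
  have -> : [set x | (c < v x)%R] = \bigcup_n [set x | (c < h n x)%R].
    apply/seteqP; split => [x /= /vgt[n hn]|x [n _ /= hn]]; first by exists n.
    exact: lt_le_trans hn (hv _ _).
  apply: bigcup_open => n _.
  apply: (@open_comp _ _ (h n) [set y | (c < y)%R]); last exact: open_gt.
  by move=> x _; exact: ch.
have vB x : ~ B x -> v x = 0%R.
  by move=> nB; apply/le_anti; rewrite v0 andbT (le_trans (vF x))// FB.
have wv x : (`|w x| <= v x)%R.
  have [Bx|nBx] := pselect (B x); last by rewrite wB// normr0.
  apply/ler_addgt0Pr => d d0.
  have KD : [set x] `<=` D by move=> _ ->; exact: BD.
  have tK : totally_bounded_set [set x].
    by move=> t t0; exists [:: x] => _ ->; exists x; rewrite ?inE// mdistxx.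
  have cK : closed [set x].
    have -> : [set x] = [set y | (mdist x y <= 0)%R].
      apply/seteqP; split => y /= => [->|yx]; first by rewrite mdistxx.
      by apply/esym/mdist_positivity/le_anti; rewrite yx mdist_ge0.
    exact: closed_ball_mdist.
  have ww y : (`| `|w y| | <= M)%R by rewrite normr_id.
  have [|n hn] := @chain_approximation _ _ kap Q k0 D D' [set x] eta M _ F cD' eta0 DD' QD tQ KD tK cK
    ww wF Flsc _ wd d d0.
    by move=> y t -> t0; exists 1%R => // z -> _; rewrite subrr normr0.
  have := hn x erefl; rewrite lerBlDr => /le_trans; apply.
  by rewrite lerD2r; exact: hv.
have vG : lip_upper_gradient v dens.
  apply: lip_upper_gradient_esup hG _ => [n|x y d d0]; first exact: density_borel.
  have key x' y' : (v y' <= v x')%R -> exists j, (`|v x' - v y'| <= `|h j x' - h j y'| + d)%R.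
    move=> yx; have [|j hj] := vgt (v x' - d)%R x'; first by rewrite gtrBl.
    exists j; rewrite ger0_norm ?subr_ge0//.
    have := ler_norm (h j x' - h j y'); have := hv j y'; lra.
  have [yx|xy] := leP (v y) (v x); first exact: key.
  have [j hj] := key _ _ (ltW xy); exists j.
  by rewrite distrC (distrC (h j x)).
exists v, (dens \_ B); split => //.
  split; last exact: lip_upper_gradient_open.
  by apply: borel_nonneg_restrict => //; exact: open_borel.
have md : measurable_fun setT (dens : cara -> \bar R) := borel_cara_fun bd.1.
have md' : measurable_fun setT (dens' : cara -> \bar R) := borel_cara_fun bd'.1.
have mv : measurable_fun setT ((fun x => (v x)%:E) : cara -> \bar R).
  apply/measurable_EFinP; apply: borel_cara_fun; exact: lsc_borel.
have mr : measurable_fun setT (dens' \_ B : cara -> \bar R) by exact: cara_measurable_restrict.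
have vd x : (v x)%:E <= (dens' \_ B) x.
  rewrite patchE; case: ifPn => [_|]; last by rewrite notin_setE => /vB ->.
  by apply: le_trans (Fd x); rewrite lee_fin.
have ve0 x : 0 <= (v x)%:E by rewrite lee_fin.
have Iv : power_integral nu p setT (fun x => (v x)%:E) <= power_integral nu p D dens'.
  have h1 := power_integral_le nu p1 measurableT mv mr (fun x _ => ve0 x) (fun x _ => vd x).
  apply: le_trans h1 _; rewrite (power_integral_restrict nu p1) setTI.
  exact: (power_integral_subset nu p mD mB BD md').
have IG : power_integral nu p setT (dens \_ B) <= power_integral nu p D dens.
  rewrite (power_integral_restrict nu p1) setTI.
  exact: (power_integral_subset nu p mD mB BD md).
have sD (u : cara -> \bar R) : measurable_fun setT u ->
    (8 `^ p)%:E * power_integral nu p D u + (e / 2)%:E <=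
    (8 `^ p)%:E * power_integral nu p setT u + (e / 2)%:E.
  move=> mu'; apply: leeD2r; apply: lee_wpmul2l; first by rewrite lee_fin powR_ge0.
  exact: power_integral_subset.
apply: le_trans (leeD (le_trans Iv (le_trans dQ' (sD _ mw1)))
  (le_trans IG (le_trans dQ (sD _ mG)))) _.
rewrite (ge0_muleDr _ (power_integral_ge0 nu p setT _) (power_integral_ge0 nu p setT G)).
by rewrite e2 addeACA.
Qed.

End local_majorant.

(** * Covers by complete balls and partitions of unity *)

Section complete_balls.
Context {R : realType} {X : pmetricType R}.

Lemma complete_set_closed (U C : set X) : complete_set U -> closed C -> C `<=` U -> complete_set C.
Proof.
move=> cU cC CU u uC cu; have [x Ux ux] := cU u (fun n => CU _ (uC n)) cu.
by exists x => //; exact: (@closed_cvg _ _ _ _ u C cC (nearW _ uC) _ ux).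
Qed.

(** The balls of radius [r i] cover the space, those of radius [2 r i] will carry a partition of
    unity, and completeness of those of radius [3 r i] leaves a margin [r i] for the chains. *)
Lemma complete_ball_cover : locally_complete X -> separable X ->
  exists (z : nat -> X) (r : nat -> R), [/\ forall i, 0 < r i,
    forall i, complete_set [set x | mdist (z i) x <= 3 * r i] &
    forall x, exists i, mdist (z i) x < r i].
Proof.
move=> lc sep; have [d dd] := dense_sequence sep.
have key x : exists n m, complete_set [set y | mdist (d n) y <= 3 * m.+1%:R^-1] /\
    mdist (d n) x < m.+1%:R^-1.
  have [U /nbhs_ballP[e /= e0 eU] cU] := lc x.
  have e4 : 0 < e / 4 by rewrite divr_gt0.
  have /ltr_add_invr[m] := e4; rewrite add0r => me.
  have m0 : 0 < m.+1%:R^-1 :> R by rewrite invr_gt0.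
  have [n hn] := dd x _ m0; exists n, m; split => //.
  apply: (complete_set_closed cU); first exact: closed_ball_mdist.
  move=> y /= ny; apply: eU; rewrite ballEmdist /=.
  have := metric_triangle x (d n) y; rewrite (metric_sym x (d n)).
  move: (m.+1%:R^-1) (mdist (d n) x) hn (mdist (d n) y) ny (mdist x y) me => a b ? c ? f ? ?; lra.
have [n0 [m0 [c0 _]]] := key point.
(* Indices that code no complete ball are sent to one fixed complete ball. *)
pose good (i : nat) : nat * nat := if unpickle i is Some a then
  if `[< complete_set [set y | mdist (d a.1) y <= 3 * a.2.+1%:R^-1] >] then a else (n0, m0)
  else (n0, m0).
exists (fun i => d (good i).1), (fun i => (good i).2.+1%:R^-1); split.
- by move=> i; rewrite invr_gt0.
- move=> i; rewrite /good; case: (unpickle i) => //= a.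
  by case: asboolP.
- move=> x; have [n [m [c h]]] := key x.
  by exists (pickle (n, m)); rewrite /good pickleK asboolT.
Qed.

End complete_balls.

Section partition_of_unity.
Context {R : realType} {X : pmetricType R}.
Variables (z : nat -> X) (r : nat -> R).
Hypotheses (r0 : forall i, 0 < r i) (cov : forall x, exists i, mdist (z i) x < r i).

Let theta i x := clamp 0 1 (2 - mdist (z i) x / r i).
Let phi i x := theta i x * \prod_(j < i) (1 - theta j x).

Let theta01 i x : 0 <= theta i x <= 1.
Proof. exact/clamp_itv/ler01. Qed.

Let theta_lip i x y : `|theta i x - theta i y| <= (r i)^-1 * mdist x y.
Proof.
apply: le_trans (clamp_lipschitz _ _ _ _) _.
have -> : 2 - mdist (z i) x / r i - (2 - mdist (z i) y / r i) =
  (r i)^-1 * (mdist (z i) y - mdist (z i) x) by ring.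
rewrite normrM ger0_norm ?invr_ge0 ?(ltW (r0 i))// ler_wpM2l ?invr_ge0 ?(ltW (r0 i))//.
have h1 := metric_triangle (z i) x y; have h2 := metric_triangle (z i) y x.
by rewrite (metric_sym y x) in h2; rewrite ler_norml; apply/andP; split; lra.
Qed.

Let lip_mul (a b : X -> R) : (forall x, `|a x| <= 1) -> (forall x, `|b x| <= 1) ->
  (exists2 k, 0 <= k & forall x y, `|a x - a y| <= k * mdist x y) ->
  (exists2 k, 0 <= k & forall x y, `|b x - b y| <= k * mdist x y) ->
  exists2 k, 0 <= k & forall x y, `|a x * b x - a y * b y| <= k * mdist x y.
Proof.
move=> a1 b1 [k k0 hk] [l l0 hl]; exists (k + l) => [|x y]; first by rewrite addr_ge0.
have -> : a x * b x - a y * b y = (a x - a y) * b x + a y * (b x - b y) by ring.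
apply: le_trans (ler_normD _ _) _; rewrite !normrM (mulrDl k l); apply: lerD.
  by rewrite -[leRHS]mulr1 ler_pM.
by rewrite -[leRHS]mul1r ler_pM.
Qed.

Let prod01 n x : 0 <= \prod_(j < n) (1 - theta j x) <= 1.
Proof.
have h j : 0 <= 1 - theta j x <= 1.
  by have /andP[? ?] := theta01 j x; apply/andP; split; lra.
elim: n => [|n /andP[a b]]; first by rewrite big_ord0 ler01 lexx.
have /andP[c d] := h n.
by rewrite big_ord_recr /= mulr_ge0//= mulr_ile1.
Qed.

Let prod_lip n : exists2 k, 0 <= k & forall x y,
  `|\prod_(j < n) (1 - theta j x) - \prod_(j < n) (1 - theta j y)| <= k * mdist x y.
Proof.
elim: n => [|n IH].
  by exists 0 => // x y; rewrite !big_ord0 subrr normr0 mul0r.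
have [|||k k0 hk] := lip_mul _ _ IH (b := fun x => 1 - theta n x).
- by move=> x; have /andP[a b] := prod01 n x; rewrite ger0_norm.
- move=> x; have /andP[a b] := theta01 n x; rewrite ger0_norm; lra.
- exists (r n)^-1 => [|x y]; first by rewrite invr_ge0 ltW.
  have -> : 1 - theta n x - (1 - theta n y) = - (theta n x - theta n y) by ring.
  by rewrite normrN; exact: theta_lip.
by exists k => // x y; rewrite !big_ord_recr; exact: hk.
Qed.

(** The bump [theta i] is 1 on the ball of radius [r i] and 0 off the ball of radius [2 r i]. The
    sum of the [phi j] telescopes to 1 minus the product of the [1 - theta j]. Near every point some
    [theta i] equals 1, which makes this product and all later [phi j] vanish. *)
Lemma partition_of_unity : exists phi : nat -> X -> R, [/\ forall i x, `|phi i x| <= 1,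
  forall i, exists2 k, 0 <= k & forall x y, `|phi i x - phi i y| <= k * mdist x y,
  forall i x, ~ mdist (z i) x < 2 * r i -> phi i x = 0 &
  forall x, exists N, exists2 d, 0 < d & forall y, mdist x y < d ->
    (forall j, (N <= j)%N -> phi j y = 0) /\ \sum_(j < N) phi j y = 1].
Proof.
exists phi; split.
- move=> i x; have /andP[a b] := prod01 i x; have /andP[c d] := theta01 i x.
  by rewrite ger0_norm ?mulr_ge0// mulr_ile1.
- move=> i; apply: lip_mul; last exact: prod_lip.
  + by move=> x; have /andP[a b] := theta01 i x; rewrite ger0_norm.
  + by move=> x; have /andP[a b] := prod01 i x; rewrite ger0_norm.
  + by exists (r i)^-1; [rewrite invr_ge0 ltW|exact: theta_lip].
- move=> i x /negP; rewrite -leNgt => h; rewrite /phi /theta /clamp.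
  rewrite (_ : Num.max _ _ = 0) ?mul0r//; apply: max_l; rewrite ge_min; apply/orP; right.
  by rewrite subr_le0 ler_pdivlMr.
- move=> x; have [i hi] := cov x; exists i.+1, (r i - mdist (z i) x); first by rewrite subr_gt0.
  move=> y xy; have th1 : theta i y = 1.
    rewrite /theta /clamp min_l ?max_r//.
    have zy : mdist (z i) y <= r i by have := metric_triangle (z i) x y; lra.
    have : mdist (z i) y / r i <= 1 by rewrite ler_pdivrMr// mul1r.
    lra.
  split => [j ij|].
    by rewrite /phi (bigD1 (Ordinal ij)) //= th1 subrr mul0r mulr0.
  have sumE n : \sum_(j < n) phi j y = 1 - \prod_(j < n) (1 - theta j y).
    elim: n => [|n IH]; first by rewrite !big_ord0 subrr.
    rewrite !big_ord_recr/= IH /phi; ring.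
  by rewrite sumE big_ord_recr /= th1 subrr mulr0 subr0.
Qed.

End partition_of_unity.

Lemma open_ball_metric {R : realType} {X : pmetricType R} (z : X) (r : R) : open (ball z r).
Proof.
rewrite ballEmdist; apply: (@open_comp _ _ (mdist z) [set y | y < r]); last exact: open_lt.
move=> x _; apply: (@lipschitz_continuous _ _ _ 1) => a b; rewrite mul1r.
have h1 := metric_triangle z a b; have h2 := metric_triangle z b a.
by rewrite (metric_sym b a) in h2; rewrite ler_norml; apply/andP; split; lra.
Qed.

(** * Global decomposition into local errors *)

Section decomposition.
Context {R : realType} {X : pmetricType R}.
Variables (mu : {measure set (borel X) -> \bar R}) (p : R).
Local Notation cara := (caratheodory_type (mu^*)%mu).
Local Notation nu := (@completed_measure_extension _ _ _ mu).
Local Open Scope ereal_scope.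
Hypotheses (hcomplete : locally_complete X) (sep : separable X)
  (hmu : forall (x : X) (r : R), (0 < r)%R -> 0 < mu (ball x r : set (borel X)) < +oo)
  (p1 : (1 <= p)%R).

Lemma locally_finite_sum_continuous (phi hh : nat -> X -> R) :
  (forall i, continuous (phi i)) -> (forall i, continuous (hh i)) ->
  (forall x, exists N, exists2 d : R, (0 < d)%R & forall y, (mdist x y < d)%R ->
    forall j, (N <= j)%N -> phi j y = 0%R) ->
  exists h : X -> R, continuous h /\ forall x N, (forall j, (N <= j)%N -> phi j x = 0%R) ->
    h x = (\sum_(j < N) phi j x * hh j x)%R.
Proof.
move=> cphi chh lf.
have /choice[N hN] : forall x, exists N, exists2 d : R, (0 < d)%R & forall y, (mdist x y < d)%R ->
    forall j, (N <= j)%N -> phi j y = 0%R by [].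
have Nx x j : (N x <= j)%N -> phi j x = 0%R.
  by move=> Nj; have [d d0 hd] := hN x; apply: hd => //; rewrite mdistxx.
pose h x := (\sum_(j < N x) phi j x * hh j x)%R.
have tail x m n : (m <= n)%N -> (forall j, (m <= j)%N -> phi j x = 0%R) ->
    (\sum_(j < n) phi j x * hh j x = \sum_(j < m) phi j x * hh j x)%R.
  move=> mn z0; elim: n mn => [|n IH]; first by rewrite leqn0 => /eqP ->.
  rewrite leq_eqVlt => /orP[/eqP -> //|]; rewrite ltnS => mn.
  by rewrite big_ord_recr/= z0// mul0r addr0 IH.
have hE x n : (forall j, (n <= j)%N -> phi j x = 0%R) -> h x = (\sum_(j < n) phi j x * hh j x)%R.
  move=> z0; rewrite /h; have [le|/ltnW le] := leqP n (N x); first exact: tail.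
  by rewrite (tail _ _ _ le (Nx x)).
exists h; split => // x; have [d d0 hd] := hN x.
have cs n : continuous (fun y => (\sum_(j < n) phi j y * hh j y)%R).
  elim: n => [|n IH].
    rewrite (_ : (fun y => _) = cst 0%R); last by apply/funext => y; rewrite big_ord0.
    exact: cst_continuous.
  rewrite (_ : (fun y => _) =
    (fun y => (\sum_(j < n) phi j y * hh j y + phi n y * hh n y)%R)); last first.
    by apply/funext => y; rewrite big_ord_recr.
  move=> y; apply: cvgD; first exact: IH.
  by apply: cvgM; [exact: cphi|exact: chh].
have E : \forall y \near x, (\sum_(j < N x) phi j y * hh j y)%R = h y.
  apply/nbhs_ballP; exists d => // y; rewrite ballEmdist => xy.
  by rewrite (hE y (N x))//; exact: hd.
exact: cvg_trans (near_eq_cvg E) (cs (N x) x).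
Qed.

(** With [h] the sum of the [phi i * hh i], and as the [phi i] sum to 1, [f - h] is the sum of the
    [w i = phi i * (f - hh i)], exactly and finitely at each point. The bounds [eps] are free
    because density and quasicontinuity use different weights. *)
Lemma approximation_decomposition (f : X -> R) (g : X -> \bar R) (M : R) (eps : nat -> R) :
  (0 < M)%R -> (forall x, `|f x| <= M)%R -> measurable_fun setT (f : cara -> R) ->
  borel_nonneg g -> lip_upper_gradient f g -> power_integral nu p setT g < +oo ->
  (forall i, 0 < eps i)%R ->
  exists (h : X -> R) (w v : nat -> X -> R) (G H : nat -> X -> \bar R), [/\ continuous h,
    forall x, exists N, forall n, (N <= n)%N -> (f x - h x = \sum_(j < n) w j x)%R,
    forall j, measurable_fun setT (w j : cara -> R) /\
      [/\ borel_nonneg (G j), lip_upper_gradient (w j) (G j) &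
      power_integral nu p setT (fun x => `|w j x|%:E) + power_integral nu p setT (G j) <= (eps j)%:E] &
    forall j, [/\ forall c, open [set x | (c < v j x)%R], forall x, (`|w j x| <= v j x)%R,
      borel_nonneg (H j), lip_upper_gradient (v j) (H j) &
      power_integral nu p setT (fun x => (v j x)%:E) + power_integral nu p setT (H j) <= (eps j)%:E]].
Proof.
move=> M0 fM mf bg fg goo e0.
have [z [r [r0 cr cov]]] := complete_ball_cover hcomplete sep.
have [phi [phi1 philip phi0 phisum]] := partition_of_unity r0 cov.
pose D i := [set x | (mdist (z i) x <= 2 * r i)%R].
pose D' i := [set x | (mdist (z i) x <= 3 * r i)%R].
pose B i := [set x | (mdist (z i) x < 2 * r i)%R].
have cD i : closed (D i) by exact: closed_ball_mdist.
have oB i : open (B i).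
  have -> : B i = ball (z i) (2 * r i) by rewrite ballEmdist.
  by apply: open_ball_metric.
have BD i : B i `<=` D i by move=> x /ltW.
have Doo i : mu (D i : set (borel X)) < +oo.
  have r3 : (0 < 3 * r i)%R by rewrite mulr_gt0.
  have /andP[_] := hmu (z i) r3; apply: le_lt_trans.
  apply: le_measure; rewrite ?inE.
  - exact: closed_borel.
  - by apply: open_borel; exact: open_ball_metric.
  - move=> x; rewrite /D /= ballEmdist/= => /le_lt_trans; apply.
    by rewrite ltr_pM2r// ltr_nat.
have DD' i x y : D i x -> (mdist x y < r i)%R -> D' i y.
  rewrite /D /D' /= => h1 h2; have := metric_triangle (z i) x y; lra.
have mD i : measurable (D i : set cara) := borel_cara mu (closed_borel (cD i)).
have mg : measurable_fun setT (g : cara -> \bar R) := borel_cara_fun bg.1.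
have gDoo i : power_integral nu p (D i) g < +oo.
  by apply: le_lt_trans goo; exact: (power_integral_subset nu p measurableT (mD i) _ mg).
have c0 : (0 < 8 `^ p :> R)%R by rewrite powR_gt0.
(* The second bound makes up for the factor [8] to the power [p] that passing from [w i] to its
   majorant costs. *)
pose del i : R := Num.min (eps i) (eps i / 2 / 8 `^ p)%R.
have del0 i : (0 < del i)%R by rewrite lt_min e0 !divr_gt0.
have /choice[hh hhP] : forall i, exists h0, continuous (h0 : X -> R) /\ exists G, [/\ borel_nonneg G,
    lip_upper_gradient (fun x => phi i x * (f x - h0 x))%R G,
    forall x, (`|phi i x * (f x - h0 x)| <= 2 * M + 1)%R &
    power_integral nu p setT (fun x => `|phi i x * (f x - h0 x)|%:E) +
      power_integral nu p setT G <= (del i)%:E].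
  move=> i; have [k k0 hk] := philip i.
  have [h0 [G [ch bG hG hM hI]]] := local_approximation p1 sep (cD i) (Doo i) (cr i) (r0 i)
    (@DD' i) (oB i) (@BD i) k0 (phi1 i) hk (phi0 i) M0 fM mf bg fg (gDoo i) (del0 i).
  by exists h0; split => //; exists G.
have {hhP}[chh /choice[G GP]] := all_and2 hhP.
pose w i x := (phi i x * (f x - hh i x))%R.
have cphi i : continuous (phi i).
  by have [k k0 hk] := philip i; exact: lipschitz_continuous hk.
have [|h [ch hE]] := locally_finite_sum_continuous cphi chh.
  move=> x; have [N [d d0 hd]] := phisum x; exists N, d => // y /hd[]; done.
have mw i : measurable_fun setT (w i : cara -> R).
  have mphi : measurable_fun setT (phi i : cara -> R) := borel_cara_fun (continuous_borel (cphi i)).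
  have mh : measurable_fun setT (hh i : cara -> R) := borel_cara_fun (continuous_borel (chh i)).
  exact: (measurable_funM mphi (measurable_funB mf mh)).
have M1 : (0 < 2 * M + 1)%R by lra.
have e20 i : (0 < eps i / 2)%R by rewrite divr_gt0.
have /choice[v] : forall i, exists v, exists H, [/\ forall c, open [set x | (c < v x)%R],
      forall x, (`|w i x| <= v x)%R,
      borel_nonneg H, lip_upper_gradient v H &
      power_integral nu p setT (fun x => (v x)%:E) + power_integral nu p setT H <= (eps i)%:E].
  move=> i; have [bG hG hM hI] := GP i.
  have wB x : ~ B i x -> w i x = 0%R by move=> nB; rewrite /w phi0// mul0r.
  have [v [H [ov wv [bH hH] vB vI]]] := local_majorant p1 sep (cD i) (Doo i) (cr i) (r0 i)
    (@DD' i) (oB i) (@BD i) M1 hM wB (mw i) bG hG (e20 i).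
  exists v, H; split => //; apply: le_trans vI _.
  apply: (@le_trans _ _ ((8 `^ p)%:E * (del i)%:E + (eps i / 2)%:E)).
    by apply: leeD2r; apply: lee_wpmul2l hI; rewrite lee_fin powR_ge0.
  rewrite -EFinM -EFinD lee_fin.
  have h1 : (8 `^ p * del i <= eps i / 2)%R.
    by rewrite mulrC -ler_pdivlMr// ge_min lexx orbT.
  lra.
move=> /choice[H HP]; exists h, w, v, G, H; split => //.
- move=> x; have [N [d d0 hd]] := phisum x; exists N => n Nn.
  have [|z0 s1] := hd x; first by rewrite mdistxx.
  have zn j : (n <= j)%N -> phi j x = 0%R by move=> nj; apply: z0; exact: leq_trans nj.
  have s1n : (\sum_(j < n) phi j x = 1)%R.
    rewrite -s1; elim: n Nn {zn} => [|n IH]; first by rewrite leqn0 => /eqP ->.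
    rewrite leq_eqVlt => /orP[/eqP -> //|]; rewrite ltnS => Nn.
    by rewrite big_ord_recr/= z0// addr0 IH.
  rewrite (hE x n zn) -[X in (X - _)%R]mul1r -s1n mulr_suml -sumrB.
  by apply: eq_bigr => j _; rewrite /w mulrBr.
- move=> i; split => //; have [bG hG hM hI] := GP i; split => //.
  by apply: le_trans hI _; rewrite lee_fin ge_min lexx.
Qed.

End decomposition.

(** * Energy bounds for finite-valued functions *)

Section finite_valued.
Context {R : realType} {X : pmetricType R}.
Local Open Scope ereal_scope.

Lemma curve_length_cst (x : X) (a b : R) : (a <= b)%R -> curve_length a b (fun=> x) = 0.
Proof.
move=> ab; apply/eqP; rewrite eq_le curve_length_ge0// andbT.
by apply: ge_ereal_sup => _ [s _ <-]; rewrite /= lee_fin big1// => i _; rewrite mdistxx.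
Qed.

(* A constant curve has path integral 0, and |f x - f x| = +oo where f is infinite. *)
Lemma upper_gradient_fin_num (f g : X -> \bar R) x : upper_gradient f g -> f x \is a fin_num.
Proof.
move=> [_ _ /(_ (fun=> x))].
have rc : rectifiable (fun=> x : X).
  split; last by rewrite curve_length_cst.
  by apply: continuous_subspaceT => t; exact: cvg_cst.
move=> /(_ rc); rewrite /path_integral curve_length_cst// mul0e.
by case: (f x) => [r| |].
Qed.

End finite_valued.

Section energy.
Context {R : realType} {X : pmetricType R}.
Variables (mu : {measure set (borel X) -> \bar R}) (p : R).
Local Notation cara := (caratheodory_type (mu^*)%mu).
Local Notation nu := (@completed_measure_extension _ _ _ mu).
Local Notation norm u := (fun x => `|u x|%:E).
Local Open Scope ereal_scope.
Hypothesis p1 : (1 <= p)%R.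

(** [b] bounds the [p]-th power of the Newtonian norm through an explicit upper gradient. With a
    witness instead of the infimum, and with powers instead of roots, the bounds pass directly to
    sums and suprema. *)
Definition energy_le (u : X -> R) (b : R) := measurable_fun setT (u : cara -> R) /\
  exists G, [/\ borel_nonneg G, lip_upper_gradient u G &
    power_integral nu p setT (norm u) + power_integral nu p setT G <= b%:E].

Let p0 : p != 0%R. Proof. by rewrite gt_eqF// (lt_le_trans ltr01). Qed.
Let norm0 (u : X -> R) x : 0 <= norm u x. Proof. by rewrite lee_fin. Qed.

Lemma energy_le_ge0 u b : energy_le u b -> (0 <= b)%R.
Proof.
move=> [_ [G [_ _ h]]]; rewrite -lee_fin; apply: le_trans h.
exact: adde_ge0 (power_integral_ge0 _ _ _ _) (power_integral_ge0 _ _ _ _).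
Qed.

Lemma Lp_norm_power (f : X -> \bar R) :
  Lp_norm mu p f `^ p = power_integral nu p setT (fun x => `|f x|).
Proof. exact: (poweR_Lnorm nu (f : cara -> \bar R) p0). Qed.

Lemma Lp_norm_lty (f : X -> \bar R) :
  power_integral nu p setT (fun x => `|f x|) < +oo -> Lp_norm mu p f < +oo.
Proof.
by rewrite -Lp_norm_power; case: (Lp_norm mu p f) => [r| |]; rewrite ?ltry ?ltNyr// poweRyr.
Qed.

Lemma power_integral_abs (G : X -> \bar R) : (forall x, 0 <= G x) ->
  power_integral nu p setT (fun x => `|G x|) = power_integral nu p setT G.
Proof. by move=> G0; congr power_integral; apply/funext => x; rewrite gee0_abs. Qed.

Lemma in_N1p_energy f : in_N1p mu p f -> exists u b, f = EFin \o u /\ energy_le u b.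
Proof.
move=> [[mf foo] [g fg [mg goo]]].
pose u x := fine (f x).
have fE : f = EFin \o u by apply/funext => x; rewrite /= fineK//; exact: upper_gradient_fin_num fg.
have [bg1 bg2 _] := fg; have bg : borel_nonneg g by [].
have foo' : power_integral nu p setT (norm u) < +oo.
  rewrite (_ : power_integral _ _ _ _ = Lp_norm mu p f `^ p) ?poweR_lty//.
  by rewrite Lp_norm_power fE.
have goo' : power_integral nu p setT g < +oo.
  by rewrite -(power_integral_abs bg2) -Lp_norm_power poweR_lty.
exists u, (fine (power_integral nu p setT (norm u) + power_integral nu p setT g)).
split => //; split; first by apply/measurable_EFinP; rewrite fE in mf.
exists g; split => //; first by apply: lip_of_upper_gradient; rewrite -fE.
have fin : power_integral nu p setT (norm u) + power_integral nu p setT g \is a fin_num.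
  rewrite ge0_fin_numE; first exact: lte_add_pinfty.
  exact: adde_ge0 (power_integral_ge0 _ _ _ _) (power_integral_ge0 _ _ _ _).
by rewrite fineK.
Qed.

Lemma energy_in_N1p u b : energy_le u b -> in_N1p mu p (EFin \o u).
Proof.
move=> [mu' [G [bG uG h]]].
have uoo : power_integral nu p setT (norm u) < +oo.
  apply: le_lt_trans (ltry b); apply: le_trans h.
  exact: (leeDl _ (power_integral_ge0 nu p setT G)).
have Goo : power_integral nu p setT G < +oo.
  apply: le_lt_trans (ltry b); apply: le_trans h.
  exact: (leeDr _ (power_integral_ge0 nu p setT (norm u))).
split; first by split; [exact/measurable_EFinP|exact: Lp_norm_lty].
exists G; first exact: upper_gradient_of_lip.
split; first exact: borel_cara_fun bG.1.
by apply: Lp_norm_lty; rewrite (power_integral_abs bG.2).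
Qed.

Lemma energy_N1p_norm u b : energy_le u b -> N1p_norm mu p (EFin \o u) `^ p <= b%:E.
Proof.
move=> [mu' [G [bG uG h]]]; apply: le_trans h.
have i0 : 0 <= ereal_inf [set Lp_norm mu p g `^ p | g in upper_gradient (EFin \o u)].
  by apply: le_ereal_inf_tmp => _ [g _ <-]; exact: poweR_ge0.
rewrite /N1p_norm -poweRrM mulVf// poweRe1; last by rewrite adde_ge0// poweR_ge0.
apply: leeD; first by rewrite Lp_norm_power.
apply: ereal_inf_lbound; exists G; first exact: upper_gradient_of_lip.
by rewrite Lp_norm_power (power_integral_abs bG.2).
Qed.

Lemma energy_leD u v w a b : energy_le u a -> energy_le v b ->
  measurable_fun setT (w : cara -> R) -> (forall x, `|w x| <= `|u x| + `|v x|)%R ->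
  (forall x y, `|w x - w y| <= `|u x - u y| + `|v x - v y|)%R ->
  energy_le w (2 `^ p * (a + b)).
Proof.
move=> [mu' [G [bG uG hu]]] [mv [H [bH vH hv]]] mw wle wlip; split => //.
exists (G \+ H); split; [exact: borel_nonnegD|exact: lip_upper_gradientD wlip uG vH|].
have nu1 := measurable_norm_EFin mu'; have nv1 := measurable_norm_EFin mv.
have nw1 := measurable_norm_EFin mw.
have h1 : power_integral nu p setT (norm w) <= (2 `^ p)%:E *
    (power_integral nu p setT (norm u) + power_integral nu p setT (norm v)).
  have wl x : setT x -> norm w x <= norm u x + norm v x by move=> _; rewrite -EFinD lee_fin.
  apply: le_trans (power_integral_le nu p1 measurableT nw1 (emeasurable_funD nu1 nv1)
    (fun x _ => norm0 w x) wl) _.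
  exact: (power_integralD nu p1 measurableT nu1 nv1 (norm0 u) (norm0 v)).
have h2 := power_integralD nu p1 measurableT (borel_cara_fun bG.1) (borel_cara_fun bH.1) bG.2 bH.2.
apply: le_trans (leeD h1 h2) _.
rewrite -(ge0_muleDr _ (adde_ge0 (power_integral_ge0 _ _ _ _) (power_integral_ge0 _ _ _ _))
  (adde_ge0 (power_integral_ge0 _ _ _ _) (power_integral_ge0 _ _ _ _))).
rewrite addeACA EFinM EFinD; apply: lee_wpmul2l; first by rewrite lee_fin powR_ge0.
exact: leeD hu hv.
Qed.

Lemma energy_le_of_esup (u : X -> R) (F G : nat -> X -> \bar R) (b : R) :
  measurable_fun setT (u : cara -> R) -> (0 <= b)%R ->
  (forall j, measurable_fun setT (F j : cara -> \bar R)) -> (forall j x, 0 <= F j x) ->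
  (forall j, borel_nonneg (G j)) -> lip_upper_gradient u (esup_fun G) ->
  (forall x, (`|u x|)%:E <= esup_fun F x) ->
  (forall j, power_integral nu p setT (F j) + power_integral nu p setT (G j) <=
    (b / (2 ^ j.+1)%:R)%:E) ->
  energy_le u b.
Proof.
move=> mu' b0 mF F0 bG uG uF hFG; split => //.
have mG j : measurable_fun setT (G j : cara -> \bar R) := borel_cara_fun (bG j).1.
exists (esup_fun G); split => //; first exact: borel_nonneg_esup.
have h1 : power_integral nu p setT (norm u) <= \sum_(0 <= j <oo) power_integral nu p setT (F j).
  have ms := esup_fun_measurable mF.
  apply: le_trans (power_integral_le nu p1 measurableT (measurable_norm_EFin mu') ms
    (fun x _ => norm0 u x) (fun x _ => uF x)) _.
  exact: (power_integral_esup nu p1 measurableT mF F0).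
have h2 := power_integral_esup nu p1 measurableT mG (fun j => (bG j).2).
apply: le_trans (leeD h1 h2) _.
rewrite -nneseriesD; last 2 first.
- by move=> *; exact: power_integral_ge0.
- by move=> *; exact: power_integral_ge0.
apply: le_trans (epsilon_trick0 xpredT b0).
apply: lee_nneseries => [j _ _|j _]; last exact: hFG.
exact: adde_ge0 (power_integral_ge0 _ _ _ _) (power_integral_ge0 _ _ _ _).
Qed.

Lemma energy_le_esup (u : X -> R) (ws : nat -> X -> R) (b : R) :
  measurable_fun setT (u : cara -> R) -> (0 <= b)%R ->
  (forall j, energy_le (ws j) (b / (2 ^ j.+1)%:R)) ->
  (forall x, (`|u x|)%:E <= esup_fun (fun j => norm (ws j)) x) ->
  (forall x y (e : R), (0 < e)%R -> exists j, `|u x - u y| <= `|ws j x - ws j y| + e)%R ->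
  energy_le u b.
Proof.
move=> mu' b0 /all_and2[mws /choice[G GP]] ule ulip.
have bG j : borel_nonneg (G j) by case: (GP j).
apply: (@energy_le_of_esup u _ G b mu' b0 (fun j => measurable_norm_EFin (mws j))
  (fun j => norm0 (ws j)) bG _ ule) => [|j]; last by case: (GP j).
by apply: lip_upper_gradient_esup ulip => // j; case: (GP j).
Qed.

(** The divisor [(2^(j+1))^p] in the hypothesis pays for the weights that turn the sum into a
    supremum. At each point the partial sums are eventually constant. *)
Lemma energy_le_series (u : X -> R) (ws : nat -> X -> R) (b : R) :
  measurable_fun setT (u : cara -> R) -> (0 <= b)%R ->
  (forall j, energy_le (ws j) (b / (2 ^ j.+1)%:R / (2 ^+ j.+1) `^ p)) ->
  (forall x, exists N, forall n, (N <= n)%N -> u x = \sum_(j < n) ws j x)%R ->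
  energy_le u b.
Proof.
move=> mu' b0 hws us.
have c0 j : (0 <= 2 ^+ j.+1 :> R)%R by rewrite exprn_ge0.
have /all_and2[mws /choice[G GP]] := hws.
have bG j : borel_nonneg (G j) by case: (GP j).
have uw : lip_upper_gradient u (esup_fun (fun j x => (2 ^+ j.+1)%:E * G j x)).
  apply: (@lip_upper_gradient_series _ _ u ws) => //; first by move=> j; case: (GP j).
  move=> x y e e0; have [N hN] := us x; have [N' hN'] := us y.
  exists (maxn N N'); rewrite (hN (maxn N N')) ?leq_maxl// (hN' (maxn N N')) ?leq_maxr//.
  rewrite -sumrB; apply: le_trans (ler_norm_sum _ _ _) _; rewrite lerDl; exact: ltW.
have h j x : 0 <= (2 ^+ j.+1)%:E * norm (ws j) x by rewrite mule_ge0 ?lee_fin.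
have mh j : measurable_fun setT ((fun x => (2 ^+ j.+1)%:E * norm (ws j) x) : cara -> \bar R).
  exact: (measurable_funeM _ (measurable_norm_EFin (mws j))).
apply: (@energy_le_of_esup u _ _ b mu' b0 mh h _ uw) => [j|x|j].
- exact: borel_nonnegZ.
- have [N hN] := us x; rewrite (hN N)//.
  apply: le_trans (_ : (\sum_(j < N) `|ws j x|)%:E <= _).
    by rewrite lee_fin ler_norm_sum.
  rewrite -sumEFin; exact: (sum_le_esup N (fun j => norm0 (ws j) x)).
- have [bGj wGj hj] := GP j.
  have mG : measurable_fun setT (G j : cara -> \bar R) := borel_cara_fun bGj.1.
  rewrite (power_integralZ nu p measurableT mG (fun x _ => bGj.2 x) (c0 j)).
  rewrite (power_integralZ nu p measurableT (measurable_norm_EFin (mws j)) (fun x _ => norm0 _ x) (c0 j)).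
  rewrite -(ge0_muleDr _ (power_integral_ge0 _ _ _ _) (power_integral_ge0 _ _ _ _)).
  apply: (@le_trans _ _ (((2 ^+ j.+1) `^ p)%:E * (b / (2 ^ j.+1)%:R / (2 ^+ j.+1) `^ p)%:E)).
    by apply: lee_wpmul2l => //; rewrite lee_fin powR_ge0.
  by rewrite -EFinM lee_fin mulrC divfK// gt_eqF// powR_gt0// exprn_gt0.
Qed.

Lemma energy_leZ u b (c : R) : (0 <= c)%R -> energy_le u b ->
  energy_le (fun x => c * u x)%R (c `^ p * b).
Proof.
move=> c0 [mu' [G [bG uG h]]]; split.
  exact: (measurable_funM (@measurable_cst _ _ cara _ setT c) mu').
exists (fun x => c%:E * G x); split; [exact: borel_nonnegZ|exact: lip_upper_gradientZ|].
have mG : measurable_fun setT (G : cara -> \bar R) := borel_cara_fun bG.1.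
rewrite (power_integralZ nu p measurableT mG (fun x _ => bG.2 x) c0).
have -> : (fun x => `|c * u x|%:E) = (fun x => c%:E * norm u x).
  by apply/funext => x; rewrite normrM ger0_norm// EFinM.
rewrite (power_integralZ nu p measurableT (measurable_norm_EFin mu') (fun x _ => norm0 u x) c0).
rewrite -(ge0_muleDr _ (power_integral_ge0 _ _ _ _) (power_integral_ge0 _ _ _ _)) EFinM.
by apply: lee_wpmul2l => //; rewrite lee_fin powR_ge0.
Qed.

End energy.

(** * Truncation and density of continuous functions *)

Section density.
Context {R : realType} {X : pmetricType R}.
Variables (mu : {measure set (borel X) -> \bar R}) (p : R).
Local Notation cara := (caratheodory_type (mu^*)%mu).
Local Notation nu := (@completed_measure_extension _ _ _ mu).
Local Notation norm u := (fun x => `|u x|%:E).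
Local Open Scope ereal_scope.
Hypothesis p1 : (1 <= p)%R.

Lemma energy_le_contraction (u w : X -> R) b : energy_le mu p u b ->
  measurable_fun setT (w : cara -> R) -> (forall x, `|w x| <= `|u x|)%R ->
  (forall x y, `|w x - w y| <= `|u x - u y|)%R -> energy_le mu p w b.
Proof.
move=> [mu' [G [bG uG h]]] mw wu wlip; split; first exact: mw.
exists G; split; [exact: bG|exact: lip_upper_gradient_contraction wlip uG|].
apply: le_trans h; apply: leeD2r.
apply: (power_integral_le nu p1 measurableT (measurable_norm_EFin mw) (measurable_norm_EFin mu')).
  by move=> x _; rewrite lee_fin.
by move=> x _; rewrite lee_fin.
Qed.

Lemma clamp_complement_contraction (M s t : R) : (0 <= M)%R ->
  (`|(s - clamp (- M) M s) - (t - clamp (- M) M t)| <= `|s - t|)%R.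
Proof.
move=> M0; have := ler_norm (s - t); have := ler_norm (t - s); rewrite (distrC t s).
move: `|s - t|%R => d h1 h2; rewrite ler_norml /clamp.
have NM : (- M <= M)%R by lra.
rewrite ![Num.max (- M)%R _]maxEle ![Num.min M _]minEle.
case: (leP M s) => Ms; case: (leP M t) => Mt; rewrite ?NM.
all: case: (leP (- M)%R s) => h4; case: (leP (- M)%R t) => h5; apply/andP; split; lra.
Qed.

Lemma clamp_continuous (a b : R) : continuous (clamp a b).
Proof.
move=> t; apply/cvgrPdist_lt => e e0; apply/nbhs_ballP; exists e => // s /= hs.
exact: le_lt_trans (clamp_lipschitz _ _ _ _) hs.
Qed.

Lemma continuous_comp_measurable (psi : R -> R) (u : X -> R) : continuous psi ->
  measurable_fun setT (u : cara -> R) -> measurable_fun setT (psi \o u : cara -> R).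
Proof. by move=> /continuous_measurable_fun; exact: measurableT_comp. Qed.

(** [u] minus its truncation vanishes where [|u| <= M], and the remaining set is small by
    Chebyshev's inequality. As that set is measurable for the completed measure only, it is enlarged
    to a Borel set [A]. Since [A] need not be open, the upper gradient is [G] restricted to [A] plus
    a small multiple of [G]. *)
Lemma truncation (u : X -> R) (a b : R) : energy_le mu p u a -> (0 < b)%R ->
  exists2 M : R, (0 < M)%R & energy_le mu p (fun x => u x - clamp (- M) M (u x))%R b.
Proof.
move=> ua b0; have a0 := energy_le_ge0 ua; have [mu' [G [bG uG h]]] := ua.
have mG : measurable_fun setT (G : cara -> \bar R) := borel_cara_fun bG.1.
have mn := measurable_norm_EFin mu'.
have ua' : power_integral nu p setT (norm u) <= a%:E.
  by apply: le_trans h; exact: (leeDl _ (power_integral_ge0 nu p setT G)).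
have Ga : power_integral nu p setT G <= a%:E.
  by apply: le_trans h; exact: (leeDr _ (power_integral_ge0 nu p setT (norm u))).
set c2 := (2 `^ p)%R : R; have c20 : (0 < c2)%R by rewrite powR_gt0.
pose b1 : R := (b / 4 / c2)%R.
have b10 : (0 < b1)%R by rewrite !divr_gt0.
have b20 : (0 < b / 2)%R by rewrite divr_gt0.
have [d1 d10 hd1] := integral_absolutely_continuous measurableT (poweR_measurable p mn)
  (fun x => poweR_ge0 _ p) (le_lt_trans ua' (ltry a)) b20.
have [d2 d20 hd2] := integral_absolutely_continuous measurableT (poweR_measurable p mG)
  (fun x => poweR_ge0 _ p) (le_lt_trans Ga (ltry a)) b10.
pose d : R := Num.min d1 d2.
have d0 : (0 < d)%R by rewrite lt_min d10.
(* This gives [a / M <= d / 2] for Chebyshev's inequality, and [1 <= M] gives [M <= M^p]. *)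
pose M : R := (2 * a / d + 1)%R.
have q0 : (0 <= 2 * a / d)%R by rewrite !mulr_ge0// invr_ge0 ltW.
have M1 : (1 <= M)%R by rewrite lerDr.
have M0 : (0 < M)%R by rewrite (lt_le_trans ltr01).
exists M; first exact: M0.
set w := fun x => _.
have mw : measurable_fun setT (w : cara -> R).
  exact: (measurable_funB mu' (continuous_comp_measurable (@clamp_continuous _ _) mu')).
have wlip x y : (`|w x - w y| <= `|u x - u y|)%R by exact/clamp_complement_contraction/ltW.
have wu x : (`|w x| <= `|u x|)%R.
  have := clamp_complement_contraction (u x) 0 (ltW M0).
  by rewrite (@clamp_id _ _ _ 0%R) ?subr0// lerNl oppr0 (ltW M0).
have w0 x : (`|u x| <= M)%R -> w x = 0%R.
  by move=> ux; rewrite /w clamp_id ?subrr// -ler_norml.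
pose E : set cara := [set x | M%:E <= norm u x].
have mE : measurable E.
  rewrite -[E]setTI; exact: emeasurable_fun_c_infty.
have nuE : nu E <= (d / 2)%:E.
  have h1 : (M `^ p)%:E * nu E <= a%:E.
    rewrite -(power_integral_cst nu p M mE); apply: le_trans ua'.
    have mc := @measurable_cst _ _ cara _ setT M%:E.
    apply: (@le_trans _ _ (power_integral nu p E (norm u))).
      apply: (power_integral_le nu p1 mE mc mn) => // x _; rewrite lee_fin; exact: ltW.
    exact: (power_integral_subset nu p measurableT mE (@subsetT _ _) mn).
  have h2 : M%:E * nu E <= a%:E.
    apply: le_trans h1; apply: lee_wpmul2r; first exact: measure_ge0.
    rewrite lee_fin -[leLHS]powRr1 ?(ltW M0)//; exact: ler_powR.
  have aM : (a / M <= d / 2)%R.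
    rewrite ler_pdivrMr// /M mulrDr mulr1.
    have -> : (d / 2 * (2 * a / d) = a)%R by field; rewrite gt_eqF.
    by rewrite lerDl divr_ge0// ltW.
  apply: (@le_trans _ _ (a / M)%:E); last by rewrite lee_fin.
  by rewrite mulrC EFinM; rewrite lee_pdivlMl.
have nuEoo : nu E < +oo by exact: le_lt_trans nuE (ltry _).
have d20' : (0 < d / 2)%R by rewrite divr_gt0.
have [A [mA EA hA]] := completed_hull d20' nuEoo.
have mA' : measurable (A : set cara) := borel_cara mu mA.
have nuA : nu (A : set cara) < d%:E.
  rewrite (completed_borelE mu mA); apply: lt_le_trans hA _.
  by apply: le_trans (leeD2r _ nuE) _; rewrite -EFinD lee_fin -splitr.
(* As [c <= 1 <= p], the [p]-th power of [c] is at most [c], so the [p]-th power of [c * G] has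
   integral at most [b1]. *)
pose c : R := Num.min 1%R (b / 4 / c2 / (a + 1))%R.
have a1 : (0 < a + 1)%R by rewrite ltr_wpDl.
have c0 : (0 < c)%R by rewrite lt_min ltr01 !divr_gt0.
have c1 : (c <= 1)%R by rewrite ge_min lexx.
have cp : (c `^ p <= b / 4 / c2 / (a + 1))%R.
  apply: (@le_trans _ _ c); last by rewrite ge_min lexx orbT.
  by rewrite -[leRHS]powRr1 ?(ltW c0)//; apply: ger_powR => //; rewrite c0.
have wA x : ~ A x -> w x = 0%R.
  move=> nA; apply: w0; rewrite leNgt; apply/negP => Mu; apply: nA; apply: EA.
  by rewrite /E /= lee_fin ltW.
have wG : lip_upper_gradient w G := lip_upper_gradient_contraction wlip uG.
split => //; exists (fun x => (G \_ A) x + c%:E * G x); split.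
- apply: borel_nonnegD; first exact: borel_nonneg_restrict.
  by apply: borel_nonnegZ => //; exact: ltW.
- exact: lip_upper_gradient_borel.
have mGA : measurable_fun setT (G \_ A : cara -> \bar R) := cara_measurable_restrict mA' mG.
have GA0 x : 0 <= (G \_ A) x by rewrite patchE; case: ifP => // _; exact: bG.2.
have cG0 x : 0 <= c%:E * G x by rewrite mule_ge0 ?bG.2// lee_fin ltW.
have mcG : measurable_fun setT ((fun x => c%:E * G x) : cara -> \bar R).
  exact: (measurable_funeM _ mG).
have wI : power_integral nu p setT (norm w) <= (b / 2)%:E.
  apply: (@le_trans _ _ (power_integral nu p setT ((norm u) \_ A))).
    have mr : measurable_fun setT ((norm u) \_ A : cara -> \bar R) := cara_measurable_restrict mA' mn.
    apply: (power_integral_le nu p1 measurableT (measurable_norm_EFin mw) mr).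
      by move=> x _; rewrite lee_fin.
    move=> x _; rewrite patchE; case: ifPn => [_|]; first by rewrite lee_fin.
    by rewrite notin_setE => /wA ->; rewrite normr0.
  rewrite (power_integral_restrict nu p1) setTI; apply: ltW; apply: hd1 => //.
  by apply: lt_le_trans nuA _; rewrite lee_fin ge_min lexx.
have AI : power_integral nu p setT (G \_ A) <= b1%:E.
  rewrite (power_integral_restrict nu p1) setTI; apply: ltW; apply: hd2 => //.
  by apply: lt_le_trans nuA _; rewrite lee_fin ge_min lexx orbT.
have cI : power_integral nu p setT (fun x => c%:E * G x) <= b1%:E.
  rewrite (power_integralZ nu p measurableT mG (fun x _ => bG.2 x) (ltW c0)).
  apply: (@le_trans _ _ ((c `^ p)%:E * a%:E)).
    by apply: lee_wpmul2l => //; rewrite lee_fin powR_ge0.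
  rewrite -EFinM lee_fin; apply: (@le_trans _ _ ((b / 4 / c2 / (a + 1)) * a)%R).
    by rewrite ler_wpM2r.
  have -> : (b / 4 / c2 / (a + 1) * a = b1 * (a / (a + 1)))%R.
    by rewrite /b1; field; rewrite !gt_eqF.
  by rewrite ler_piMr ?(ltW b10)// ler_pdivrMr// mul1r lerDl.
have gI := power_integralD nu p1 measurableT mGA mcG GA0 cG0.
apply: le_trans (leeD wI (le_trans gI _)) _.
  by apply: lee_wpmul2l (leeD AI cI); rewrite lee_fin powR_ge0.
have E2 : c2%:E * (b1%:E + b1%:E) = (b / 2)%:E.
  by rewrite -EFinD -EFinM; congr EFin; rewrite /b1; field; rewrite gt_eqF.
by rewrite -/c2 E2 -EFinD lee_fin -splitr.
Qed.

Lemma bounded_approximation_sum (h u : X -> R) (w : nat -> X -> R) (G : nat -> X -> \bar R) b :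
  measurable_fun setT (u : cara -> R) -> continuous h -> (0 < b)%R ->
  (forall x, exists N, forall n, (N <= n)%N -> (u x - h x = \sum_(j < n) w j x)%R) ->
  (forall j, measurable_fun setT (w j : cara -> R) /\
      [/\ borel_nonneg (G j), lip_upper_gradient (w j) (G j) &
      power_integral nu p setT (norm (w j)) + power_integral nu p setT (G j) <=
        (b / (2 ^ j.+1)%:R / (2 ^+ j.+1) `^ p)%:E]) ->
  energy_le mu p (fun x => u x - h x)%R b.
Proof.
move=> mu' ch b0 us hw.
have mh : measurable_fun setT (h : cara -> R) := borel_cara_fun (continuous_borel ch).
apply: (energy_le_series p1 (measurable_funB mu' mh) (ltW b0) _ us) => j.
by have [mw ?] := hw j; split; [exact: mw|exists (G j)].
Qed.

Hypotheses (hcomplete : locally_complete X) (sep : separable X)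
  (hmu : forall (x : X) (r : R), (0 < r)%R -> 0 < mu (ball x r : set (borel X)) < +oo).

Theorem newtonian_density : continuous_dense_in_N1p mu p.
Proof.
move=> f /(in_N1p_energy p1)[u [a [fE ua]]] e e0.
(* The truncation and the approximation contribute [b] each, and [2^p (b + b)] is half of [e^p]. *)
pose b : R := (e `^ p / 2 `^ p / 4)%R.
have c0 : (0 < 2 `^ p :> R)%R by rewrite powR_gt0.
have ep0 : (0 < e `^ p)%R by rewrite powR_gt0.
have b0 : (0 < b)%R by rewrite !divr_gt0.
have [M M0 uM] := truncation ua b0.
have [mu' [G [bG uG hG]]] := ua.
pose t x : R := clamp (- M) M (u x).
have mt : measurable_fun setT (t : cara -> R).
  exact: (continuous_comp_measurable (@clamp_continuous _ _) mu').
have tM x : (`|t x| <= M)%R.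
  by rewrite ler_norml; apply: clamp_itv; rewrite (le_trans _ (ltW M0))// oppr_le0 ltW.
have tG : lip_upper_gradient t G.
  by apply: lip_upper_gradient_contraction uG => x y; exact: clamp_lipschitz.
have Goo : power_integral nu p setT G < +oo.
  apply: le_lt_trans (ltry a); apply: le_trans hG.
  exact: (leeDr _ (power_integral_ge0 nu p setT _)).
have eps0 j : (0 < b / (2 ^ j.+1)%:R / (2 ^+ j.+1) `^ p)%R.
  by rewrite !divr_gt0 ?powR_gt0 ?exprn_gt0// ltr0n expn_gt0.
have [h [w [v [Gs [H [ch us hw _]]]]]] :=
  approximation_decomposition hcomplete sep hmu p1 M0 tM mt bG tG Goo eps0.
have th := bounded_approximation_sum mt ch b0 us hw.
have mh : measurable_fun setT (h : cara -> R) := borel_cara_fun (continuous_borel ch).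
have uh : energy_le mu p (fun x => u x - h x)%R (2 `^ p * (b + b)).
  have E1 (a1 b1 c1 : R) : (a1 - c1 = (a1 - b1) + (b1 - c1))%R by ring.
  have E2 (a1 b1 c1 a2 b2 c2 : R) :
      ((a1 - c1) - (a2 - c2) = ((a1 - b1) - (a2 - b2)) + ((b1 - c1) - (b2 - c2)))%R by ring.
  apply: (energy_leD p1 uM th (measurable_funB mu' mh)) => [x|x y].
    by apply: le_trans (ler_normD _ _); rewrite -(E1 (u x) (t x) (h x)).
  by apply: le_trans (ler_normD _ _); rewrite -(E2 (u x) (t x) (h x) (u y) (t y) (h y)).
exists h; split; first exact: ch.
  have E1 (a1 b1 : R) : (b1 = a1 - (a1 - b1))%R by ring.
  have E2 (a1 b1 a2 b2 : R) : (b1 - b2 = (a1 - a2) - ((a1 - b1) - (a2 - b2)))%R by ring.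
  apply: (energy_in_N1p p1 (energy_leD p1 ua uh mh _ _)) => [x|x y].
    by apply: le_trans (ler_normB _ _); rewrite -(E1 (u x) (h x)).
  by apply: le_trans (ler_normB _ _); rewrite -(E2 (u x) (h x) (u y) (h y)).
have -> : (fun x => f x - (h x)%:E) = EFin \o (fun x => u x - h x)%R by rewrite fE.
have hN := energy_N1p_norm p1 uh.
rewrite ltNge; apply/negP => eN.
have : e%:E `^ p <= (2 `^ p * (b + b))%:E.
  by apply: le_trans hN; apply: (poweR_le p1) => //; rewrite lee_fin ltW.
rewrite poweR_EFin lee_fin leNgt => /negP; apply.
have -> : (2 `^ p * (b + b) = e `^ p / 2)%R by rewrite /b; field; rewrite gt_eqF.
by rewrite ltr_pdivrMr// ltr_pMr// ltr1n.
Qed.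

End density.

(** * Suprema of functions and quasicontinuity *)

Section supremum.
Context {R : realType} {X : pmetricType R}.
Variable ws : nat -> X -> R.
Hypothesis ws01 : forall j x, 0 <= ws j x <= 1.
Let W x := sup (range (fun j => ws j x)).

Let has_sup_ws x : has_sup (range (fun j => ws j x)).
Proof.
split; first by exists (ws 0%N x), 0%N.
by exists 1 => _ [j _ <-]; case/andP: (ws01 j x).
Qed.

Lemma sup_family_ge j x : ws j x <= W x.
Proof. by apply: sup_upper_bound => //; exists j. Qed.

Lemma sup_family01 x : 0 <= W x <= 1.
Proof.
rewrite (le_trans _ (sup_family_ge 0%N x)); last by case/andP: (ws01 0%N x).
by apply: ge_sup => [|_ [j _ <-]]; [case: (has_sup_ws x)|case/andP: (ws01 j x)].
Qed.

Lemma sup_family_gt c x : c < W x -> exists j, c < ws j x.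
Proof. by move=> /(sup_gt (has_sup_ws x).1)[_ [j _ <-]] cj; exists j. Qed.

Lemma sup_family_lsc : (forall j c, open [set x | c < ws j x]) ->
  forall c, open [set x | c < W x].
Proof.
move=> ow c.
have -> : [set x | c < W x] = \bigcup_j [set x | c < ws j x].
  apply/seteqP; split => [x /= /sup_family_gt[j hj]|x [j _ /= hj]]; first by exists j.
  exact: lt_le_trans hj (sup_family_ge _ _).
by apply: bigcup_open => j _; exact: ow.
Qed.

Lemma sup_family_dist x y (e : R) : 0 < e -> exists j, `|W x - W y| <= `|ws j x - ws j y| + e.
Proof.
have key x' y' (d : R) : 0 < d -> W y' <= W x' ->
    exists j, `|W x' - W y'| <= `|ws j x' - ws j y'| + d.
  move=> d0 yx; have [|j hj] := @sup_family_gt (W x' - d) x'; first by rewrite gtrBl.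
  exists j; rewrite ger0_norm ?subr_ge0//.
  have := ler_norm (ws j x' - ws j y'); have := sup_family_ge j y'.
  move: (W x') (W y') hj => a b; lra.
move=> e0; have [yx|xy] := leP (W y) (W x); first exact: key.
have [j hj] := key _ _ _ e0 (ltW xy); exists j.
by rewrite distrC (distrC (ws j x)).
Qed.

Lemma sup_family_esup x : (`|W x|%:E <= esup_fun (fun j x => `|ws j x|%:E) x)%E.
Proof.
have /andP[w0 _] := sup_family01 x; rewrite ger0_norm//.
apply/lee_addgt0Pr => e e0.
have [|j hj] := @sup_family_gt (W x - e) x; first by rewrite gtrBl.
apply: (@le_trans _ _ ((ws j x)%:E + e%:E)%E).
  by rewrite -EFinD lee_fin; lra.
apply: leeD2r; apply: le_trans (esup_fun_ge _ j x).
by rewrite lee_fin ler_norm.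
Qed.

End supremum.

Section quasicontinuity.
Context {R : realType} {X : pmetricType R}.
Variables (mu : {measure set (borel X) -> \bar R}) (p : R).
Local Notation cara := (caratheodory_type (mu^*)%mu).
Local Notation nu := (@completed_measure_extension _ _ _ mu).
Local Notation norm u := (fun x => `|u x|%:E).
Local Open Scope ereal_scope.
Hypothesis p1 : (1 <= p)%R.

Lemma energy_le_sup (ws : nat -> X -> R) (b : R) : (0 <= b)%R ->
  (forall j x, 0 <= ws j x <= 1)%R -> (forall j c, open [set x | (c < ws j x)%R]) ->
  (forall j, energy_le mu p (ws j) (b / (2 ^ j.+1)%:R)) ->
  energy_le mu p (fun x => sup (range (fun j => ws j x))) b.
Proof.
move=> b0 w01 ow hw.
have mW := borel_cara_fun (mu := mu) (lsc_borel (sup_family_lsc w01 ow)).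
exact: (energy_le_esup p1 mW b0 hw (sup_family_esup w01) (sup_family_dist w01)).
Qed.

(** For nonnegative [v] this is a test function for the capacity of the set where [v > 1 / c]: it
    equals 1 there. *)
Let cap (c : R) (v : X -> R) x := Num.min 1%R (c * v x)%R.

Let cap01 c v : (0 <= c)%R -> (forall x, 0 <= v x)%R -> forall x, (0 <= cap c v x <= 1)%R.
Proof. by move=> c0 v0 x; rewrite /cap le_min ler01 mulr_ge0//= ge_min lexx. Qed.

Let cap_lsc c v : (0 < c)%R -> (forall d, open [set x | (d < v x)%R]) ->
  forall d, open [set x | (d < cap c v x)%R].
Proof.
move=> c0 ov d; have [d1|d1] := ltP d 1%R.
  rewrite (_ : [set x | _] = [set x | (d / c < v x)%R]); first exact: ov.
  by apply/seteqP; split => x; rewrite /cap /= lt_min d1/= ltr_pdivrMr// mulrC.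
rewrite (_ : [set x | _] = set0); first exact: open0.
by rewrite -subset0 => x; rewrite /cap /= lt_min ltNge d1.
Qed.

Let cap_energy c v b : (0 < c)%R -> (forall x, 0 <= v x)%R ->
  (forall d, open [set x | (d < v x)%R]) ->
  energy_le mu p v (b / c `^ p)%R -> energy_le mu p (cap c v) b.
Proof.
move=> c0 v0 ov hv.
have hc := energy_leZ (ltW c0) hv.
have cb : (c `^ p * (b / c `^ p) = b)%R by rewrite mulrC divfK// gt_eqF// powR_gt0.
rewrite cb in hc.
have mc := borel_cara_fun (mu := mu) (lsc_borel (cap_lsc c0 ov)).
apply: (energy_le_contraction p1 hc mc) => [x|x y].
  have /andP[h0 h1] := cap01 (ltW c0) v0 x.
  by rewrite !ger0_norm ?mulr_ge0 ?(ltW c0)// ge_min lexx orbT.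
exact: dist_min_le.
Qed.

Hypotheses (hcomplete : locally_complete X) (sep : separable X)
  (hmu : forall (x : X) (r : R), (0 < r)%R -> 0 < mu (ball x r : set (borel X)) < +oo).

(** Written through [s - t] and [|t| - |s|], the numerator of the difference is at most
    [|s - t| (1 + |s| + |t|)] in absolute value. The map is an injective contraction into (-1, 1):
    it makes a function bounded while its values can be recovered. *)
Lemma squash_contraction (s t : R) : (`|s / (1 + `|s|) - t / (1 + `|t|)| <= `|s - t|)%R.
Proof.
have s1 : (0 < 1 + `|s|)%R by rewrite ltr_pwDl.
have t1 : (0 < 1 + `|t|)%R by rewrite ltr_pwDl.
have -> : (s / (1 + `|s|) - t / (1 + `|t|) =
    (s * (1 + `|t|) - t * (1 + `|s|)) / ((1 + `|s|) * (1 + `|t|)))%R.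
  by field; rewrite !gt_eqF.
rewrite normrM normfV (gtr0_norm (mulr_gt0 s1 t1)) ler_pdivrMr ?mulr_gt0//.
have -> : (s * (1 + `|t|) - t * (1 + `|s|) =
    (s - t) * (1 + (`|s| + `|t|) / 2) + (s + t) * ((`|t| - `|s|) / 2))%R by field.
have h1 : (`| `|t| - `|s| | <= `|s - t|)%R by rewrite (distrC s); exact: ler_dist_dist.
have h2 : (`|s + t| <= `|s| + `|t|)%R := ler_normD s t.
have h3 : (0 <= 1 + (`|s| + `|t|) / 2)%R by rewrite addr_ge0 ?divr_ge0 ?addr_ge0.
apply: le_trans (ler_normD _ _) _; rewrite !normrM (ger0_norm h3) normfV (@ger0_norm _ 2%R)//.
have h4 : (`|s + t| * `| `|t| - `|s| | <= (`|s| + `|t|) * `|s - t|)%R by rewrite ler_pM.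
have h5 : (0 <= `|s - t| * (`|s| * `|t|))%R by rewrite !mulr_ge0.
nra.
Qed.

Theorem newtonian_quasicontinuous f : in_N1p mu p f -> quasicontinuous mu p f.
Proof.
move=> /(in_N1p_energy p1)[u [a [fE ua]]] e e0.
have [mu' [G [bG uG hG]]] := ua.
pose f1 x : R := (u x / (1 + `|u x|))%R.
have den x : (0 < 1 + `|u x|)%R by rewrite ltr_pwDl.
have f1M x : (`|f1 x| <= 1)%R.
  by rewrite normrM normfV (gtr0_norm (den x)) ler_pdivrMr// mul1r lerDr.
have mf1 : measurable_fun setT (f1 : cara -> R).
  have cpsi : continuous (fun t : R => t / (1 + `|t|))%R; last first.
    exact: (continuous_comp_measurable cpsi mu').
  move=> t; apply/cvgrPdist_lt => d d0; apply/nbhs_ballP; exists d => // s /= hs.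
  exact: le_lt_trans (squash_contraction _ _) hs.
have f1G : lip_upper_gradient f1 G.
  by apply: lip_upper_gradient_contraction uG => x y; exact: squash_contraction.
have Goo : power_integral nu p setT G < +oo.
  apply: le_lt_trans (ltry a); apply: le_trans hG.
  exact: (leeDr _ (power_integral_ge0 nu p setT _)).
pose b : R := (e / 2)%R.
have b0 : (0 < b)%R by rewrite divr_gt0.
(* The reciprocals of the [c k j] sum over [j] to [2^(-k)], the distance allowed between [f1] and
   the continuous [h k] off the exceptional set. *)
pose c k j : R := (2 ^+ (j.+1 + k))%R.
have c0 k j : (0 < c k j)%R by rewrite exprn_gt0.
(* The divisors pay for the suprema over [k] and over [j] and for the factor [c k j] inside
   [cap]. *)
pose eps k j : R := (b / (2 ^ k.+1)%:R / (2 ^ j.+1)%:R / (c k j) `^ p)%R.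
have b2 k : (0 < b / (2 ^ k.+1)%:R)%R by rewrite divr_gt0// ltr0n expn_gt0.
have eps0 k j : (0 < eps k j)%R.
  by rewrite divr_gt0 ?powR_gt0// divr_gt0// ltr0n expn_gt0.
have /choice[h hP] : forall k, exists h, continuous (h : X -> R) /\ exists v : nat -> X -> R,
    (forall j, [/\ forall d, open [set x | (d < v j x)%R], forall x, (0 <= v j x)%R &
      energy_le mu p (v j) (eps k j)]) /\
    (forall x, exists N, `|f1 x - h x| <= \sum_(j < N) v j x)%R.
  move=> k; have [h [w [v [Gs [H [ch us hw hv]]]]]] :=
    approximation_decomposition hcomplete sep hmu p1 ltr01 f1M mf1 bG f1G Goo (eps0 k).
  exists h; split => //; exists v; split => [j|x].
    have [ov wv bH vH vI] := hv j.
    have v0 x : (0 <= v j x)%R by exact: le_trans (wv x).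
    split; [exact: ov|exact: v0|split; first exact: borel_cara_fun (lsc_borel ov)].
    exists (H j); split; [exact: bH|exact: vH|].
    have -> // : (fun x => `|v j x|%:E) = (fun x => (v j x)%:E).
    by apply/funext => x; rewrite ger0_norm.
  have [N hN] := us x; exists N; rewrite (hN N)//.
  apply: le_trans (ler_norm_sum _ _ _) _; apply: ler_sum => j _.
  by have [_ wv _ _ _] := hv j; exact: wv.
have {hP}[ch /choice[v hv]] := all_and2 hP.
have ov k j d : open [set x | (d < v k j x)%R] by have [/(_ j)[]] := hv k.
have v0 k j x : (0 <= v k j x)%R by have [/(_ j)[]] := hv k.
have vE k j : energy_le mu p (v k j) (eps k j) by have [/(_ j)[]] := hv k.
have fv k x : exists N, (`|f1 x - h k x| <= \sum_(j < N) v k j x)%R by have [_] := hv k; exact.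
pose ws k j := cap (c k j) (v k j).
have ws01 k j x : (0 <= ws k j x <= 1)%R by exact: cap01 (ltW (c0 k j)) (v0 k j) x.
have wsl k j d : open [set x | (d < ws k j x)%R] by exact: cap_lsc.
pose W k x := sup (range (fun j => ws k j x)).
have W01 k x : (0 <= W k x <= 1)%R := sup_family01 (ws01 k) x.
have Wl k d : open [set x | (d < W k x)%R] := sup_family_lsc (ws01 k) (wsl k) d.
have WE k : energy_le mu p (W k) (b / (2 ^ k.+1)%:R).
  exact: (energy_le_sup (ltW (b2 k)) (ws01 k) (wsl k)
    (fun j => cap_energy (c0 k j) (v0 k j) (ov k j) (vE k j))).
pose U x := sup (range (fun k => W k x)).
have UE : energy_le mu p U b := (energy_le_sup (ltW b0) W01 Wl WE).
(* Where some [v k j] exceeds the reciprocal of [c k j], the function [ws k j] is 1; hence [U >= 1]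
   on [O], and [U] bounds the capacity of [O]. *)
pose O : set X := \bigcup_k \bigcup_j [set x | ((c k j)^-1 < v k j x)%R].
have oO : open O by apply: bigcup_open => k _; apply: bigcup_open => j _; exact: ov.
have OU x : O x -> 1 <= (EFin \o U) x.
  move=> [k _ [j _ /= hx]]; rewrite lee_fin.
  apply: le_trans (sup_family_ge W01 k x); apply: le_trans (sup_family_ge (ws01 k) j x).
  by rewrite /ws /cap le_min lexx/= -(mulfV (lt0r_neq0 (c0 k j))) ler_pM2l// ltW.
exists O; split; first exact: oO.
  apply: (@le_lt_trans _ _ b%:E); last by rewrite lte_fin /b ltr_pdivrMr// ltr_pMr// ltr1n.
  apply: le_trans (energy_N1p_norm p1 UE).
  apply: ereal_inf_lbound; exists (EFin \o U); last by [].
  by split; [exact: (energy_in_N1p p1 UE)|exact: OU].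
have unif k x : ~ O x -> (`|f1 x - h k x| <= (2 ^+ k)^-1)%R.
  move=> nO; have [N hN] := fv k x; apply: le_trans hN _.
  have vc j : (v k j x <= (c k j)^-1)%R.
    by rewrite leNgt; apply/negP => hj; apply: nO; exists k => //; exists j.
  apply: (@le_trans _ _ (\sum_(j < N) (c k j)^-1)%R); first by apply: ler_sum => j _.
  have -> : (\sum_(j < N) (c k j)^-1 = (2 ^+ k)^-1 * (1 - (2 ^+ N)^-1))%R.
    elim: N => [|n IH]; first by rewrite big_ord0 expr0 invr1 subrr mulr0.
    rewrite big_ord_recr/= IH /c exprD exprS; field.
    by rewrite !expf_neq0.
  by rewrite ler_piMr ?invr_ge0 ?exprn_ge0// gerBl invr_ge0 exprn_ge0.
have cf1 x : ~ O x -> f1 @ within (~` O) (nbhs x) --> f1 x.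
  move=> nO; apply/cvgrPdist_lt => d d0.
  have [k hk] : exists k, ((2 ^+ k)^-1 < d / 3)%R.
    have d3 : (0 < d / 3)%R by rewrite divr_gt0.
    have /ltr_add_invr[k] := d3; rewrite add0r => hk; exists k; apply: le_lt_trans hk.
    by rewrite lef_pV2 ?posrE ?exprn_gt0// -natrX ler_nat ltn_expl.
  have /cvgrPdist_lt/(_ (d / 3)%R) := ch k x; rewrite divr_gt0// => /(_ isT) hx.
  apply: filterS hx => y hy nOy.
  have h1 := unif k x nO; have h2 := unif k y nOy.
  have -> : (f1 x - f1 y = (f1 x - h k x) + (h k x - h k y) - (f1 y - h k y))%R by ring.
  apply: le_lt_trans (ler_normB _ _) _; apply: le_lt_trans (lerD (ler_normD _ _) (lexx _)) _.
  by move: h1 h2 hk; move: ((2 ^+ k)^-1)%R => q h1 h2 hk; lra.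
have f1lt x : (`|f1 x| < 1)%R.
  by rewrite normrM normfV (gtr0_norm (den x)) ltr_pdivrMr// mul1r ltrDr.
have uE x : u x = (f1 x / (1 - `|f1 x|))%R.
  have d0 := den x; rewrite normrM normfV (gtr0_norm d0) /f1.
  have -> : (1 - `|u x| / (1 + `|u x|) = (1 + `|u x|)^-1)%R by field; rewrite gt_eqF.
  by rewrite invrK divfK// gt_eqF.
apply/subspace_continuousP => x nO; rewrite fE.
apply: cvg_EFin; first exact: nearW.
rewrite (_ : fine \o _ = (fun r : R => r / (1 - `|r|))%R \o f1); last first.
  by apply/funext => y; rewrite /= uE.
rewrite (uE x); apply: (cvg_comp _ _ (cf1 x nO)).
apply: cvgM; first exact: cvg_id.
apply: cvgV; first by rewrite subr_eq0 eq_sym lt_eqF.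
by apply: cvgB; [exact: cvg_cst|apply: cvg_norm; exact: cvg_id].
Qed.

End quasicontinuity.

Theorem theorem1p6 (R : realType) (X : pmetricType R)
    (mu : {measure set (borel X) -> \bar R}) (p : R)
    (hcomplete : locally_complete X) (hseparable : separable X)
    (hmu : forall (x : X) (r : R), 0 < r ->
       (0%:E < mu (ball x r) < +oo)%E)
    (hp : 1 <= p) :
  continuous_dense_in_N1p mu p /\
  (forall f : X -> \bar R, in_N1p mu p f -> quasicontinuous mu p f).
Proof.
split; first exact: newtonian_density hp hcomplete hseparable hmu.
by move=> f; exact: newtonian_quasicontinuous hp hcomplete hseparable hmu f.
Qed.
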